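(* $p_H^\Psi(t,x)$ is a mild solution of the equation $$\partial_t^\Psi v(t,x)=\frac12\,Gv(t,x)$$ in $(0,+\infty)\times\mathbb{R}^*$.
   Context: Notation: $\mathbf{H}^*=\{\lambda\in\mathbb{C}:\Re(\lambda)>0\}$, $\mathbb{R}^*=\mathbb{R}\setminus\{0\}$; $\mathcal{L}[f(\cdot)](\lambda)=\int_0^{+\infty}e^{-\lambda t}f(t)\,dt$ is the Laplace transform in $t$, $\mathcal{L}^{-1}$ its inverse. Fix $H\in(\frac12,1)$ and $\theta>0$. The fractional Ornstein-Uhlenbeck process $U_H(t)=e^{-t/\theta}\int_0^t e^{s/\theta}\,dB^H(s)$ ($B^H$ a fractional Brownian motion with Hurst index $H$) is centered Gaussian with variance $$V_{2,H}(t)=H(2H-1)\theta^{2H}\int_0^{t/\theta}\int_0^{t/\theta}e^{-s-u}|u-s|^{2H-2}\,du\,ds$$ and density $p_H(t,x)=\frac{1}{\sqrt{2\pi V_{2,H}(t)}}e^{-x^2/(2V_{2,H}(t))}$, $t>0$. The transform $\mathcal{L}[V'_{2,H}(\cdot)](\lambda)$ is defined for $\Re(\lambda)>-\frac1\theta$. Let $\sigma$ be a driftless subordinator with Lévy measure $\nu$ on $(0,+\infty)$, $\int_0^{+\infty}(1\wedge x)\nu(dx)<+\infty$, $\nu(0,+\infty)=+\infty$, so $\mathbb{E}[e^{-\lambda\sigma(y)}]=e^{-y\Psi(\lambda)}$ with $\Psi(\lambda)=\int_0^{+\infty}(1-e^{-\lambda x})\nu(dx)$, which is holomorphic on $\mathbf{H}^*$.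 Put $\nu_\infty(t)=\nu(t,+\infty)$, $t>0$. Let $E(t)=\inf\{y>0:\sigma(y)>t\}$, independent of $U_H$, with probability density function $f_E(t,\cdot)$ for $t>0$. The time-changed process is $U_H^\Psi(t)=U_H(E(t))$, and $p_H^\Psi(t,x)$ denotes its probability density function. Assume $\mathbb{E}[E^{-H}(t)]<+\infty$ for any $t>0$; then $p_H^\Psi(t,x)$ exists for all $t>0$ and satisfies $p_H^\Psi(t,x)=\int_0^{+\infty}p_H(y,x)f_E(t,y)\,dy$. Moreover $p_H^\Psi(0,x)=0$ for $x\in\mathbb{R}^*$. Operator $\hat L$: fix $c_1<0<c_2$ with $c_1-c_2>-\frac1\theta$. Let $Z$ be the (at most countable) set of zeros of $\Psi'$ in $\mathbf{H}^*$; local inverses of $\Psi$ are denoted $\Psi^{-1}$. Let $I\subseteq\mathbb{R}$ and $v:\mathbf{H}^*\times I\to\mathbb{C}$. Then $v\in\mathcal{D}(\hat L,I)$ if for all $\lambda\in\mathbf{H}^*$, $x\in I$ and for any $z\in\mathbb{R}$ such that $c_2+iz\notin Z$, the quantity $\frac{\Psi^{-1}(c_2+iz)}{c_2+iz}v(\Psi^{-1}(c_2+iz),x)$ is independent of the choice of the local inverse map $\Psi^{-1}$ of $\Psi$ in $c_2+iz$, and $$\hat{L}v(\lambda,x):=\frac{1}{4\pi^2}\int_0^{+\infty}e^{-\Psi(\lambda)t}\lim_{R_2\to+\infty}\int_{-\infty}^{+\infty}e^{(c_1+iw)t}\int_{-R_2}^{R_2}\mathcal{L}[V'_{2,H}(\cdot)](c_1-c_2+i(w-z))\,\frac{\Psi^{-1}(c_2+iz)}{c_2+iz}\,v(\Psi^{-1}(c_2+iz),x)\,dz\,dw\,dt$$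 is well defined, i.e. is some complex number. Generalized Caputo derivative: $\partial_t^\Psi v(t)=\frac{d}{dt}\int_0^t\nu_\infty(t-\tau)(v(\tau)-v(0))\,d\tau$, for $v$ in a certain function space. Operator $G$: let $v:[0,+\infty)\times I\to\mathbb{R}$ be such that $\overline v(\lambda,x)=\mathcal{L}[v(\cdot,x)](\lambda)$ is well defined for $x\in I$ and $\lambda\in\mathbf{H}^*$, $\overline v\in\mathcal{D}(\hat L,I)$, and $\frac{\partial^2}{\partial x^2}\hat L\overline v(\lambda,x)$ is well defined for any $x\in I$, $\lambda\in\mathbf{H}^*$ and is the Laplace transform of some $L^\infty$ function. On such functions $$Gv(t,x)=\left[\nu_\infty*\mathcal{L}^{-1}_{\lambda\to t}\left[\frac{\partial^2}{\partial x^2}\hat L\overline v(\lambda,x)\right]\right](t).$$ Mild solution: $v:(0,+\infty)\times I\to\mathbb{R}$ with $I\subset\mathbb{R}$ is a mild solution of $\partial_t^\Psi v=\frac12Gv$ if $v$ admits a Laplace transform $\overline v(\lambda,x)=\mathcal{L}[v(\cdot,x)](\lambda)$ for $\lambda\in\mathbf{H}^*$, and $\overline v(\lambda,x)$ is a solution of $$\Psi(\lambda)\overline v(\lambda,x)-\frac{\Psi(\lambda)}{\lambda}v(0,x)=\frac{\Psi(\lambda)}{2\lambda}\frac{\partial^2}{\partial x^2}\hat L\overline v(\lambda,x),\qquad\lambda\in\mathbf{H}^*,\ x\in I.$$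
   Formalization: Where Ψ has no local inverse at c₂+iz with values in H* (e.g. Ψ(λ)=√λ, |z|>c₂), the quantity Ψ⁻¹(c₂+iz)/(c₂+iz)·v(Ψ⁻¹(c₂+iz),x) in L̂ is undefined; it is read there as the analytic continuation to H* of the function of c₂+iz that it defines where local inverses exist. *)

(* Defs.v *)
From HB Require Import structures.
From mathcomp Require Import all_boot all_order all_algebra.
From mathcomp Require Export complex.
From mathcomp Require Import all_classical all_reals all_analysis.

Set Implicit Arguments.
Unset Strict Implicit.
Unset Printing Implicit Defensive.

Import Order.TTheory GRing.Theory Num.Theory.
Import numFieldNormedType.Exports.

Local Open Scope classical_set_scope.
Local Open Scope complex_scope.
Local Open Scope ring_scope.

Section ComplexAnalysis.
Context {R : realType}.

Definition cexp (z : R[i]) : R[i] :=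
  (expR (complex.Re z) * cos (complex.Im z)) +i* (expR (complex.Re z) * sin (complex.Im z)).

Section Integral.
Context d (T : measurableType d) (mu : {measure set T -> \bar R}).

Definition cintegrable (D : set T) (f : T -> R[i]) : Prop :=
  mu.-integrable D (fun x => (complex.Re (f x))%:E) /\
  mu.-integrable D (fun x => (complex.Im (f x))%:E).

(* Only meaningful under [cintegrable D f]. *)
Definition cintegral (D : set T) (f : T -> R[i]) : R[i] :=
  (\int[mu]_(x in D) complex.Re (f x)) +i* (\int[mu]_(x in D) complex.Im (f x)).

End Integral.

Definition Hstar : set R[i] := [set l | 0 < complex.Re l].

Definition laplace_integrand (f : R -> R) (l : R[i]) (t : R) : R[i] :=
  cexp (- l * t%:C) * (f t)%:C.

Definition has_laplace (f : R -> R) (l : R[i]) : Prop :=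
  cintegrable lebesgue_measure `]0, +oo[ (laplace_integrand f l).

Definition laplace (f : R -> R) (l : R[i]) : R[i] :=
  cintegral lebesgue_measure `]0, +oo[ (laplace_integrand f l).

(* Complex differentiability: the field [R[i]] is a normed module over itself
   as [R[i]^o], so this is a limit of complex difference quotients. *)
Definition cdifferentiable (f : R[i] -> R[i]) (z : R[i]) : Prop :=
  derivable (f : R[i]^o -> R[i]^o) z 1.

Definition cderive (f : R[i] -> R[i]) (z : R[i]) : R[i] :=
  'D_1 (f : R[i]^o -> R[i]^o) z.

Definition is_derive2 (f : R -> R) (x l : R) : Prop :=
  (\forall y \near x, derivable f y 1) /\ is_derive x 1 (derive1 f) l.

Definition is_cderive2 (f : R -> R[i]) (x : R) (l : R[i]) : Prop :=
  is_derive2 (fun y => complex.Re (f y)) x (complex.Re l) /\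
  is_derive2 (fun y => complex.Im (f y)) x (complex.Im l).

End ComplexAnalysis.

Section Processes.
Context {R : realType} d (Omega : measurableType d) (P : probability Omega R).

Definition is_pdf (X : Omega -> R) (f : R -> R) : Prop :=
  [/\ measurable_fun setT f, forall x, 0 <= f x &
      forall A : set R, measurable A ->
        P (X @^-1` A) = (\int[lebesgue_measure]_(x in A) (f x)%:E)%E].

(* The library's [normal_prob m 0] is not the Dirac mass at [m]. *)
Definition gaussian_law (m s : R) (A : set R) : \bar R :=
  if s == 0 then \d_m A else normal_prob m s A.

Definition gaussian_process (X : R -> {RV P >-> R}) : Prop :=
  forall (n : nat) (t a : 'I_n -> R), (forall i, 0 <= t i) ->
    exists m s : R, forall A : set R, measurable A ->
      P ((fun w => \sum_(i < n) a i * X (t i) w) @^-1` A) = gaussian_law m s A.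

Definition fractional_brownian_motion (H : R) (B : R -> {RV P >-> R}) : Prop :=
  [/\ gaussian_process B,
      forall t : R, 0 <= t -> ('E_P[B t] = 0)%E,
      forall s t : R, 0 <= s -> 0 <= t ->
        covariance P (B s) (B t) =
          (2^-1 * (s `^ (2 * H) + t `^ (2 * H) - `|t - s| `^ (2 * H)))%:E &
      forall w, {within `[0, +oo[, continuous (fun t : R => B t w)}].

(* Riemann-Stieltjes sums of [f] against [g] on [[0, t]] for the uniform
   partition; for [f] of bounded variation and [g] continuous they converge to
   the Riemann-Stieltjes integral. *)
Definition stieltjes_sum (f g : R -> R) (t : R) (n : nat) : R :=
  \sum_(k < n) f (k%:R * t / n%:R) *
    (g (k.+1%:R * t / n%:R) - g (k%:R * t / n%:R)).

Definition stieltjes_integral (f g : R -> R) (t : R) : R :=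
  lim (stieltjes_sum f g t n @[n --> \oo]).

Definition fractional_ou (theta : R) (B : R -> Omega -> R) (t : R)
    (w : Omega) : R :=
  expR (- t / theta) *
  stieltjes_integral (fun s => expR (s / theta)) (fun s => B s w) t.

(* Independence of the sigma-algebras generated by two processes, on the
   generating pi-systems of finite-dimensional cylinders. *)
Definition independent_processes (X Y : R -> Omega -> R) : Prop :=
  forall (n m : nat) (s : 'I_n -> R) (t : 'I_m -> R)
    (A : 'I_n -> set R) (A' : 'I_m -> set R),
    (forall i, 0 <= s i) -> (forall j, 0 <= t j) ->
    (forall i, measurable (A i)) -> (forall j, measurable (A' j)) ->
    let EX := \bigcap_(i in [set: 'I_n]) (X (s i) @^-1` A i) in
    let EY := \bigcap_(j in [set: 'I_m]) (Y (t j) @^-1` A' j) in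
    P (EX `&` EY) = (P EX * P EY)%E.

Definition levy_measure (nu : {measure set R -> \bar R}) : Prop :=
  nu [set` `]-oo, 0]] = 0%E /\
  (\int[nu]_(x in `]0%R, +oo[) (Num.min 1 x)%:E < +oo)%E.

Definition laplace_exponent (nu : {measure set R -> \bar R}) (l : R[i]) : R[i] :=
  cintegral nu `]0, +oo[ (fun x => 1 - cexp (- l * x%:C)).

Definition driftless_subordinator (nu : {measure set R -> \bar R})
    (sigma : R -> {RV P >-> R}) : Prop :=
  [/\ forall w, sigma 0 w = 0,
      forall w (s t : R), 0 <= s -> s <= t -> sigma s w <= sigma t w,
      forall w (t : R), 0 <= t -> sigma s w @[s --> t^'+] --> sigma t w &
    [/\ forall (n : nat) (t : nat -> R) (A : nat -> set R),
        0 <= t 0 -> (forall i, t i <= t i.+1) -> (forall i, measurable (A i)) ->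
        P (\bigcap_(i < n)
            ((fun w => sigma (t i.+1) w - sigma (t i) w) @^-1` A i)) =
        (\prod_(i < n)
           fine (P ((fun w => sigma (t i.+1) w - sigma (t i) w) @^-1` A i)))%:E,
      forall (s t : R) (A : set R), 0 <= s -> 0 <= t -> measurable A ->
        P ((fun w => sigma (s + t) w - sigma s w) @^-1` A) =
        P (sigma t @^-1` A) &
      forall (y : R) (l : R[i]), 0 <= y -> Hstar l ->
        cintegral P setT (fun w => cexp (- l * (sigma y w)%:C)) =
        cexp (- y%:C * laplace_exponent nu l)]].

Definition inverse_process (sigma : R -> Omega -> R) (t : R) (w : Omega) : R :=
  inf [set y | 0 < y /\ t < sigma y w].

End Processes.

Section Kernel.
Context {R : realType} (H theta : R).

Definition ou_variance (t : R) : R :=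
  H * (2 * H - 1) * theta `^ (2 * H) *
  \int[lebesgue_measure]_(s in `[0, t / theta])
    \int[lebesgue_measure]_(u in `[0, t / theta])
      (expR (- s - u) * `|u - s| `^ (2 * H - 2)).

Definition ou_density (t x : R) : R :=
  (Num.sqrt (2 * pi * ou_variance t))^-1 *
  expR (- (x ^+ 2) / (2 * ou_variance t)).

End Kernel.

Section Operator.
Context {R : realType} (H theta c1 c2 : R) (Psi : R[i] -> R[i]).
Implicit Types (v : R[i] -> R -> R[i]) (g : R[i] -> R[i]).

Definition critical_points : set R[i] :=
  [set l | Hstar l /\ cderive Psi l = 0].

Definition local_inverse (mu : R[i]) g : Prop :=
  \forall z \near (mu : R[i]^o),
    [/\ Hstar (g z), Psi (g z) = z & cdifferentiable g z].

Definition symbol v (x : R) g (mu : R[i]) : R[i] := g mu / mu * v (g mu) x.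

(* [q] is the value at [mu] of the possibly multivalued expression
   [symbol v x Psi^-1 mu]: all local inverses of [Psi] at [mu] have to give the
   same value [q].  [Psi] need not map [Hstar] onto [Hstar] (for
   [Psi l = l ^ a] with [0 < a < 1] the range is a sector) so there may be no
   local inverse at [mu]; the expression is then understood as the analytic
   continuation to [Hstar] of the function of [mu] it defines. *)
Definition symbol_value v (x : R) (mu q : R[i]) : Prop :=
  (forall g, local_inverse mu g -> q = symbol v x g mu) /\
  ((forall g, ~ local_inverse mu g) ->
    exists F : R[i] -> R[i],
      [/\ forall z, Hstar z -> cdifferentiable F z,
          forall z g, Hstar z -> local_inverse z g -> F z = symbol v x g z &
          q = F mu]).

Definition Lhat_inner (Q : R -> R[i]) (w z : R) : R[i] :=
  laplace (derive1 (ou_variance H theta)) ((c1 - c2) +i* (w - z)) * Q z.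

Definition Lhat_middle (Q : R -> R[i]) (t R2 w : R) : R[i] :=
  cexp ((c1 +i* w) * t%:C) *
  cintegral lebesgue_measure `[- R2, R2] (Lhat_inner Q w).

(* [Lhat v l x] is well defined with value [y]; [J t] is the limit in [R2]. *)
Definition is_Lhat_at v (l : R[i]) (x : R) (y : R[i]) : Prop :=
  exists (Q J : R -> R[i]),
    [/\ forall z, ~ critical_points (c2 +i* z) ->
          symbol_value v x (c2 +i* z) (Q z),
        forall R2 w : R, 0 < R2 ->
          cintegrable lebesgue_measure `[- R2, R2] (Lhat_inner Q w),
        forall t R2 : R, 0 < t -> 0 < R2 ->
          cintegrable lebesgue_measure setT (Lhat_middle Q t R2),
        forall t : R, 0 < t ->
          cintegral lebesgue_measure setT (Lhat_middle Q t R2)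
            @[R2 --> +oo%R] --> (J t : R[i]^o) &
        cintegrable lebesgue_measure `]0, +oo[
          (fun t => cexp (- Psi l * t%:C) * J t) /\
        y = ((4 * pi ^+ 2)^-1)%:C *
          cintegral lebesgue_measure `]0, +oo[
            (fun t => cexp (- Psi l * t%:C) * J t)].

(* [v] belongs to the domain of [Lhat] on [I], and [Lhat v = Lv] there. *)
Definition is_Lhat (I : set R) v (Lv : R[i] -> R -> R[i]) : Prop :=
  forall l x, Hstar l -> I x -> is_Lhat_at v l x (Lv l x).

Definition mild_solution (I : set R) (v : R -> R -> R) : Prop :=
  let vbar := fun l x => laplace (v^~ x) l in
  (forall l x, Hstar l -> I x -> has_laplace (v^~ x) l) /\
  exists Lv DLv : R[i] -> R -> R[i],
    [/\ is_Lhat I vbar Lv,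
        forall l x, Hstar l -> I x -> is_cderive2 (Lv l) x (DLv l x) &
        forall l x, Hstar l -> I x ->
          Psi l * vbar l x - Psi l / l * (v 0 x)%:C =
          Psi l / (2 * l) * DLv l x].

End Operator.

(* Main.v *)
(** For [x != 0] let [h t] be the density of the Ornstein-Uhlenbeck process at
    time [t], [W] the derivative of its variance, and [h'] the time derivative of
    [h], which is [W / 2] times the second space derivative of the Gaussian
    density. Integrating by parts, [p t x] is the integral of [h' s] against
    [P (sigma s <= t)], so that the Laplace transform of [p] at [l] is [l^-1]
    times that of [h'] at [Psi l], hence [l^-1 * Psi l] times that of [h]. The
    symbol in the operator is therefore the Laplace transform of [h] on the line
    [Re = c2], whatever the local inverse of [Psi], and it continues
    holomorphically to the half-plane. Both transforms are integrable on vertical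
    lines: [h] vanishes to infinite order at [0], so its transform is
    [O (|z|^-2)], and that of [W] is explicit up to a Gamma integral, which gives
    [O (|w|^(-2 H))]. By Fubini and Laplace inversion on the lines [Re = c1 - c2]
    and [Re = c2] the operator becomes the Laplace transform of [W * h] at
    [Psi l]. Two space derivatives under the integral turn it into twice the
    transform of [h'], which is the equation. *)
Require Import Defs.
From HB Require Import structures.
From mathcomp Require Import all_boot all_order all_algebra.
From mathcomp Require Import complex ring lra.
From mathcomp Require Import all_classical all_reals all_analysis measurable_realfun.
Import Order.TTheory GRing.Theory Num.Theory.
Import numFieldNormedType.Exports.
Local Open Scope classical_set_scope.
Local Open Scope ring_scope.
Set Implicit Arguments.
Unset Strict Implicit.
Unset Printing Implicit Defensive.

Import Normc.

(** * Complex-valued integrals *)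

Lemma ReD (R : realType) (z w : R[i]) :
  complex.Re (z + w) = complex.Re z + complex.Re w.
Proof. by case: z w => ? ? []. Qed.

Lemma ImD (R : realType) (z w : R[i]) :
  complex.Im (z + w) = complex.Im z + complex.Im w.
Proof. by case: z w => ? ? []. Qed.

Lemma ReN (R : realType) (z : R[i]) : complex.Re (- z) = - complex.Re z.
Proof. by case: z. Qed.

Lemma ImN (R : realType) (z : R[i]) : complex.Im (- z) = - complex.Im z.
Proof. by case: z. Qed.

Lemma ReM (R : realType) (z w : R[i]) : complex.Re (z * w) =
  complex.Re z * complex.Re w - complex.Im z * complex.Im w.
Proof. by case: z w => ? ? []. Qed.

Lemma ImM (R : realType) (z w : R[i]) : complex.Im (z * w) =
  complex.Re z * complex.Im w + complex.Im z * complex.Re w.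
Proof. by case: z w => ? ? [] ? ? /=; rewrite addrC mulrC [X in _ + X]mulrC. Qed.

Lemma ReZ (R : realType) (x : R) (z : R[i]) :
  complex.Re (x%:C%C * z) = x * complex.Re z.
Proof. by rewrite ReM/= mul0r subr0. Qed.

Lemma ImZ (R : realType) (x : R) (z : R[i]) :
  complex.Im (x%:C%C * z) = x * complex.Im z.
Proof. by rewrite ImM/= mul0r addr0. Qed.

Lemma complex_ext (R : realType) (z w : R[i]) :
  complex.Re z = complex.Re w -> complex.Im z = complex.Im w -> z = w.
Proof. by case: z w => ? ? [] ? ? /= -> ->. Qed.

Lemma normcC (R : realType) (x : R) : normc x%:C%C = `|x|.
Proof. by rewrite /= expr0n/= addr0 sqrtr_sqr. Qed.

Lemma normc_ge0 (R : realType) (z : R[i]) : 0 <= normc z.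
Proof. by case: z => a b; exact: sqrtr_ge0. Qed.

Lemma normc_gt0 (R : realType) (z : R[i]) : (0 < normc z) = (z != 0).
Proof.
rewrite lt_neqAle normc_ge0 andbT eq_sym; congr negb.
by apply/eqP/eqP => [/eq0_normc//|->]; rewrite normc0.
Qed.

Lemma ler_Re_normc (R : realType) (z : R[i]) : `|complex.Re z| <= normc z.
Proof.
by case: z => a b /=; rewrite -sqrtr_sqr ler_wsqrtr// lerDl sqr_ge0.
Qed.

Lemma ler_Im_normc (R : realType) (z : R[i]) : `|complex.Im z| <= normc z.
Proof.
by case: z => a b /=; rewrite -sqrtr_sqr ler_wsqrtr// lerDr sqr_ge0.
Qed.

Lemma normc_le_ReIm (R : realType) (z : R[i]) :
  normc z <= `|complex.Re z| + `|complex.Im z|.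
Proof.
case: z => a b /=.
rewrite -[leRHS]ger0_norm ?addr_ge0// -sqrtr_sqr ler_wsqrtr//.
rewrite sqrrD -!normrX (ger0_norm (sqr_ge0 a)) (ger0_norm (sqr_ge0 b)).
by rewrite addrAC lerDl mulrn_wge0// mulr_ge0.
Qed.

Lemma cexpD (R : realType) (z w : R[i]) : cexp (z + w) = cexp z * cexp w.
Proof.
case: z w => a b [c d]; rewrite /cexp; apply: complex_ext; rewrite ?ReM ?ImM/=.
- by rewrite expRD cosD; ring.
- by rewrite expRD sinD; ring.
Qed.

Lemma normc_cexp (R : realType) (z : R[i]) : normc (cexp z) = expR (complex.Re z).
Proof.
by rewrite /cexp /normc !exprMn -mulrDr cos2Dsin2 mulr1 sqrtr_sqr ger0_norm// expR_ge0.
Qed.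

Lemma cexp0 (R : realType) : cexp (0 : R[i]) = 1.
Proof. by rewrite /cexp/= expR0 cos0 sin0 mul1r mulr0. Qed.

Lemma cexp_real (R : realType) (x : R) : cexp x%:C%C = (expR x)%:C%C.
Proof. by rewrite /cexp/= cos0 sin0 mulr1 mulr0. Qed.

Section ComplexMeasurable.
Context {R : realType} d (T : measurableType d).
Implicit Types (D : set T) (f g : T -> R[i]) (h : T -> R).

Definition cmeasurable D f :=
  measurable_fun D (fun x => complex.Re (f x)) /\
  measurable_fun D (fun x => complex.Im (f x)).

Lemma cmeasurable_cst D (c : R[i]) : cmeasurable D (fun=> c).
Proof. by split; exact: measurable_cst. Qed.

Lemma cmeasurable_real D h :
  measurable_fun D h -> cmeasurable D (fun x => (h x)%:C%C).
Proof. by move=> mh; split=> //=; exact: measurable_cst. Qed.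

Lemma cmeasurableD D f g :
  cmeasurable D f -> cmeasurable D g -> cmeasurable D (fun x => f x + g x).
Proof.
move=> [f1 f2] [g1 g2]; split.
- by under eq_fun do rewrite ReD; exact: measurable_funD.
- by under eq_fun do rewrite ImD; exact: measurable_funD.
Qed.

Lemma cmeasurableN D f : cmeasurable D f -> cmeasurable D (fun x => - f x).
Proof.
move=> [f1 f2]; split.
- by under eq_fun do rewrite ReN; exact: measurableT_comp.
- by under eq_fun do rewrite ImN; exact: measurableT_comp.
Qed.

Lemma cmeasurableM D f g :
  cmeasurable D f -> cmeasurable D g -> cmeasurable D (fun x => f x * g x).
Proof.
move=> [f1 f2] [g1 g2]; split.
- by under eq_fun do rewrite ReM; apply: measurable_funB; exact: measurable_funM.
- by under eq_fun do rewrite ImM; apply: measurable_funD; exact: measurable_funM.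
Qed.

Lemma cmeasurable_cexp D f : cmeasurable D f -> cmeasurable D (fun x => cexp (f x)).
Proof.
move=> [f1 f2]; split; rewrite /cexp/=; apply: measurable_funM.
- exact: measurableT_comp f1.
- apply: measurableT_comp f2; apply: continuous_measurable_fun; exact: continuous_cos.
- exact: measurableT_comp f1.
- apply: measurableT_comp f2; apply: continuous_measurable_fun; exact: continuous_sin.
Qed.

Lemma cmeasurable_normc D f : cmeasurable D f -> measurable_fun D (fun x => normc (f x)).
Proof.
move=> [f1 f2]; rewrite (_ : (fun x => _) =
  fun x => Num.sqrt (complex.Re (f x) ^+ 2 + complex.Im (f x) ^+ 2)); last first.
  by apply/funext => x; case: (f x).
apply: measurableT_comp => //; last by apply: measurable_funD; exact: measurable_funX.
apply: continuous_measurable_fun; exact: sqrt_continuous.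
Qed.


End ComplexMeasurable.

Section ComplexIntegral.
Context {R : realType} d (T : measurableType d) (mu : {measure set T -> \bar R}).
Variables (D : set T) (mD : measurable D).
Implicit Types (f g : T -> R[i]) (h : T -> R).

Lemma integrable_dom h (g : T -> R) : measurable_fun D h ->
  (forall x, D x -> `|h x| <= g x) ->
  mu.-integrable D (EFin \o g) -> mu.-integrable D (EFin \o h).
Proof.
move=> mh hg; apply: le_integrable => //; first exact/measurable_EFinP.
by move=> x Dx; rewrite !abse_EFin lee_fin (le_trans (hg _ Dx))// ler_norm.
Qed.

Lemma integrable_congr (h k : T -> R) : (forall x, D x -> k x = h x) ->
  mu.-integrable D (EFin \o h) -> mu.-integrable D (EFin \o k).
Proof. by move=> hk; apply: eq_integrable => // x /[1!inE] Dx /=; rewrite hk. Qed.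

Lemma cintegrable_cmeasurable f : cintegrable mu D f -> cmeasurable D f.
Proof.
by move=> [/integrableP[/measurable_EFinP ? _] /integrableP[/measurable_EFinP ? _]].
Qed.

Lemma cintegrable_dom f h : cmeasurable D f ->
  (forall x, D x -> normc (f x) <= h x) ->
  mu.-integrable D (EFin \o h) -> cintegrable mu D f.
Proof.
move=> [f1 f2] fh ih; split.
- by apply: (integrable_dom f1 _ ih) => x /fh; apply: le_trans; exact: ler_Re_normc.
- by apply: (integrable_dom f2 _ ih) => x /fh; apply: le_trans; exact: ler_Im_normc.
Qed.

Lemma cintegrable_normc f : cintegrable mu D f ->
  mu.-integrable D (EFin \o (fun x => normc (f x))).
Proof.
move=> cf; have [f1 f2] := cf.
apply: (@integrable_dom _ (fun x => `|complex.Re (f x)| + `|complex.Im (f x)|)).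
- exact/cmeasurable_normc/cintegrable_cmeasurable.
- by move=> x _; rewrite ger0_norm ?normc_ge0// normc_le_ReIm.
- have : mu.-integrable D ((abse \o (EFin \o (fun x => complex.Re (f x)))) \+
                          (abse \o (EFin \o (fun x => complex.Im (f x)))))%E.
    by apply: integrableD => //; exact: integrable_abse.
  by apply: eq_integrable => // x _.
Qed.

Lemma eq_cintegral f g : (forall x, D x -> f x = g x) ->
  cintegral mu D f = cintegral mu D g.
Proof.
by move=> fg; rewrite /cintegral; congr Complex; apply: eq_Rintegral => x;
  rewrite inE => /fg ->.
Qed.

Lemma eq_cintegrable f g : (forall x, D x -> f x = g x) ->
  cintegrable mu D f -> cintegrable mu D g.
Proof.
move=> fg [f1 f2]; split.
- by apply: eq_integrable f1 => // x; rewrite inE => /fg ->.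
- by apply: eq_integrable f2 => // x; rewrite inE => /fg ->.
Qed.

Lemma cintegrableD f g : cintegrable mu D f -> cintegrable mu D g ->
  cintegrable mu D (fun x => f x + g x).
Proof.
move=> [f1 f2] [g1 g2]; split.
- by under eq_fun do rewrite ReD EFinD; exact: integrableD.
- by under eq_fun do rewrite ImD EFinD; exact: integrableD.
Qed.

Lemma cintegralD f g : cintegrable mu D f -> cintegrable mu D g ->
  cintegral mu D (fun x => f x + g x) = cintegral mu D f + cintegral mu D g.
Proof.
move=> [f1 f2] [g1 g2]; apply: complex_ext; rewrite /cintegral/=.
- by under eq_Rintegral do rewrite ReD; rewrite RintegralD.
- by under eq_Rintegral do rewrite ImD; rewrite RintegralD.
Qed.

Lemma integrableMc (c : R) h : mu.-integrable D (EFin \o h) ->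
  mu.-integrable D (EFin \o (fun x => c * h x)).
Proof. by move=> /(integrableZl mD c); apply: eq_integrable. Qed.

Lemma cintegrableZ (c : R[i]) f : cintegrable mu D f ->
  cintegrable mu D (fun x => c * f x).
Proof.
move=> [f1 f2]; split.
- under eq_fun do rewrite ReM EFinB.
  by apply: integrableB => //; exact: integrableMc.
- under eq_fun do rewrite ImM EFinD.
  by apply: integrableD => //; exact: integrableMc.
Qed.

Lemma cintegralZ (c : R[i]) f : cintegrable mu D f ->
  cintegral mu D (fun x => c * f x) = c * cintegral mu D f.
Proof.
move=> [f1 f2]; apply: complex_ext; rewrite /cintegral ?ReM ?ImM/=.
- under eq_Rintegral do rewrite ReM.
  by rewrite RintegralB ?RintegralZl//; exact: integrableMc.
- under eq_Rintegral do rewrite ImM.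
  by rewrite RintegralD ?RintegralZl//; exact: integrableMc.
Qed.

Lemma cintegralZr (c : R[i]) f : cintegrable mu D f ->
  cintegral mu D (fun x => f x * c) = cintegral mu D f * c.
Proof. by move=> cf; under eq_fun do rewrite mulrC; rewrite cintegralZ// mulrC. Qed.

Lemma cintegrableB f g : cintegrable mu D f -> cintegrable mu D g ->
  cintegrable mu D (fun x => f x - g x).
Proof.
move=> cf cg; under eq_fun do rewrite -mulN1r.
by apply: cintegrableD => //; exact: cintegrableZ.
Qed.

Lemma cintegralB f g : cintegrable mu D f -> cintegrable mu D g ->
  cintegral mu D (fun x => f x - g x) = cintegral mu D f - cintegral mu D g.
Proof.
move=> cf cg; under eq_fun do rewrite -mulN1r.
by rewrite cintegralD ?cintegralZ ?mulN1r//; exact: cintegrableZ.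
Qed.

Lemma cintegrable_real h : mu.-integrable D (EFin \o h) ->
  cintegrable mu D (fun x => (h x)%:C%C).
Proof. by move=> ih; split => //=; exact: integrable0. Qed.

Lemma cintegral_real h : cintegral mu D (fun x => (h x)%:C%C) = (\int[mu]_(x in D) h x)%:C%C.
Proof.
by apply: complex_ext => //=; rewrite /Rintegral integral0.
Qed.

Lemma normc_cintegral_le f h : cmeasurable D f ->
  (forall x, D x -> normc (f x) <= h x) ->
  mu.-integrable D (EFin \o h) ->
  normc (cintegral mu D f) <= 2 * \int[mu]_(x in D) h x.
Proof.
move=> mf fh ih; have [f1 f2] := cintegrable_dom mf fh ih.
rewrite (le_trans (normc_le_ReIm _))//= mulr2n mulrDl !mul1r.
apply: lerD; (apply: le_trans (le_normr_Rintegral _ _) _ => //);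
  apply: le_Rintegral => //; do ?[exact: integrable_norm] => x /fh; apply: le_trans;
  [exact: ler_Re_normc|exact: ler_Im_normc].
Qed.

End ComplexIntegral.

Section FubiniReal.
Context {R : realType} d1 d2 (T1 : measurableType d1) (T2 : measurableType d2).
Variables (m1 : {sigma_finite_measure set T1 -> \bar R}).
Variables (m2 : {sigma_finite_measure set T2 -> \bar R}).
Variables (D1 : set T1) (D2 : set T2).
Hypotheses (mD1 : measurable D1) (mD2 : measurable D2).
Variables (a : T1 -> R) (b : T2 -> R).
Hypotheses (ia : m1.-integrable D1 (EFin \o a)) (ib : m2.-integrable D2 (EFin \o b)).

Variable f : T1 * T2 -> R.
Hypothesis mf : measurable_fun (D1 `*` D2) f.
Hypothesis fab : forall x y, D1 x -> D2 y -> `|f (x, y)| <= a x * b y.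

Let F := (EFin \o f) \_ (D1 `*` D2).

Let mF : measurable_fun setT F.
Proof.
apply/(measurable_restrictT _ _).1; first exact: measurableX.
exact/measurable_EFinP.
Qed.

Let F1 x : D1 x -> (fun y => F (x, y)) = (fun y => (f (x, y))%:E) \_ D2.
Proof.
move=> D1x; apply/funext => y; rewrite /F /restrict.
by congr (if _ then _ else _); apply/idP/idP; rewrite !inE//= => -[].
Qed.

Let F2 y : D2 y -> (fun x => F (x, y)) = (fun x => (f (x, y))%:E) \_ D1.
Proof.
move=> D2y; apply/funext => x; rewrite /F /restrict.
by congr (if _ then _ else _); apply/idP/idP; rewrite !inE//= => -[].
Qed.

Let FN1 x : ~ D1 x -> (fun y => F (x, y)) = cst 0%E.
Proof.
by move=> D1x; apply/funext => y; rewrite /F /restrict memNset// => -[].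
Qed.

Let FN2 y : ~ D2 y -> (fun x => F (x, y)) = cst 0%E.
Proof.
by move=> D2y; apply/funext => x; rewrite /F /restrict memNset// => -[].
Qed.

Lemma section1_measurable x : D1 x -> measurable_fun D2 (fun y => f (x, y)).
Proof.
move=> D1x; apply/measurable_EFinP/(measurable_restrictT _ _).2 => //.
by rewrite -F1//; exact: measurableT_comp mF _.
Qed.

Lemma section2_measurable y : D2 y -> measurable_fun D1 (fun x => f (x, y)).
Proof.
move=> D2y; apply/measurable_EFinP/(measurable_restrictT _ _).2 => //.
by rewrite -F2//; exact: measurableT_comp mF _.
Qed.

Lemma section1_integrable x : D1 x -> m2.-integrable D2 (fun y => (f (x, y))%:E).
Proof.
move=> D1x; apply: (@integrable_dom _ _ _ m2 _ mD2 _ (fun y => a x * b y)).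
- exact: section1_measurable.
- by move=> y D2y; exact: fab.
- exact: integrableMc.
Qed.

Lemma section2_integrable y : D2 y -> m1.-integrable D1 (fun x => (f (x, y))%:E).
Proof.
move=> D2y; apply: (@integrable_dom _ _ _ m1 _ mD1 _ (fun x => b y * a x)).
- exact: section2_measurable.
- by move=> x D1x; rewrite mulrC; exact: fab.
- exact: integrableMc.
Qed.

Let iF : (m1 \x m2)%E.-integrable setT F.
Proof.
apply/integrable12ltyP => //.
have mabs d (T : measurableType d) (m : {measure set T -> \bar R}) D h :
    measurable D -> m.-integrable D (EFin \o h) ->
    measurable_fun D (fun x : T => (`|h x|)%:E).
  move=> mD /integrableP[/measurable_EFinP mh _].
  exact/measurable_EFinP/measurableT_comp.
have := (integrableP _ _ _ ia).2; have := (integrableP _ _ _ ib).2.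
set Bc := (\int[m2]_(y in D2) _)%E => Bfin Afin.
have B0 : (0 <= Bc)%E by exact: integral_ge0.
apply: (@le_lt_trans _ _ (\int[m1]_(x in D1) ((`|a x|)%:E * Bc))%E); last first.
  rewrite ge0_integralZr//; last exact: mabs ia.
  by rewrite lte_mul_pinfty//; [exact: integral_ge0|rewrite ge0_fin_numE//; exact: integral_ge0].
rewrite [leRHS]integral_mkcond; apply: ge0_le_integral => //.
- by move=> x _; exact: integral_ge0.
- by apply: measurable_fun_fubini_tonelli_F (abse \o F) _ _ => //=; exact: measurableT_comp.
- apply/(measurable_restrictT _ _).1 => //.
  apply: emeasurable_funM; last exact: measurable_cst.
  exact: mabs ia.
- move=> x _; have [D1x|D1x] := pselect (D1 x); last first.
    rewrite [leLHS](eq_integral (cst 0%E)); last first.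
      by move=> y _ /=; rewrite -[F (x, y)]/((fun y => F (x, y)) y) FN1// abse0.
    by rewrite integral0 erestrict_ge0// => ? _; exact: mule_ge0.
  rewrite /restrict mem_set// -ge0_integralZl//; last exact: mabs ib.
  rewrite [leLHS](eq_integral (abse \o ((fun y => (f (x, y))%:E) \_ D2))); last first.
    by move=> y _; rewrite -(F1 D1x).
  rewrite [leRHS]integral_mkcond; apply: ge0_le_integral => //.
  + by move=> y _; exact: abse_ge0.
  + apply: measurableT_comp => //.
    apply/(measurable_restrictT _ _).1 => //.
    exact/measurable_EFinP/section1_measurable.
  + apply/(measurable_restrictT _ _).1 => //.
    apply: emeasurable_funM; first exact: measurable_cst.
    exact: mabs ib.
  + move=> y _; rewrite /comp /restrict; case: ifPn => [|_]; last by rewrite abse0.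
    by rewrite inE => D2y /=; rewrite lee_fin -normrM (le_trans (fab _ _))// ler_norm.
Qed.

Let int1 x : D1 x -> (\int[m2]_y F (x, y) = (\int[m2]_(y in D2) f (x, y))%R%:E)%E.
Proof.
move=> D1x; rewrite (F1 D1x) -integral_mkcond /Rintegral fineK//.
by apply: integrable_fin_num => //; exact: section1_integrable.
Qed.

Let int2 y : D2 y -> (\int[m1]_x F (x, y) = (\int[m1]_(x in D1) f (x, y))%R%:E)%E.
Proof.
move=> D2y; rewrite (F2 D2y) -integral_mkcond /Rintegral fineK//.
by apply: integrable_fin_num => //; exact: section2_integrable.
Qed.

Lemma integrable_Fubini1 : m1.-integrable D1 (fun x => (\int[m2]_(y in D2) f (x, y))%:E).
Proof.
have := integrableS measurableT mD1 (@subsetT _ _) (integrable_fubini_F iF).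
by apply: eq_integrable => // x; rewrite inE => D1x; exact: int1.
Qed.

Lemma Rintegral_Fubini :
  \int[m1]_(x in D1) (\int[m2]_(y in D2) f (x, y)) =
  \int[m2]_(y in D2) (\int[m1]_(x in D1) f (x, y)).
Proof.
rewrite [LHS]/Rintegral [RHS]/Rintegral; congr fine.
transitivity (\int[m1]_x \int[m2]_y F (x, y))%E.
  rewrite integral_mkcond; apply: eq_integral => x _; rewrite /restrict.
  case: ifPn => [/set_mem D1x|]; first by rewrite int1.
  by move=> /negP D1x; rewrite FN1 ?integral0// => ?; apply: D1x; rewrite inE.
rewrite (Fubini iF).
rewrite [RHS]integral_mkcond; apply: eq_integral => x _; rewrite /restrict.
case: ifPn => [/set_mem D1x|]; first by rewrite int2.
by move=> /negP D1x; rewrite FN2 ?integral0// => ?; apply: D1x; rewrite inE.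
Qed.

Lemma integrable_prod : (m1 \x m2)%E.-integrable (D1 `*` D2) (EFin \o f).
Proof. by apply/integrable_mkcond => //; exact: measurableX. Qed.

Lemma Rintegral_prod :
  \int[(m1 \x m2)%E]_(z in D1 `*` D2) f z =
  \int[m1]_(x in D1) (\int[m2]_(y in D2) f (x, y)).
Proof.
rewrite [LHS]/Rintegral [RHS]/Rintegral; congr fine.
rewrite [LHS]integral_mkcond -(integral12_prod_meas1 iF) /fubini_F.
rewrite [RHS]integral_mkcond; apply: eq_integral => x _; rewrite /restrict.
case: ifPn => [/set_mem D1x|]; first by rewrite int1.
by move=> /negP D1x; rewrite FN1 ?integral0// => ?; apply: D1x; rewrite inE.
Qed.

End FubiniReal.

Section FubiniComplex.
Context {R : realType} d1 d2 (T1 : measurableType d1) (T2 : measurableType d2).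
Variables (m1 : {sigma_finite_measure set T1 -> \bar R}).
Variables (m2 : {sigma_finite_measure set T2 -> \bar R}).
Variables (D1 : set T1) (D2 : set T2).
Hypotheses (mD1 : measurable D1) (mD2 : measurable D2).
Variables (a : T1 -> R) (b : T2 -> R).
Hypotheses (ia : m1.-integrable D1 (EFin \o a)) (ib : m2.-integrable D2 (EFin \o b)).

Variable f : T1 * T2 -> R[i].
Hypothesis mf : cmeasurable (D1 `*` D2) f.
Hypothesis fab : forall x y, D1 x -> D2 y -> normc (f (x, y)) <= a x * b y.

Let fabR x y : D1 x -> D2 y -> `|complex.Re (f (x, y))| <= a x * b y.
Proof. by move=> ? ?; rewrite (le_trans (ler_Re_normc _))// fab. Qed.

Let fabI x y : D1 x -> D2 y -> `|complex.Im (f (x, y))| <= a x * b y.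
Proof. by move=> ? ?; rewrite (le_trans (ler_Im_normc _))// fab. Qed.

Lemma cintegrable_Fubini1 : cintegrable m1 D1 (fun x => cintegral m2 D2 (fun y => f (x, y))).
Proof. by split; [exact: (integrable_Fubini1 mD1 mD2 ia ib mf.1 fabR)|exact: (integrable_Fubini1 mD1 mD2 ia ib mf.2 fabI)]. Qed.

Lemma cintegral_Fubini :
  cintegral m1 D1 (fun x => cintegral m2 D2 (fun y => f (x, y))) =
  cintegral m2 D2 (fun y => cintegral m1 D1 (fun x => f (x, y))).
Proof.
by apply: complex_ext => /=; [exact: (Rintegral_Fubini mD1 mD2 ia ib mf.1 fabR)|exact: (Rintegral_Fubini mD1 mD2 ia ib mf.2 fabI)].
Qed.

Lemma cintegral_prod :
  cintegral (m1 \x m2)%E (D1 `*` D2) f =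
  cintegral m1 D1 (fun x => cintegral m2 D2 (fun y => f (x, y))).
Proof.
by apply: complex_ext => /=; [exact: (Rintegral_prod mD1 mD2 ia ib mf.1 fabR)|exact: (Rintegral_prod mD1 mD2 ia ib mf.2 fabI)].
Qed.


End FubiniComplex.

Section LebesgueIsometry.
Context {R : realType}.
Notation mu := (@lebesgue_measure R).
Variable phi : R -> R.
Hypothesis mphi : measurable_fun setT phi.
Hypothesis phi_mu : forall A, measurable A -> mu (phi @^-1` A) = mu A.

Lemma ge0_integral_isometry (D : set R) (f : R -> \bar R) :
  measurable D -> measurable_fun D f -> (forall x, D x -> (0 <= f x)%E) ->
  (\int[mu]_(x in phi @^-1` D) f (phi x) = \int[mu]_(x in D) f x)%E.
Proof.
move=> mD mf f0.
have mphi' : measurable_fun setT (phi : measurableTypeR R -> measurableTypeR R) by exact: mphi.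
rewrite -[LHS](ge0_integral_pushforward mphi')//; last first.
  by move=> x; rewrite inE; exact: f0.
by apply: eq_measure_integral => A mA _; exact: phi_mu.
Qed.

Lemma integral_isometry (D : set R) (f : R -> \bar R) :
  measurable D -> measurable_fun D f ->
  (\int[mu]_(x in phi @^-1` D) f (phi x) = \int[mu]_(x in D) f x)%E.
Proof.
move=> mD mf; rewrite [LHS]integralE [RHS]integralE.
under [X in (X - _)%E = _]eq_integral do rewrite (funepos_comp f phi)/=.
under [X in (_ - X)%E = _]eq_integral do rewrite (funeneg_comp f phi)/=.
rewrite (ge0_integral_isometry mD (measurable_funepos mf))//.
by rewrite (ge0_integral_isometry mD (measurable_funeneg mf)).
Qed.


Lemma integrable_isometry (D : set R) (f : R -> R) :
  measurable D -> mu.-integrable D (EFin \o f) ->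
  mu.-integrable (phi @^-1` D) (EFin \o (fun x => f (phi x))).
Proof.
move=> mD /integrableP[mf fi]; apply/integrableP; split.
  by apply: (measurable_comp mD _ mf (measurable_funTS mphi)) => _ [x Dx <-].
move: fi; rewrite -(@ge0_integral_isometry D)//; last exact: measurableT_comp.
Qed.

Lemma cintegral_isometry (D : set R) (f : R -> R[i]) :
  measurable D -> cmeasurable D f ->
  cintegral mu (phi @^-1` D) (fun x => f (phi x)) = cintegral mu D f.
Proof.
move=> mD [f1 f2]; rewrite /cintegral /Rintegral; congr Complex.
- by rewrite -(@integral_isometry D)//; exact/measurable_EFinP.
- by rewrite -(@integral_isometry D)//; exact/measurable_EFinP.
Qed.

Lemma cintegrable_isometry (D : set R) (f : R -> R[i]) :
  measurable D -> cintegrable mu D f ->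
  cintegrable mu (phi @^-1` D) (fun x => f (phi x)).
Proof. by move=> mD [f1 f2]; split; [exact: integrable_isometry f1|exact: integrable_isometry f2]. Qed.

End LebesgueIsometry.

Section LebesgueInvariance.
Context {R : realType}.
Notation mu := (@lebesgue_measure R).

Lemma lebesgue_measure_shift (c : R) (A : set R) : measurable A ->
  mu ((fun x => x + c) @^-1` A) = mu A.
Proof.
move=> mA.
have mphi : measurable_fun setT (fun x : measurableTypeR R => (x + c : measurableTypeR R)).
  exact: measurable_funD.
pose T := isMeasurableFun.Build _ _ _ _ _ mphi.
pose S : {mfun _ >-> _} := HB.pack (fun x : measurableTypeR R => (x + c : measurableTypeR R)) T.
apply/esym/(@lebesgue_measure_unique _ (pushforward mu S)) => //= _ [[a b]] _ <-.
rewrite /pushforward (_ : _ @^-1` _ = `](a - c), (b - c)]%classic); last first.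
  by apply/seteqP; split => x /=; rewrite !in_itv/= ltrBlDr lerBrDr.
rewrite /= !lebesgue_measure_itv/= !lte_fin ltrD2r.
by case: ifPn => // _; congr EFin; ring.
Qed.

Lemma lebesgue_measure_reflect (c : R) (A : set R) : measurable A ->
  mu ((fun x => c - x) @^-1` A) = mu A.
Proof.
move=> mA.
rewrite (_ : _ @^-1` _ = (-%R : _ -> measurableTypeR R) @^-1` ((fun x => x + c) @^-1` A)); last first.
  by apply/seteqP; split => x /=; rewrite addrC.
have mA' : measurable ((fun x => x + c) @^-1` A).
  rewrite -[X in measurable X]setTI.
  by have : measurable_fun setT (fun x : R => x + c); [exact: measurable_funD|exact].
by have := lebesgue_measureN mA'; rewrite /pushforward => ->; exact: lebesgue_measure_shift.
Qed.

End LebesgueInvariance.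

Section FTC.
Context {R : realType}.
Notation mu := (@lebesgue_measure R).

Lemma FTC_halfline (F f : R -> R) (a l : R) :
  (forall x, a <= x -> is_derive x 1 F (f x)) ->
  (forall x, a <= x -> {for x, continuous f}) ->
  (forall x, a <= x -> 0 <= f x) -> F x @[x --> +oo] --> l ->
  mu.-integrable `[a, +oo[ (EFin \o f) /\
  \int[mu]_(x in `[a, +oo[) f x = l - F a.
Proof.
move=> dF cf f0 Fl.
have E : (\int[mu]_(x in `[a, +oo[) (f x)%:E = l%:E - (F a)%:E)%E.
  apply: ge0_continuous_FTC2y => //.
  - apply/continuous_within_itvcyP; split.
      by move=> x; rewrite in_itv/= andbT => /ltW; exact: cf.
    exact/cvg_at_right_filter/cf.
  - by move=> x /ltW /dF[].
  - apply/cvg_at_right_filter/differentiable_continuous/derivable1_diffP.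
    by have [] := dF _ (lexx a).
  - move=> x; rewrite in_itv/= andbT => /ltW ax.
    by rewrite derive1E; have := dF _ ax => /@derive_val.
split; last by rewrite /Rintegral E.
apply/integrableP; split.
  apply/measurable_EFinP/measurable_fun_itv_obnd_cbndP.
  apply: open_continuous_measurable_fun; first exact: interval_open.
  by move=> x; rewrite inE/= in_itv/= andbT => /ltW; exact: cf.
rewrite (_ : (\int[mu]_(x in _) _)%E = (l%:E - (F a)%:E)%E) ?ltry//.
rewrite -E; apply: eq_integral => x; rewrite inE/= in_itv/= andbT => ax.
by rewrite ger0_norm// f0.
Qed.

Lemma integral_oy_cy (f : R -> R) (a : R) :
  measurable_fun `]a, +oo[ f ->
  \int[mu]_(x in `]a, +oo[) f x = \int[mu]_(x in `[a, +oo[) f x.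
Proof.
by move=> mf; rewrite /Rintegral integral_itv_obnd_cbnd//; exact/measurable_EFinP.
Qed.

Lemma cvg_expRN_y (a : R) : 0 < a -> expR (- (a * x)) @[x --> +oo] --> (0 : R).
Proof.
move=> a0; apply: (@cvg_comp _ _ _ (fun x => a * x) (fun x => expR (- x)) _ +oo).
  by apply: gt0_cvgMry => //; exact: cvg_id.
exact: cvgr_expR.
Qed.

Lemma integral_expRN (a tau : R) : 0 < a ->
  mu.-integrable `[tau, +oo[ (EFin \o (fun t => expR (- (a * t)))) /\
  \int[mu]_(t in `[tau, +oo[) expR (- (a * t)) = expR (- (a * tau)) / a.
Proof.
move=> a0; have [] := @FTC_halfline (fun t => - (a^-1 * expR (- (a * t))))
  (fun t => expR (- (a * t))) tau 0.
- move=> x _; apply: is_derive_eq; rewrite /GRing.scale/=; field; exact: lt0r_neq0.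
- move=> x _; apply/differentiable_continuous/derivable1_diffP; exact: ex_derive.
- by move=> x _; exact: expR_ge0.
- rewrite -[0]oppr0 -(mulr0 a^-1); apply: cvgN; apply: cvgM; first exact: cvg_cst.
  exact: cvg_expRN_y.
by move=> i ->; split => //; rewrite sub0r opprK mulrC.
Qed.

End FTC.

(** * Laplace transforms *)

Section LaplaceBasics.
Context {R : realType}.
Notation mu := (@lebesgue_measure R).
Implicit Types (z : R[i]) (t : R).

Lemma cexp_mulNC z t : cexp (- z * t%:C%C) =
  ((expR (- (complex.Re z * t)) * cos (complex.Im z * t)) +i*
   (- (expR (- (complex.Re z * t)) * sin (complex.Im z * t))))%C.
Proof.
rewrite /cexp ReM ImM ReN ImN/= !mulr0 subr0 add0r !mulNr cosN sinN mulrN.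
by [].
Qed.

Lemma normc_cexp_mulNC z t :
  normc (cexp (- z * t%:C%C)) = expR (- (complex.Re z * t)).
Proof. by rewrite normc_cexp ReM ReN/= mulr0 subr0 mulNr. Qed.

Lemma cmeasurable_cexp_mulNC z D : cmeasurable D (fun t => cexp (- z * t%:C%C)).
Proof.
apply/cmeasurable_cexp/cmeasurableM; first exact: cmeasurable_cst.
exact/cmeasurable_real/measurable_id.
Qed.

Lemma cvg_expRN_bounded (a M : R) (b : R -> R) : 0 < a -> (forall x, `|b x| <= M) ->
  expR (- (a * x)) * b x @[x --> +oo] --> (0 : R).
Proof.
move=> a0 bM; apply: norm_cvg0.
apply: (@squeeze_cvgr _ _ _ _ (cst 0) (fun x => expR (- (a * x)) * M)).
- apply: nearW => x; rewrite normr_ge0/= normrM ger0_norm ?expR_ge0//.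
  by rewrite ler_wpM2l ?expR_ge0.
- exact: cvg_cst.
- by rewrite -(mul0r M); apply: cvgM; [exact: cvg_expRN_y|exact: cvg_cst].
Qed.

Lemma integral_expRN_cos (a b tau : R) : 0 < a ->
  mu.-integrable `[tau, +oo[ (EFin \o (fun t => expR (- (a * t)) * cos (b * t))) /\
  \int[mu]_(t in `[tau, +oo[) (expR (- (a * t)) * cos (b * t)) =
  expR (- (a * tau)) * (a * cos (b * tau) - b * sin (b * tau)) / (a ^+ 2 + b ^+ 2).
Proof.
move=> a0; have n0 : a ^+ 2 + b ^+ 2 != 0 by rewrite gt_eqF// ltr_wpDr ?sqr_ge0// exprn_gt0.
have a0' : a != 0 by rewrite gt_eqF.
have [] := @FTC_halfline _ (fun t => expR (- (a * t)) *
    ((b * sin (b * t) - a * cos (b * t)) / (a ^+ 2 + b ^+ 2) - a^-1))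
  (fun t => expR (- (a * t)) * (1 + cos (b * t))) tau 0.
- move=> x _; apply: is_derive_eq; rewrite /GRing.scale/=; field.
  by rewrite a0' n0.
- move=> x _; apply/differentiable_continuous/derivable1_diffP; exact: ex_derive.
- by move=> x _; rewrite mulr_ge0 ?expR_ge0// -lerBlDl sub0r cos_geN1.
- apply: (@cvg_expRN_bounded _ ((`|b| + `|a|) / (a ^+ 2 + b ^+ 2) + `|a^-1|)) => // x.
  rewrite (le_trans (ler_normB _ _))// lerD2r normrM normfV [X in _ * X^-1 <= _]ger0_norm ?addr_ge0 ?sqr_ge0//.
  rewrite ler_wpM2r ?invr_ge0 ?addr_ge0 ?sqr_ge0//.
  rewrite (le_trans (ler_normB _ _))// !normrM lerD// ler_piMr//.
    by rewrite ler_norml sin_geN1 sin_le1.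
  by rewrite ler_norml cos_geN1 cos_le1.
move=> i1 e1; have [i2 e2] := @integral_expRN R a tau a0.
have E t : expR (- (a * t)) * cos (b * t) =
    expR (- (a * t)) * (1 + cos (b * t)) - expR (- (a * t)) by ring.
split.
  have /(_ (measurable_itv _)) := fun h => integrableB h i1 i2.
  by apply: eq_integrable => // t _ /=; rewrite -EFinB -E.
under eq_Rintegral do rewrite E.
rewrite RintegralB// e1 e2; field.
by rewrite a0' n0.
Qed.

Lemma integral_expRN_sin (a b tau : R) : 0 < a ->
  mu.-integrable `[tau, +oo[ (EFin \o (fun t => expR (- (a * t)) * sin (b * t))) /\
  \int[mu]_(t in `[tau, +oo[) (expR (- (a * t)) * sin (b * t)) =
  expR (- (a * tau)) * (a * sin (b * tau) + b * cos (b * tau)) / (a ^+ 2 + b ^+ 2).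
Proof.
move=> a0; have n0 : a ^+ 2 + b ^+ 2 != 0 by rewrite gt_eqF// ltr_wpDr ?sqr_ge0// exprn_gt0.
have a0' : a != 0 by rewrite gt_eqF.
have [] := @FTC_halfline _ (fun t => expR (- (a * t)) *
    (- (a * sin (b * t) + b * cos (b * t)) / (a ^+ 2 + b ^+ 2) - a^-1))
  (fun t => expR (- (a * t)) * (1 + sin (b * t))) tau 0.
- move=> x _; apply: is_derive_eq; rewrite /GRing.scale/=; field.
  by rewrite a0' n0.
- move=> x _; apply/differentiable_continuous/derivable1_diffP; exact: ex_derive.
- by move=> x _; rewrite mulr_ge0 ?expR_ge0// -lerBlDl sub0r sin_geN1.
- apply: (@cvg_expRN_bounded _ ((`|a| + `|b|) / (a ^+ 2 + b ^+ 2) + `|a^-1|)) => // x.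
  rewrite (le_trans (ler_normB _ _))// lerD2r normrM normfV [X in _ * X^-1 <= _]ger0_norm ?addr_ge0 ?sqr_ge0//.
  rewrite ler_wpM2r ?invr_ge0 ?addr_ge0 ?sqr_ge0//.
  rewrite normrN (le_trans (ler_normD _ _))// !normrM lerD// ler_piMr//.
    by rewrite ler_norml sin_geN1 sin_le1.
  by rewrite ler_norml cos_geN1 cos_le1.
move=> i1 e1; have [i2 e2] := @integral_expRN R a tau a0.
have E t : expR (- (a * t)) * sin (b * t) =
    expR (- (a * t)) * (1 + sin (b * t)) - expR (- (a * t)) by ring.
split.
  have /(_ (measurable_itv _)) := fun h => integrableB h i1 i2.
  by apply: eq_integrable => // t _ /=; rewrite -EFinB -E.
under eq_Rintegral do rewrite E.
rewrite RintegralB// e1 e2; field.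
by rewrite a0' n0.
Qed.

Lemma integral_cexp z (tau : R) : 0 < complex.Re z ->
  cintegrable mu `[tau, +oo[ (fun t => cexp (- z * t%:C%C)) /\
  cintegral mu `[tau, +oo[ (fun t => cexp (- z * t%:C%C)) = z^-1 * cexp (- z * tau%:C%C).
Proof.
case: z => a b /= a0.
have [i1 e1] := @integral_expRN_cos a b tau a0.
have [i2 e2] := @integral_expRN_sin a b tau a0.
have i2N := integrableN i2.
split.
  split.
  - by apply: eq_integrable i1 => // t _; rewrite cexp_mulNC.
  - by apply: eq_integrable i2N => // t _; rewrite cexp_mulNC.
have n0 : a ^+ 2 + b ^+ 2 != 0 by rewrite gt_eqF// ltr_wpDr ?sqr_ge0// exprn_gt0.
transitivity ((\int[mu]_(t in `[tau, +oo[) (expR (- (a * t)) * cos (b * t))) +i*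
  (- \int[mu]_(t in `[tau, +oo[) (expR (- (a * t)) * sin (b * t))))%C.
  rewrite /cintegral; congr Complex.
    by apply: eq_Rintegral => t _; rewrite cexp_mulNC.
  rewrite -[RHS]mulN1r -RintegralZl//; apply: eq_Rintegral => t _.
  by rewrite cexp_mulNC/= mulN1r.
by rewrite e1 e2 cexp_mulNC; apply: complex_ext => /=; field.
Qed.

Lemma Rintegral_tail (f : R -> R) (tau : R) : 0 <= tau -> measurable_fun setT f ->
  \int[mu]_(t in `]0, +oo[) (f t * (tau <= t)%R%:R) = \int[mu]_(t in `[tau, +oo[) f t.
Proof.
move=> tau0 mf.
have mP : measurable_fun setT (fun t : R => (tau <= t)%R%:R : R).
  have -> : (fun t : R => (tau <= t)%R%:R : R) = \1_(`[tau, +oo[).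
    by apply/funext => t; rewrite indicE mem_setE in_itv/= andbT.
  exact: measurable_indic.
rewrite integral_oy_cy; last by apply: measurable_funTS; exact: measurable_funM.
have -> : `[tau, +oo[%classic = `[0, +oo[%classic `&` `[tau, +oo[%classic :> set R.
  apply/seteqP; split => x /=; rewrite !in_itv/= !andbT; last by case.
  by move=> tx; split => //; exact: le_trans tx.
rewrite Rintegral_mkcondr; apply: eq_Rintegral => t _; rewrite patchE mem_setE in_itv/= andbT.
by case: ifP => _; rewrite ?mulr1 ?mulr0.
Qed.

Lemma cintegral_tail (f : R -> R[i]) (tau : R) : 0 <= tau -> cmeasurable setT f ->
  cintegral mu `]0, +oo[ (fun t => f t * ((tau <= t)%R%:R : R)%:C%C) =
  cintegral mu `[tau, +oo[ f.
Proof.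
move=> tau0 [f1 f2]; apply: complex_ext => /=.
- by rewrite -Rintegral_tail//; apply: eq_Rintegral => t _; rewrite ReM/= mulr0 subr0.
- by rewrite -Rintegral_tail//; apply: eq_Rintegral => t _; rewrite ImM/= mulr0 add0r.
Qed.

Lemma measurable_bool_natr d (T : measurableType d) (D : set T) (g : T -> bool) :
  measurable D -> measurable_fun D g -> measurable_fun D (fun x => (g x)%:R : R).
Proof.
move=> mD mg; rewrite (_ : (fun x => _) = (fun x => if g x then 1 else 0)); last first.
  by apply/funext => x; case: (g x).
have := @measurable_fun_if _ _ T R (cst 1) (cst 0) D mD g mg (measurable_cst _) (measurable_cst _).
by apply.
Qed.

(* If [m] were a measure on [X], [u] would be the distribution function of the
   image of [m] by [tau], and [laplace u z] its Laplace-Stieltjes transform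
   divided by [z]. *)
Lemma laplace_cdf d (X : measurableType d) (m : {sigma_finite_measure set X -> \bar R})
    (D : set X) (w tau : X -> R) z (rho : R) :
  measurable D -> measurable_fun D w -> measurable_fun D tau ->
  (forall x, D x -> 0 <= tau x) -> 0 <= rho -> rho < complex.Re z ->
  m.-integrable D (EFin \o (fun x => `|w x| * expR (- (rho * tau x)))) ->
  let u t := \int[m]_(x in D) (w x * (tau x <= t)%R%:R) in
  has_laplace u z /\
  laplace u z = z^-1 * cintegral m D (fun x => cexp (- z * (tau x)%:C%C) * (w x)%:C%C).
Proof.
move=> mD mw mt t0 rho0 rhoz iw u.
have rz : 0 < complex.Re z by exact: le_lt_trans rhoz.
pose f (y : measurableTypeR R * X) := cexp (- z * y.1%:C%C) * (w y.2 * (tau y.2 <= y.1)%R%:R)%:C%C.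
have mD1 : measurable (`]0%R, +oo[%classic : set (measurableTypeR R)) by [].
have mX : measurable ((`]0%R, +oo[%classic : set (measurableTypeR R)) `*` D) by exact: measurableX.
have m2 (h : X -> R) : measurable_fun D h ->
    measurable_fun ((`]0%R, +oo[%classic : set (measurableTypeR R)) `*` D) (fun y : measurableTypeR R * X => h y.2).
  move=> mh; apply: (measurable_comp mD _ mh); last exact: measurable_funTS measurable_snd.
  by move=> _ [[x y] [/= _ Dy] <-].
have m1 : measurable_fun ((`]0%R, +oo[%classic : set (measurableTypeR R)) `*` D) (fun y : measurableTypeR R * X => y.1).
  exact: measurable_funTS measurable_fst.
have mf : cmeasurable ((`]0%R, +oo[%classic : set (measurableTypeR R)) `*` D) f.
  apply: cmeasurableM.
    apply/cmeasurable_cexp/cmeasurableM; first exact: cmeasurable_cst.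
    exact: cmeasurable_real.
  apply/cmeasurable_real/measurable_funM; first exact: m2.
  apply: measurable_bool_natr => //; apply: measurable_fun_ler => //; exact: m2.
have fb t x : `]0%R, +oo[%classic t -> D x -> normc (f (t, x)) <=
    expR (- ((complex.Re z - rho) * t)) * (`|w x| * expR (- (rho * tau x))).
  move=> _ Dx; rewrite /f normcM normc_cexp_mulNC normcC normrM/=.
  case: (lerP (tau x) t) => tx; last first.
    by rewrite normr0 !mulr0 !mulr_ge0 ?expR_ge0.
  rewrite normr1 mulr1 [leLHS]mulrC mulrCA ler_wpM2l// -expRD ler_expR.
  by have := ler_wpM2l rho0 tx; lra.
have iz : mu.-integrable `]0, +oo[
    (EFin \o (fun t => expR (- ((complex.Re z - rho) * t)))).
  have [+ _] := @integral_expRN R (complex.Re z - rho) 0 ltac:(lra).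
  by apply: integrableS => //; by apply: subset_itvr; rewrite bnd_simp.
have iu t : m.-integrable D (EFin \o (fun x => w x * (tau x <= t)%R%:R)).
  apply: (@integrable_dom _ _ _ m _ mD _
    (fun x => expR (rho * t) * (`|w x| * expR (- (rho * tau x))))).
  - by apply: measurable_funM => //; apply: measurable_bool_natr => //; exact: measurable_fun_ler.
  - move=> x Dx; rewrite normrM; case: (lerP (tau x) t) => tx; last first.
      by rewrite normr0 !mulr0 !mulr_ge0 ?expR_ge0.
    rewrite normr1 mulr1 mulrCA ler_peMr// -expRD -expR0 ler_expR.
    by have := ler_wpM2l rho0 tx; lra.
  - exact: integrableMc.
have E t : cintegral m D (fun x => f (t, x)) = laplace_integrand u z t.
  by rewrite /f /= cintegralZ ?cintegral_real//; exact: cintegrable_real.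
split.
  apply: (eq_cintegrable mD1 _ (cintegrable_Fubini1 mD1 mD iz iw mf fb)) => t _; exact: E.
transitivity (cintegral mu `]0, +oo[ (fun t => cintegral m D (fun x => f (t, x)))).
  by apply: eq_cintegral => t _; rewrite E.
rewrite (cintegral_Fubini mD1 mD iz iw mf fb).
rewrite -cintegralZ//; last first.
  apply: (@cintegrable_dom _ _ _ m _ mD _ (fun x => `|w x| * expR (- (rho * tau x)))) => //.
    apply: cmeasurableM; last exact: cmeasurable_real.
    apply/cmeasurable_cexp/cmeasurableM; first exact: cmeasurable_cst.
    exact: cmeasurable_real.
  move=> x Dx; rewrite normcM normc_cexp_mulNC normcC mulrC ler_wpM2l// ler_expR lerN2.
  by rewrite ler_wpM2r ?t0// ltW.
apply: eq_cintegral => x Dx.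
transitivity (cintegral mu `]0, +oo[ (fun t => (w x)%:C%C * cexp (- z * t%:C%C) *
    ((tau x <= t)%R%:R : R)%:C%C)).
  by apply: eq_cintegral => t _; rewrite /f /= rmorphM/=; ring.
rewrite cintegral_tail ?t0//; last first.
  by apply: cmeasurableM; [exact: cmeasurable_cst|exact: cmeasurable_cexp_mulNC].
have [i e] := @integral_cexp z (tau x) rz.
by rewrite cintegralZ// e; ring.
Qed.

End LaplaceBasics.

Section RealIntegralTools.
Context {R : realType}.
Notation mu := (@lebesgue_measure R).

(* [measurableTypeR R], the domain of [lebesgue_measure], and [R] carry the same
   sigma-algebra under different displays. *)
Lemma measurable_itvR (i : interval R) : measurable ([set` i] : set (measurableTypeR R)).
Proof. exact: measurable_itv. Qed.

Lemma continuous_measurable_funR (D : set (measurableTypeR R)) (f : R -> R) :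
  continuous f -> measurable_fun D f.
Proof. by move=> cf; apply: measurable_funTS; exact: continuous_measurable_fun. Qed.

Lemma continuous_gt0_measurable (f : R -> R) : (forall t : R, 0 < t -> {for t, continuous f}) ->
  measurable_fun (`]0, +oo[%classic : set (measurableTypeR R)) f.
Proof.
move=> cf; have : measurable_fun (`]0, +oo[%classic : set R) f.
  apply: open_continuous_measurable_fun; first exact: interval_open.
  by move=> y; rewrite inE/= in_itv/= andbT; exact: cf.
by [].
Qed.

Lemma Rintegral_dominated_cvg d (T : measurableType d) (m : {measure set T -> \bar R})
    (D : set T) (f_ : nat -> T -> R) (f g : T -> R) :
  measurable D -> (forall n, measurable_fun D (f_ n)) ->
  (forall x, D x -> f_ n x @[n --> \oo] --> f x) ->
  m.-integrable D (EFin \o g) ->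
  (forall n x, D x -> `|f_ n x| <= g x) ->
  \int[m]_(x in D) f_ n x @[n --> \oo] --> \int[m]_(x in D) f x.
Proof.
move=> mD mf ff ig fg.
have mfoo : measurable_fun D f by exact: measurable_fun_cvg ff.
have g0 x : D x -> 0 <= g x by move=> Dx; exact: le_trans (fg 0 x Dx).
have := @dominated_cvg _ _ _ m D mD (fun n x => (f_ n x)%:E) (EFin \o f) (EFin \o g).
move=> /(_ _ _ _ ig) H; apply: fine_cvg; rewrite fineK.
  apply: H => //.
  - by move=> n; exact/measurable_EFinP.
  - by move=> x Dx; apply: cvg_EFin; [exact: nearW|exact: ff].
apply: integrable_fin_num => //; apply: (integrable_dom mD mfoo _ ig) => x Dx.
have := ff _ Dx; move/cvg_norm => nf.
by apply: (cvgr_to_le nf); apply: nearW => n; exact: fg.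
Qed.

Lemma FTC_segment (F f : R -> R) (a b : R) : a < b ->
  (forall x, a <= x <= b -> is_derive x 1 F (f x)) ->
  (forall x, a <= x <= b -> {for x, continuous f}) ->
  mu.-integrable `[a, b] (EFin \o f) /\ \int[mu]_(x in `[a, b]) f x = F b - F a.
Proof.
move=> ab dF cf.
have cF x : a <= x <= b -> {for x, continuous F}.
  by move=> /dF[dx _]; exact/differentiable_continuous/derivable1_diffP.
have wf : {within `[a, b], continuous f}.
  apply/continuous_within_itvP => //; split.
  - by move=> x; rewrite in_itv/= => /andP[/ltW ? /ltW ?]; apply: cf; apply/andP.
  - by apply/cvg_at_right_filter/cf; rewrite lexx ltW.
  - by apply/cvg_at_left_filter/cf; rewrite lexx ltW.
split; first by apply: continuous_compact_integrable => //; exact: segment_compact.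
rewrite /Rintegral (@continuous_FTC2 _ f F)//.
- split.
  + by move=> x; rewrite in_itv/= => /andP[/ltW ? /ltW ?]; have [|] := dF x; first by apply/andP.
  + by apply/cvg_at_right_filter/cF; rewrite lexx ltW.
  + by apply/cvg_at_left_filter/cF; rewrite lexx ltW.
- move=> x; rewrite in_itv/= => /andP[/ltW ax /ltW xb].
  by rewrite derive1E; have /@derive_val := dF x ltac:(by apply/andP).
Qed.

Lemma integrable_halves (g : R -> R) : measurable_fun setT g ->
  mu.-integrable `[0, +oo[ (EFin \o g) ->
  mu.-integrable `[0, +oo[ (EFin \o (fun x => g (- x))) ->
  mu.-integrable setT (EFin \o g) /\
  \int[mu]_x g x = \int[mu]_(x in `[0, +oo[) g x + \int[mu]_(x in `[0, +oo[) g (- x).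
Proof.
move=> mg i1 i2.
have mphi : measurable_fun setT (fun x : R => 0 - x) by exact: measurable_funB.
have mg' : measurable_fun setT (fun x : R => g (- x)).
  under eq_fun do rewrite -sub0r; exact: measurableT_comp mg mphi.
have pre : (fun x : R => 0 - x) @^-1` `[0, +oo[ = `]-oo, 0]%classic.
  by apply/seteqP; split => x /=; rewrite !in_itv/= andbT sub0r oppr_ge0.
have i3 : mu.-integrable `]-oo, 0] (EFin \o g).
  have := integrable_isometry mphi (@lebesgue_measure_reflect _ 0) (measurable_itv _) i2.
  rewrite pre; apply: eq_integrable => // x _ /=; congr (g _)%:E; lra.
have i4 : mu.-integrable `]-oo, 0[ (EFin \o g).
  by apply: integrableS i3 => //; apply: subset_itvl; rewrite bnd_simp.
have ig : mu.-integrable setT (EFin \o g).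
  have := integrableD (@measurableT _ (measurableTypeR R)) ((integrable_mkcond _ (measurable_itvR _)).1 i1)
    ((integrable_mkcond _ (measurable_itvR _)).1 i4).
  apply: eq_integrable => // x _; rewrite /= /restrict !mem_setE !in_itv/= andbT.
  by case: ltP => _; rewrite ?adde0 ?add0e.
split=> //.
have TE : [set: R] = `[0, +oo[ `|` `]-oo, 0[.
  by apply/seteqP; split => x //= _; rewrite !in_itv/= andbT; case: (lerP 0 x); [left|right].
rewrite [in LHS]TE Rintegral_setU//; last 2 first.
- by rewrite -TE.
- apply/disj_set2P; rewrite -subset0 => x/=; rewrite !in_itv/= andbT => -[].
  by rewrite leNgt => /negP.
congr (_ + _).
transitivity (\int[mu]_(x in `]-oo, 0]) g x).
  rewrite /Rintegral; congr fine; apply: integral_itv_bndo_bndc.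
  exact/measurable_EFinP/measurable_funTS.
rewrite -pre /Rintegral; congr fine.
rewrite -(integral_isometry mphi (@lebesgue_measure_reflect _ 0) (measurable_itv _)).
  by apply: eq_integral => x _; congr (g _)%:E; lra.
by apply/measurable_EFinP/measurable_funTS.
Qed.

End RealIntegralTools.

(** * Inversion of the Laplace transform *)

Section Inversion.
Context {R : realType}.
Notation mu := (@lebesgue_measure R).

Lemma poisson_cos (e y : R) : 0 < e ->
  mu.-integrable setT (EFin \o (fun w => expR (- (e * `|w|)) * cos (w * y))) /\
  \int[mu]_w (expR (- (e * `|w|)) * cos (w * y)) = 2 * e / (e ^+ 2 + y ^+ 2).
Proof.
move=> e0; have [i E] := @integral_expRN_cos R e y 0 e0.
have mg : measurable_fun setT (fun w : R => expR (- (e * `|w|)) * cos (w * y)).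
  apply: continuous_measurable_fun => w; apply: cvgM.
    apply: continuous_comp; last exact: continuous_expR.
    by apply: cvgN; apply: cvgM; [exact: cvg_cst|apply: cvg_norm; exact: cvg_id].
  apply: continuous_comp; last exact: continuous_cos.
  by apply: cvgM; [exact: cvg_id|exact: cvg_cst].
have E1 w : (`[0, +oo[%classic : set R) w ->
    expR (- (e * `|w|)) * cos (w * y) = expR (- (e * w)) * cos (y * w).
  by rewrite /= in_itv/= andbT => w0; rewrite ger0_norm// mulrC [w * y]mulrC mulrC.
have E2 w : (`[0, +oo[%classic : set R) w ->
    expR (- (e * `|- w|)) * cos (- w * y) = expR (- (e * w)) * cos (y * w).
  by move=> w0; rewrite normrN mulNr cosN E1.
have [|| ig ->] := integrable_halves mg.
- exact: (integrable_congr (measurable_itvR _) E1 i).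
- exact: (integrable_congr (measurable_itvR _) E2 i).
split=> //.
have -> : \int[mu]_(x in `[0, +oo[) (expR (- (e * `|x|)) * cos (x * y)) =
  \int[mu]_(t in `[0, +oo[) (expR (- (e * t)) * cos (y * t)).
  by apply: eq_Rintegral => w; rewrite inE => w0; rewrite E1.
have -> : \int[mu]_(x in `[0, +oo[) (expR (- (e * `|- x|)) * cos (- x * y)) =
  \int[mu]_(t in `[0, +oo[) (expR (- (e * t)) * cos (y * t)).
  by apply: eq_Rintegral => w; rewrite inE => w0; rewrite E2.
rewrite E !mulr0 oppr0 expR0 cos0 sin0; field.
by rewrite gt_eqF// ltr_wpDr ?sqr_ge0// exprn_gt0.
Qed.

Lemma poisson_sin (e y : R) : 0 < e ->
  mu.-integrable setT (EFin \o (fun w => expR (- (e * `|w|)) * sin (w * y))) /\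
  \int[mu]_w (expR (- (e * `|w|)) * sin (w * y)) = 0.
Proof.
move=> e0; have [i E] := @integral_expRN_sin R e y 0 e0.
have mg : measurable_fun setT (fun w : R => expR (- (e * `|w|)) * sin (w * y)).
  apply: continuous_measurable_fun => w; apply: cvgM.
    apply: continuous_comp; last exact: continuous_expR.
    by apply: cvgN; apply: cvgM; [exact: cvg_cst|apply: cvg_norm; exact: cvg_id].
  apply: continuous_comp; last exact: continuous_sin.
  by apply: cvgM; [exact: cvg_id|exact: cvg_cst].
have E1 w : (`[0, +oo[%classic : set R) w ->
    expR (- (e * `|w|)) * sin (w * y) = expR (- (e * w)) * sin (y * w).
  by rewrite /= in_itv/= andbT => w0; rewrite ger0_norm// mulrC [w * y]mulrC mulrC.
have E2 w : (`[0, +oo[%classic : set R) w ->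
    expR (- (e * `|- w|)) * sin (- w * y) = - (expR (- (e * w)) * sin (y * w)).
  by move=> w0; rewrite normrN mulNr sinN mulrN E1.
have [|| ig ->] := integrable_halves mg.
- exact: (integrable_congr (measurable_itvR _) E1 i).
- exact: (integrable_congr (measurable_itvR _) E2 (integrableN i)).
split=> //.
rewrite -RintegralD//; last 2 first.
- exact: (integrable_congr (measurable_itvR _) E1 i).
- exact: (integrable_congr (measurable_itvR _) E2 (integrableN i)).
transitivity (\int[mu]_(w in `[0, +oo[) (0 : R)); last by rewrite /Rintegral integral0.
by apply: eq_Rintegral => w; rewrite inE => w0; rewrite (E1 _ w0) (E2 _ w0) subrr.
Qed.

Lemma poisson_cexp (e a y : R) : 0 < e ->
  cintegral mu setT (fun w => (expR (- (e * `|w|)))%:C%C * cexp ((a +i* w)%C * y%:C%C)) =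
  (expR (a * y) * (2 * e / (e ^+ 2 + y ^+ 2)))%:C%C.
Proof.
move=> e0; have [ic Ec] := @poisson_cos e y e0; have [si Es] := @poisson_sin e y e0.
have E w : (expR (- (e * `|w|)))%:C%C * cexp ((a +i* w)%C * y%:C%C) =
  ((expR (a * y) * (expR (- (e * `|w|)) * cos (w * y))) +i*
   (expR (a * y) * (expR (- (e * `|w|)) * sin (w * y))))%C.
  by rewrite /cexp ReM ImM/=; apply: complex_ext; rewrite ?ReM ?ImM/= !mulr0 !mul0r !subr0 !add0r; ring.
transitivity (cintegral mu setT (fun w =>
    ((expR (a * y) * (expR (- (e * `|w|)) * cos (w * y))) +i*
     (expR (a * y) * (expR (- (e * `|w|)) * sin (w * y))))%C)).
  by apply: eq_cintegral => w _; exact: E.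
apply: complex_ext => /=.
- by rewrite RintegralZl// Ec.
- by rewrite RintegralZl// Es mulr0.
Qed.

Lemma poisson_limit (u : R -> R) (t0 : R) : 0 < t0 ->
  mu.-integrable `]0, +oo[ (EFin \o u) -> {for t0, continuous u} ->
  \int[mu]_(s in `]0, +oo[)
    (u s * (2 * n.+1%:R^-1 / (n.+1%:R^-1 ^+ 2 + (t0 - s) ^+ 2))) @[n --> \oo] -->
  2 * pi * u t0.
Proof.
move=> t00 iu cu.
pose P (n : nat) (s : R) := 2 * n.+1%:R^-1 / (n.+1%:R^-1 ^+ 2 + (t0 - s) ^+ 2) : R.
have en (n : nat) : 0 < n.+1%:R^-1 :> R by rewrite invr_gt0.
have Pd (n : nat) s : 0 < n.+1%:R^-1 ^+ 2 + (t0 - s) ^+ 2 :> R.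
  by rewrite ltr_wpDr ?sqr_ge0// exprn_gt0.
have P0 (n : nat) (s : R) : 0 <= P n s by rewrite divr_ge0 ?mulr_ge0// ltW.
have dP (n : nat) (s : R) : is_derive s (1 : R) (fun s : R => 2 * atan ((s - t0) * n.+1%:R)) (P n s).
  apply: is_derive_eq; rewrite /GRing.scale/= /P.
  have := ltr0Sn R n; move: (n.+1%:R : R) => N N0.
  by field; rewrite gt_eqF//= gt_eqF// ltr_wpDr ?sqr_ge0.
have cP (n : nat) : continuous (P n).
  move=> s; apply: cvgM; first exact: cvg_cst.
  apply: cvgV; first by rewrite gt_eqF.
  apply: cvgD; first exact: cvg_cst.
  by apply: cvgM; (apply: cvgB; [exact: cvg_cst|exact: cvg_id]).
apply/cvgrPdist_le => e e0.
have pi0 := @pi_gt0 R.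
have eta0 : 0 < e / (4 * pi) by rewrite divr_gt0// mulr_gt0.
have /cvgrPdist_le/(_ _ eta0)[d0 /= d00 Hd] := cu.
pose d := Num.min d0 t0 / 2.
have dd0 : 0 < d by rewrite divr_gt0// lt_min d00.
have dlt0 : d < d0 by rewrite ltr_pdivrMr// mulr_natr mulr2n ltr_pwDl// ?lt_min ?d00// ge_min lexx.
have dltt : d < t0 by rewrite ltr_pdivrMr// mulr_natr mulr2n ltr_pwDl// ?lt_min ?d00// ge_min lexx orbT.
pose I := `[t0 - d, t0 + d]%classic : set (measurableTypeR R).
pose D := `]0, +oo[%classic : set (measurableTypeR R).
have mI : measurable I by exact: measurable_itvR.
have mD : measurable D by exact: measurable_itvR.
have mDI : measurable (D `\` I) by exact: measurableD.
have ID : I `<=` D.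
  by move=> s; rewrite /I /D /= !in_itv/= andbT => /andP[+ _]; apply: lt_le_trans; rewrite subr_gt0.
have mu_ : measurable_fun D u by have /integrableP[/measurable_EFinP] := iu.
have mP n : measurable_fun D (P n) by exact: measurable_funTS (continuous_measurable_fun (cP n)).
have iuP n : mu.-integrable D (EFin \o (fun s => u s * P n s)).
  apply: (@integrable_dom _ _ _ _ _ mD _ (fun s => (2 * n.+1%:R) * `|u s|)).
  - exact: measurable_funM mu_ (mP n).
  - move=> s _; rewrite normrM mulrC ler_wpM2r// ger0_norm// /P ler_pdivrMr//.
    rewrite [leRHS](_ : _ = 2 * n.+1%:R^-1 + 2 * n.+1%:R * (t0 - s) ^+ 2); last first.
      by field; rewrite addrC natr1.
    by rewrite lerDl mulr_ge0 ?sqr_ge0// mulr_ge0.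
  - exact/integrableMc/integrable_norm.
have [iPI EPI] : (forall n, mu.-integrable I (EFin \o P n)) /\
    forall n, \int[mu]_(s in I) P n s = 4 * atan (d * n.+1%:R).
  have H n : mu.-integrable I (EFin \o P n) /\ \int[mu]_(s in I) P n s = 4 * atan (d * n.+1%:R).
    have [i ->] := @FTC_segment R _ (P n) (t0 - d) (t0 + d) ltac:(lra)
      (fun s _ => dP n s) (fun s _ => cP n s).
    split => //; rewrite [t0 + d - t0]addrC addKr [t0 - d - t0]addrC addKr mulNr atanN; ring.
  by split=> n; have [] := H n.
pose M := \int[mu]_(s in D) `|u s|.
have K1 n : `|\int[mu]_(s in I) ((u s - u t0) * P n s)| <= e / 2.
  have iuPI : mu.-integrable I (EFin \o (fun s => (u s - u t0) * P n s)).
    have /(_ mI) := fun h => integrableB h (integrableS mD mI ID (iuP n)) (integrableMc mI (u t0) (iPI n)).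
    by apply: eq_integrable => // s _ /=; rewrite -EFinB mulrBl.
  rewrite (le_trans (le_normr_Rintegral _ _))//.
  apply: (@le_trans _ _ (\int[mu]_(s in I) (e / (4 * pi) * P n s))).
    apply: le_Rintegral => //; [exact: integrable_norm|exact: integrableMc|].
    move=> s; rewrite /I /= in_itv/= => /andP[s1 s2].
    rewrite normrM (ger0_norm (P0 _ _)) ler_wpM2r// distrC; apply: Hd => /=.
    by rewrite (le_lt_trans _ dlt0)// ler_norml; lra.
  rewrite RintegralZl// EPI.
  have : atan (d * n.+1%:R) <= pi / 2 by exact/ltW/atan_ltpi2.
  move=> /(ler_wpM2l (ltW eta0)); move/(ler_wpM2l (ler0n R 4)) => H.
  rewrite mulrCA (le_trans H)//; move: pi0; move: (pi : R) => q q0.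
  by rewrite le_eqVlt; apply/orP; left; apply/eqP; field; rewrite gt_eqF.
have K2 n : `|\int[mu]_(s in D `\` I) (u s * P n s)| <= (2 * M / d ^+ 2) * n.+1%:R^-1.
  rewrite (le_trans (le_normr_Rintegral _ _))//; first exact: (integrableS mD mDI (@subDsetl _ _ _) (iuP n)).
  apply: (@le_trans _ _ (\int[mu]_(s in D `\` I) ((2 / d ^+ 2 * n.+1%:R^-1) * `|u s|))).
    apply: le_Rintegral => //.
    - exact/integrable_norm/(integrableS mD mDI (@subDsetl _ _ _) (iuP n)).
    - exact/integrableMc/(integrableS mD mDI (@subDsetl _ _ _))/integrable_norm.
    move=> s [_]; rewrite /I /= in_itv/= => /negP sI.
    rewrite normrM mulrC ler_wpM2r// (ger0_norm (P0 _ _)) /P.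
    rewrite [leRHS]mulrAC ler_wpM2l ?invr_ge0//.
    rewrite lef_pV2 ?posrE ?exprn_gt0// ler_wpDl ?sqr_ge0//.
    rewrite -[leRHS]ger0_norm ?sqr_ge0// normrX ler_pXn2r ?nnegrE//; last exact: ltW.
    by rewrite ler_normr; move: sI; rewrite negb_and -!ltNge => /orP[] sd; apply/orP; [left|right]; lra.
  rewrite RintegralZl//; last exact/(integrableS mD mDI (@subDsetl _ _ _))/integrable_norm.
  rewrite [X in _ <= X](_ : _ = (2 / d ^+ 2 * n.+1%:R^-1) * M); last ring.
  rewrite ler_wpM2l//.
    by rewrite mulr_ge0 ?divr_ge0 ?sqr_ge0// ltW.
  rewrite /M /Rintegral fine_le//.
  - apply: integrable_fin_num => //; exact/(integrableS mD mDI (@subDsetl _ _ _))/integrable_norm.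
  - by apply: integrable_fin_num => //; exact: integrable_norm.
  apply: ge0_subset_integral => //; first by apply/measurable_EFinP; exact: measurableT_comp.
pose b n := `|u t0| * `|4 * atan (d * n.+1%:R) - 2 * pi| + (2 * M / d ^+ 2) * n.+1%:R^-1.
have b0 : b n @[n --> \oo] --> (0 : R).
  rewrite -[0](addr0 0); apply: cvgD; last first.
    by rewrite -(mulr0 (2 * M / d ^+ 2)); apply: cvgM; [exact: cvg_cst|exact: cvg_harmonic].
  rewrite -(mulr0 `|u t0|); apply: cvgM; first exact: cvg_cst.
  rewrite -(@normr0 _ R) -(subrr (2 * pi)); apply: cvg_norm; apply: cvgB; last exact: cvg_cst.
  rewrite (_ : 2 * pi = 4 * (pi / 2)); last by lra.
  apply: cvgM; first exact: cvg_cst.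
  apply: (@cvg_comp _ _ _ (fun n : nat => d * n.+1%:R) atan _ +oo); last exact: cvgy_atan.
  apply/cvgryPge => A; have /cvgryPge/(_ (A / d)) := @cvgr_idn R.
  by apply: filterS => n; rewrite ler_pdivrMr// mulrC -natr1 mulrDr => An; rewrite ler_wpDr// mulr1 ltW.
have e20 : 0 < e / 2 by rewrite divr_gt0.
have /cvgrPdist_le/(_ _ e20) := b0.
apply: filterS => n; rewrite sub0r normrN => bn.
have -> : \int[mu]_(s in `]0, +oo[) (u s * P n s) =
    \int[mu]_(s in I) ((u s - u t0) * P n s) + u t0 * (4 * atan (d * n.+1%:R)) +
    \int[mu]_(s in D `\` I) (u s * P n s).
  have DE : D = I `|` (D `\` I).
    by rewrite setDUK.
  rewrite -[LHS]/(\int[mu]_(s in D) (u s * P n s)) [in LHS]DE Rintegral_setU//; last 2 first.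
  - by rewrite -DE.
  - by apply/disj_set2P; rewrite setDE setIA setIAC setICr set0I.
  congr (_ + _); rewrite -EPI -RintegralZl// -RintegralD//.
  - by apply: eq_Rintegral => s _; ring.
  - have /(_ mI) := fun h => integrableB h (integrableS mD mI ID (iuP n)) (integrableMc mI (u t0) (iPI n)).
    by apply: eq_integrable => // s _ /=; rewrite -EFinB mulrBl.
  - exact: integrableMc.
have bn' : b n <= e / 2 by rewrite (le_trans (ler_norm _)).
rewrite distrC; set A := \int[mu]_(s in I) _; set C := \int[mu]_(s in D `\` I) _.
have -> : A + u t0 * (4 * atan (d * n.+1%:R)) + C - 2 * pi * u t0 =
  A + (u t0 * (4 * atan (d * n.+1%:R) - 2 * pi) + C) by ring.
rewrite (le_trans (ler_normD _ _))// [leRHS](splitr e) lerD//; first exact: K1.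
rewrite (le_trans (ler_normD _ _))// normrM (le_trans _ bn')// /b lerD2l.
exact: K2.
Qed.

End Inversion.

Section LaplaceInversion.
Context {R : realType}.
Notation mu := (@lebesgue_measure R).

Lemma integrable_expR_abs (e : R) : 0 < e ->
  mu.-integrable setT (EFin \o (fun w => expR (- (e * `|w|)))).
Proof.
move=> e0; have [i _] := @poisson_cos R e 0 e0.
by apply: (integrable_congr measurableT _ i) => w _; rewrite mulr0 cos0 mulr1.
Qed.

Lemma Rintegral_expR_abs_cvg (h : R -> R) :
  mu.-integrable setT (EFin \o h) ->
  \int[mu]_w (expR (- (n.+1%:R^-1 * `|w|)) * h w) @[n --> \oo] --> \int[mu]_w h w.
Proof.
move=> ih; have mh : measurable_fun setT h by have /integrableP[/measurable_EFinP] := ih.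
apply: (@Rintegral_dominated_cvg _ _ _ mu setT _ h (fun w => `|h w|)) => //.
- move=> n; apply: measurable_funM => //.
  by have /integrableP[/measurable_EFinP] := @integrable_expR_abs n.+1%:R^-1 ltac:(by rewrite invr_gt0).
- move=> w _; rewrite [X in _ --> X](_ : _ = expR (- (0 * `|w|)) * h w); last first.
    by rewrite mul0r oppr0 expR0 mul1r.
  apply: cvgM; last exact: cvg_cst.
  apply: continuous_cvg; first exact: continuous_expR.
  by apply: cvgN; apply: cvgM; [exact: cvg_harmonic|exact: cvg_cst].
- exact: integrable_norm.
- by move=> n w _; rewrite normrM ler_piMl// ger0_norm ?expR_ge0// expR_le1 oppr_le0 mulr_ge0.
Qed.

Lemma laplace_inversion (f : R -> R) (a t0 : R) : 0 < t0 ->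
  mu.-integrable `]0, +oo[ (EFin \o (fun t => expR (- (a * t)) * f t)) ->
  {for t0, continuous f} ->
  cintegrable mu setT (fun w => laplace f (a +i* w)%C) ->
  cintegral mu setT (fun w => cexp ((a +i* w)%C * t0%:C%C) * laplace f (a +i* w)%C) =
  (2 * pi * f t0)%:C%C.
Proof.
move=> t00; set u := fun t => expR (- (a * t)) * f t => iu cf iU.
pose D := `]0, +oo[%classic : set (measurableTypeR R).
have mD : measurable D by exact: measurable_itvR.
have mT : measurable (setT : set (measurableTypeR R)) by exact: measurableT.
pose e (n : nat) : R := n.+1%:R^-1.
have e0 n : 0 < e n by rewrite invr_gt0.
pose g n (z : measurableTypeR R * measurableTypeR R) : R[i] :=
  ((expR (- (e n * `|z.1|)))%:C%C * cexp ((a +i* z.1)%C * t0%:C%C)) *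
  laplace_integrand f (a +i* z.1)%C z.2.
have mf : measurable_fun D f.
  have /integrableP[/measurable_EFinP mu_ _] := iu.
  have : measurable_fun D (fun t => expR (a * t) * u t).
    apply: measurable_funM => //; apply: continuous_measurable_funR => x.
    apply: continuous_comp; last exact: continuous_expR.
    by apply: cvgM; [exact: cvg_cst|exact: cvg_id].
  by apply: eq_measurable_fun => t _; rewrite /u mulrA -expRD subrr expR0 mul1r.
have mX : measurable ((setT : set (measurableTypeR R)) `*` D) by exact: measurableX.
have m1 : measurable_fun (setT `*` D) (fun z : measurableTypeR R * measurableTypeR R => z.1).
  exact: measurable_funTS measurable_fst.
have m2 : measurable_fun (setT `*` D) (fun z : measurableTypeR R * measurableTypeR R => z.2).
  exact: measurable_funTS measurable_snd.
have mfz : measurable_fun (setT `*` D) (fun z : measurableTypeR R * measurableTypeR R => f z.2).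
  by apply: (measurable_comp mD _ mf m2) => _ [[x y] [/= _ Dy] <-].
have mabs n : measurable_fun (setT `*` D)
    (fun z : measurableTypeR R * measurableTypeR R => expR (- (e n * `|z.1|)) : R).
  have /integrableP[/measurable_EFinP mm _] := integrable_expR_abs (e0 n).
  exact: (measurable_comp mT (@subsetT _ _) mm m1).
have ma : cmeasurable (setT `*` D)
    (fun z : measurableTypeR R * measurableTypeR R => (a +i* z.1)%C).
  by split => //; exact: measurable_cst.
have mg n : cmeasurable (setT `*` D) (g n).
  apply: cmeasurableM; first apply: cmeasurableM; first exact: cmeasurable_real.
    by apply/cmeasurable_cexp/cmeasurableM => //; exact: cmeasurable_cst.
  apply: cmeasurableM; last exact: cmeasurable_real.
  apply/cmeasurable_cexp/cmeasurableM; first exact: cmeasurableN.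
  exact: cmeasurable_real.
have nt w : normc (cexp ((a +i* w)%C * t0%:C%C)) = expR (a * t0).
  by rewrite normc_cexp ReM/= mulr0 subr0.
have bg n w s : (setT : set (measurableTypeR R)) w -> D s ->
    normc (g n (w, s)) <= (expR (a * t0) * expR (- (e n * `|w|))) * `|u s|.
  move=> _ _; rewrite /g /laplace_integrand !normcM normc_cexp_mulNC nt !normcC/=.
  by rewrite /u normrM !(ger0_norm (expR_ge0 _)) [X in X * _ <= _]mulrC.
have iA n : mu.-integrable setT (EFin \o (fun w => expR (a * t0) * expR (- (e n * `|w|)))).
  exact/integrableMc/integrable_expR_abs.
have iu' : mu.-integrable D (EFin \o (fun s => `|u s|)) by exact: integrable_norm.
have EL n w : cintegral mu D (fun s => g n (w, s)) =
    (expR (- (e n * `|w|)))%:C%C * (cexp ((a +i* w)%C * t0%:C%C) * laplace f (a +i* w)%C).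
  rewrite mulrA -cintegralZ//.
  apply: (@cintegrable_dom _ _ _ _ _ mD _ (fun s => `|u s|)) => //.
    apply: cmeasurableM; last exact: cmeasurable_real.
    exact: cmeasurable_cexp_mulNC.
  move=> s _; rewrite /laplace_integrand normcM normc_cexp_mulNC normcC/=.
  by rewrite /u normrM ger0_norm ?expR_ge0.
have ER n s : cintegral mu setT (fun w => g n (w, s)) =
    (expR (a * t0) * (u s * (2 * e n / (e n ^+ 2 + (t0 - s) ^+ 2))))%:C%C.
  transitivity (cintegral mu setT (fun w =>
      (f s)%:C%C * ((expR (- (e n * `|w|)))%:C%C * cexp ((a +i* w)%C * (t0 - s)%:C%C)))).
    apply: eq_cintegral => w _; rewrite /g /laplace_integrand /=.
    rewrite (_ : (a +i* w)%C * (t0 - s)%:C%C = (a +i* w)%C * t0%:C%C + - (a +i* w)%C * s%:C%C); last first.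
      by rewrite rmorphB/=; ring.
    by rewrite cexpD; ring.
  rewrite cintegralZ//; last first.
    apply: (@cintegrable_dom _ _ _ _ _ mT _
      (fun w => expR (a * (t0 - s)) * expR (- (e n * `|w|)))).
    - apply: cmeasurableM.
        by apply: cmeasurable_real; have /integrableP[/measurable_EFinP] := integrable_expR_abs (e0 n).
      apply/cmeasurable_cexp/cmeasurableM; last exact: cmeasurable_cst.
      by split => /=; [exact: measurable_cst|exact: measurable_id].
    - move=> w _; rewrite normcM normcC normc_cexp ReM/= mulr0 subr0 mulrC.
      by rewrite ger0_norm ?expR_ge0.
    - exact/integrableMc/integrable_expR_abs.
  rewrite poisson_cexp// -rmorphM/=; congr (_%:C%C).
  by rewrite /u mulrBr expRD; ring.
have FE n : cintegral mu setT (fun w => (expR (- (e n * `|w|)))%:C%C *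
      (cexp ((a +i* w)%C * t0%:C%C) * laplace f (a +i* w)%C)) =
    (expR (a * t0) * \int[mu]_(s in D)
      (u s * (2 * e n / (e n ^+ 2 + (t0 - s) ^+ 2))))%:C%C.
  transitivity (cintegral mu setT (fun w => cintegral mu D (fun s => g n (w, s)))).
    by apply: eq_cintegral => w _; rewrite EL.
  rewrite (cintegral_Fubini mT mD (iA n) iu' (mg n) (bg n)).
  transitivity (cintegral mu D (fun s =>
      (expR (a * t0) * (u s * (2 * e n / (e n ^+ 2 + (t0 - s) ^+ 2))))%:C%C)).
    by apply: eq_cintegral => s _; rewrite ER.
  rewrite cintegral_real RintegralZl//.
  apply: (@integrable_dom _ _ _ _ _ mD _ (fun s => (2 / e n) * `|u s|)).
  - apply: measurable_funM; first by have /integrableP[/measurable_EFinP] := iu.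
    apply: continuous_measurable_funR => s.
    apply: cvgM; first exact: cvg_cst.
    apply: cvgV; first by rewrite gt_eqF// ltr_wpDr ?sqr_ge0// exprn_gt0.
    apply: cvgD; first exact: cvg_cst.
    by apply: cvgM; (apply: cvgB; [exact: cvg_cst|exact: cvg_id]).
  - move=> s _; rewrite normrM mulrC ler_wpM2r// ger0_norm; last first.
      by rewrite divr_ge0 ?mulr_ge0 ?addr_ge0 ?sqr_ge0// ltW.
    rewrite ler_pdivrMr; last by rewrite ltr_wpDr ?sqr_ge0// exprn_gt0.
    rewrite [leRHS](_ : _ = 2 * e n + 2 / e n * (t0 - s) ^+ 2); last first.
      by field; rewrite gt_eqF.
    by rewrite lerDl mulr_ge0 ?sqr_ge0// divr_ge0// ltW.
  - exact: integrableMc.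
pose h w := cexp ((a +i* w)%C * t0%:C%C) * laplace f (a +i* w)%C.
have [h1 h2] : cintegrable mu setT h.
  have cU := cintegrable_cmeasurable iU.
  apply: (@cintegrable_dom _ _ _ _ _ mT _ (fun w => expR (a * t0) * normc (laplace f (a +i* w)%C))).
  - apply: cmeasurableM => //.
    apply/cmeasurable_cexp/cmeasurableM; last exact: cmeasurable_cst.
    by split => /=; [exact: measurable_cst|exact: measurable_id].
  - by move=> w _; rewrite normcM nt.
  - exact/integrableMc/cintegrable_normc.
have cu : {for t0, continuous u}.
  apply: cvgM => //.
  apply: continuous_comp; last exact: continuous_expR.
  by apply: cvgN; apply: cvgM; [exact: cvg_cst|exact: cvg_id].
have E1 n : \int[mu]_w (expR (- (e n * `|w|)) * complex.Re (h w)) =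
    expR (a * t0) * \int[mu]_(s in D) (u s * (2 * e n / (e n ^+ 2 + (t0 - s) ^+ 2))).
  transitivity (complex.Re (cintegral mu setT (fun w => (expR (- (e n * `|w|)))%:C%C * h w))).
    by apply: eq_Rintegral => w _; rewrite ReZ.
  by rewrite FE.
have E2 n : \int[mu]_w (expR (- (e n * `|w|)) * complex.Im (h w)) = 0.
  transitivity (complex.Im (cintegral mu setT (fun w => (expR (- (e n * `|w|)))%:C%C * h w))).
    by apply: eq_Rintegral => w _; rewrite ImZ.
  by rewrite FE.
apply: complex_ext.
- have L1 := Rintegral_expR_abs_cvg h1.
  have L2 := poisson_limit t00 iu cu.
  have L3 : expR (a * t0) * \int[mu]_(s in D) (u s * (2 * e n / (e n ^+ 2 + (t0 - s) ^+ 2)))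
      @[n --> \oo] --> expR (a * t0) * (2 * pi * u t0).
    by apply: cvgM; [exact: cvg_cst|exact: L2].
  have L4 : expR (a * t0) * \int[mu]_(s in D) (u s * (2 * e n / (e n ^+ 2 + (t0 - s) ^+ 2)))
      @[n --> \oo] --> \int[mu]_w complex.Re (h w).
    by apply: cvg_trans L1; apply: near_eq_cvg; apply: nearW => n; exact: E1.
  rewrite [LHS](cvg_unique _ L4 L3)// /u mulrCA [expR _ * (_ * _)]mulrA -expRD subrr expR0 mul1r.
  by [].
- have L1 := Rintegral_expR_abs_cvg h2.
  have L4 : (0 : R) @[n --> \oo] --> \int[mu]_w complex.Im (h w).
    by apply: cvg_trans L1; apply: near_eq_cvg; apply: nearW => n; exact: E2.
  by rewrite [LHS](cvg_unique _ L4 (cvg_cst 0)).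
Qed.

End LaplaceInversion.

(** * The Gamma integral on vertical lines *)

Section Oscillation.
Context {R : realType}.
Notation mu := (@lebesgue_measure R).

Lemma integrable_shift (f : R -> R) (c : R) : mu.-integrable setT (EFin \o f) ->
  mu.-integrable setT (EFin \o (fun x => f (x + c))) /\
  \int[mu]_x f (x + c) = \int[mu]_x f x.
Proof.
move=> i; have mphi : measurable_fun setT (fun x : R => x + c) by exact: measurable_funD.
have iso := @lebesgue_measure_shift R c.
split; first exact: (integrable_isometry mphi iso measurableT i).
have mf : measurable_fun setT (EFin \o f) by have /integrableP[] := i.
by rewrite /Rintegral -[in RHS](integral_isometry mphi iso measurableT mf) preimage_setT.
Qed.

(* Translating by the half-period [h] changes the sign of [c], so twice the
   integral is the integral of [c r * (k r - k (r + h))], and [k] is monotone. *)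
Lemma oscillation_bound (k c : R -> R) (h : R) : 0 < h ->
  mu.-integrable `]0, +oo[ (EFin \o k) -> (forall r, 0 < r -> 0 <= k r) ->
  (forall r s, 0 < r -> r <= s -> k s <= k r) ->
  continuous c -> (forall r, `|c r| <= 1) -> (forall r, c (r + h) = - c r) ->
  `|\int[mu]_(r in `]0, +oo[) (c r * k r)| <= \int[mu]_(r in `]0, h]) k r.
Proof.
move=> h0 ik k0 kni cc c1 ch.
pose D := `]0, +oo[%classic : set (measurableTypeR R).
have mD : measurable D by exact: measurable_itvR.
have mH : measurable (`]0, h]%classic : set (measurableTypeR R)) by exact: measurable_itvR.
pose K : R -> R := k \_ D.
pose K1 : R -> R := k \_ `]0, h].
have KE r : K r = if 0 < r then k r else 0 by rewrite /K patchE mem_setE in_itv/= andbT.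
have K1E r : K1 r = if 0 < r <= h then k r else 0 by rewrite /K1 patchE mem_setE in_itv.
have iK : mu.-integrable setT (EFin \o K).
  by rewrite /K -restrict_EFin; exact: (integrable_mkcond _ mD).1.
have iK1 : mu.-integrable setT (EFin \o K1).
  rewrite /K1 -restrict_EFin; apply: (integrable_mkcond _ mH).1.
  by apply: integrableS ik => //; apply: subset_itvl; rewrite bnd_simp.
have mT : measurable (setT : set (measurableTypeR R)) by exact: measurableT.
have mc : measurable_fun (setT : set (measurableTypeR R)) c by exact: continuous_measurable_funR.
have mK (G : R -> R) : mu.-integrable setT (EFin \o G) -> measurable_fun (setT : set (measurableTypeR R)) G.
  by move=> /integrableP[/measurable_EFinP].
have icM (G : R -> R) : mu.-integrable setT (EFin \o G) ->
    mu.-integrable setT (EFin \o (fun r => c r * G r)).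
  move=> iG; apply: (integrable_dom mT _ _ (integrable_norm iG)).
    by apply: measurable_funM => //; exact: mK.
  by move=> r _; rewrite normrM ler_piMl.
have [iKh EKh] := integrable_shift h iK.
have [iK1h EK1h] := integrable_shift h iK1.
have [_ EcK] := integrable_shift h (icM _ iK).
set G := \int[mu]_(r in `]0, +oo[) (c r * k r).
have GE : G = \int[mu]_r (c r * K r).
  rewrite /G Rintegral_mkcond; apply: eq_Rintegral => r _.
  by rewrite patchE mem_setE in_itv/= andbT KE; case: ifP; rewrite ?mulr0.
have E2 : 2 * G = \int[mu]_r (c r * (K r - K (r + h))).
  transitivity (\int[mu]_r (c r * K r) - \int[mu]_r (c r * K (r + h))).
    rewrite -GE mulrDl mul1r; congr (_ + _).
    rewrite GE -EcK -mulN1r -RintegralZl//; last exact: icM.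
    by apply: eq_Rintegral => r _; rewrite ch mulN1r mulNr.
  rewrite -RintegralB//; [|exact: icM|exact: icM].
  by apply: eq_Rintegral => r _; rewrite mulrBr.
have iKK : mu.-integrable setT (EFin \o (fun r => K r - K (r + h))).
  have /(_ mT) := fun h => integrableB h iK iKh.
  by apply: integrable_congr.
have le2 : `|2 * G| <= 2 * \int[mu]_(r in `]0, h]) k r.
  rewrite E2 (le_trans (le_normr_Rintegral _ _))//; first exact: icM.
  have -> : 2 * \int[mu]_(r in `]0, h]) k r =
      \int[mu]_r ((K r - K (r + h)) + 2 * K1 (r + h)).
    rewrite RintegralD//; last exact: integrableMc.
    rewrite RintegralB// EKh subrr add0r RintegralZl// EK1h; congr (_ * _).
    by rewrite Rintegral_mkcond.
  apply: le_Rintegral => //.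
  - exact/integrable_norm/icM.
  - have /(_ mT) := fun h' => integrableD h' iKK (integrableMc mT 2 iK1h).
    exact: integrable_congr.
  move=> r _; rewrite normrM (le_trans (ler_piMl _ (c1 r)))// !KE K1E.
  case: (ltP 0 r) => r0.
    have rh0 : 0 < r + h by exact: addr_gt0.
    have -> : (r + h <= h) = false by apply/negbTE; rewrite -ltNge ltrDr.
    rewrite rh0 andbF mulr0 addr0.
    by rewrite ger0_norm// subr_ge0 kni// lerDl ltW.
  case: (ltP 0 (r + h)) => rh /=; last by rewrite subr0 normr0 mulr0 addr0.
  have -> : (r + h <= h) = true by rewrite gerDr.
  by rewrite sub0r normrN ger0_norm ?k0// mulr2n mulrDl !mul1r addKr.
by move: le2; rewrite normrM ger0_norm// ler_pM2l.
Qed.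

Lemma FTC_left_singular (F f : R -> R) (a b l : R) : a < b ->
  (forall x, a < x <= b -> 0 <= f x) ->
  (forall x, a < x <= b -> is_derive x 1 F (f x)) ->
  (forall x, a < x <= b -> {for x, continuous f}) ->
  F x @[x --> a^'+] --> l ->
  mu.-integrable `]a, b] (EFin \o f) /\ \int[mu]_(x in `]a, b]) f x = F b - l.
Proof.
move=> ab f0 dF cf Fl.
pose x (n : nat) : R := a + (b - a) / n.+2%:R.
have xa n : a < x n by rewrite ltrDl divr_gt0// subr_gt0.
have xb n : x n < b.
  rewrite /x -ltrBrDl ltr_pdivrMr// -[X in X < _]mulr1 ltr_pM2l ?subr_gt0//.
  by rewrite ltr1n.
have xca : x n @[n --> \oo] --> a.
  rewrite -[X in _ --> X]addr0 -(mulr0 (b - a)); apply: cvgD; first exact: cvg_cst.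
  apply: cvgM; first exact: cvg_cst.
  apply/(@cvgrPdist_le _ R^o) => e e0.
  have /cvgrPdist_le/(_ _ e0) := @cvg_harmonic R.
  apply: filterS => n; rewrite !sub0r !normrN => h; apply: le_trans h.
  rewrite !ger0_norm ?invr_ge0//= lef_pV2 ?posrE//.
  by rewrite ler_nat.
have Fx : F (x n) @[n --> \oo] --> l by move/cvg_at_rightP : Fl; apply; split.
pose D := `]a, b]%classic : set (measurableTypeR R).
have mD : measurable D by exact: measurable_itvR.
have mf : measurable_fun (`]a, b]%classic : set R) f.
  apply/measurable_fun_itv_bndo_bndcP.
  apply: open_continuous_measurable_fun; first exact: interval_open.
  by move=> y; rewrite inE/= in_itv/= => /andP[ay yb]; apply: cf; rewrite ay ltW.
pose f_ n y := f y * (x n <= y)%R%:R.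
have mf_ n : measurable_fun D (f_ n).
  by apply: measurable_funM => //; apply: measurable_bool_natr => //; exact: measurable_fun_ler.
have E n : (\int[mu]_(y in D) (f_ n y)%:E = (F b - F (x n))%:E)%E.
  have [i <-] := @FTC_segment R F f (x n) b (xb n)
    (fun y ybd => dF y ltac:(case/andP: ybd => h ->; rewrite (lt_le_trans (xa n) h)//))
    (fun y ybd => cf y ltac:(case/andP: ybd => h ->; rewrite (lt_le_trans (xa n) h)//)).
  rewrite /Rintegral fineK; last by apply: integrable_fin_num.
  have -> : `[x n, b]%classic = D `&` `[x n, b]%classic.
    apply/esym/setIidPr => y; rewrite /D /= !in_itv/= => /andP[h ->].
    by rewrite (lt_le_trans (xa n) h).
  rewrite integral_mkcondr; apply: eq_integral => y; rewrite inE /D/= in_itv/= => /andP[ay yb].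
  rewrite /restrict mem_setE in_itv/= yb andbT /f_.
  by case: ifP => _; rewrite ?mulr1 ?mulr0.
have lim_ : (\int[mu]_(y in D) (f_ n y)%:E @[n --> \oo] --> \int[mu]_(y in D) (f y)%:E)%E.
  have -> : (\int[mu]_(y in D) (f y)%:E = \int[mu]_(y in D) limn (fun n => (f_ n y)%:E))%E.
    apply: eq_integral => y; rewrite inE /D/= in_itv/= => /andP[ay yb].
    apply/esym/cvg_lim => //; apply: cvg_EFin; first exact: nearW.
    apply: (@cvg_trans _ (f y @[n --> \oo])); last exact: cvg_cst.
    apply: near_eq_cvg.
    have : \forall n \near \oo, x n <= y by exact: (cvgr_le _ xca).
    by apply: filterS => n xy; rewrite /= /f_ xy mulr1.
  apply: cvg_monotone_convergence => //.
  - by move=> n; exact/measurable_EFinP.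
  - move=> n y; rewrite /D/= in_itv/= => yab; rewrite lee_fin mulr_ge0//.
    exact: f0.
  - move=> y; rewrite /D/= in_itv/= => yab m n mn; rewrite lee_fin /f_ ler_wpM2l ?f0//.
    rewrite ler_nat; case: (lerP (x m) y) => //= xmy.
    rewrite lt0b; apply: le_trans xmy; rewrite /x lerD2l ler_wpM2l ?subr_ge0 ?(ltW ab)//.
    by rewrite lef_pV2 ?posrE// ler_nat.
have EF : (\int[mu]_(y in D) (f y)%:E = (F b - l)%:E)%E.
  have lim2 : ((F b - F (x n))%:E @[n --> \oo] --> (F b - l)%:E)%E.
    by apply: cvg_EFin; [exact: nearW|apply: cvgB => //; exact: cvg_cst].
  have lim3 : ((F b - F (x n))%:E @[n --> \oo] --> \int[mu]_(y in D) (f y)%:E)%E.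
    by apply: cvg_trans lim_; apply: near_eq_cvg; apply: nearW => n; exact: E.
  exact: (cvg_unique _ lim3 lim2).
split; last by rewrite /Rintegral EF.
apply/integrableP; split; first exact/measurable_EFinP.
rewrite (_ : (\int[mu]_(y in _) _)%E = (F b - l)%:E) ?ltry// -EF.
apply: eq_integral => y; rewrite inE /D/= in_itv/= => yab.
by rewrite ger0_norm// f0.
Qed.

Lemma integral_powR_near0 (al h : R) : 0 < al -> 0 < h ->
  mu.-integrable `]0, h] (EFin \o (fun r => r `^ (al - 1))) /\
  \int[mu]_(r in `]0, h]) r `^ (al - 1) = h `^ al / al.
Proof.
move=> al0 h0.
have [||||i ->] := @FTC_left_singular (fun r => r `^ al / al) (fun r => r `^ (al - 1)) 0 h 0 h0.
- by move=> x _; exact: powR_ge0.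
- move=> x /andP[x0 _]; have d := is_derive1_powR al x0.
  by apply: is_derive_eq; rewrite /GRing.scale/=; field; rewrite gt_eqF.
- move=> x /andP[x0 _]; apply/differentiable_continuous/derivable1_diffP.
  by have [] := is_derive1_powR (al - 1) x0.
- rewrite -[X in _ --> X](mul0r al^-1); apply: cvgM; last exact: cvg_cst.
  exact: powR_cvg0.
by split => //; rewrite subr0.
Qed.

Lemma integrable_gamma (al a : R) : 0 < al < 1 -> 0 < a ->
  mu.-integrable `]0, +oo[ (EFin \o (fun r => r `^ (al - 1) * expR (- (a * r)))).
Proof.
move=> /andP[al0 al1] a0.
pose D := `]0, +oo[%classic : set (measurableTypeR R).
have mD : measurable D by exact: measurable_itvR.
have mH : measurable (`]0, 1]%classic : set (measurableTypeR R)) by exact: measurable_itvR.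
have [i1 _] := integral_powR_near0 al0 (@ltr01 R).
have [i2 _] := @integral_expRN R a 0 a0.
have i2' : mu.-integrable D (EFin \o (fun t => expR (- (a * t)))).
  by apply: integrableS i2 => //; apply: subset_itvr; rewrite bnd_simp.
pose g : R -> R := (fun r => r `^ (al - 1)) \_ `]0, 1].
have ig : mu.-integrable D (EFin \o g).
  apply: (@integrableS _ _ _ _ setT) => //.
  by rewrite /g -restrict_EFin; exact: (integrable_mkcond _ mH).1.
apply: (@integrable_dom _ _ _ _ _ mD _ (fun r => g r + expR (- (a * r)))).
- apply: measurable_funM; first by apply: measurable_funTS; exact: measurable_powR.
  by have /integrableP[/measurable_EFinP] := i2'.
- move=> r; rewrite /D/= in_itv/= andbT => r0.
  rewrite ger0_norm ?mulr_ge0 ?powR_ge0 ?expR_ge0// /g patchE mem_setE in_itv/= r0/=.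
  case: ifPn => [r1|]; last first.
    rewrite -ltNge => r1; rewrite add0r ler_piMl ?expR_ge0//.
    by rewrite -[leRHS](powRr0 r); apply: ler_powR; [exact: ltW|lra].
  rewrite (@le_trans _ _ (r `^ (al - 1)))//; last by rewrite lerDl expR_ge0.
  by rewrite ler_piMr ?powR_ge0// expR_le1 oppr_le0 mulr_ge0// ltW.
- have /(_ mD) := fun h => integrableD h ig i2'.
  exact: integrable_congr.
Qed.

Lemma cintegrable_gamma (al : R) (z : R[i]) : 0 < al < 1 -> 0 < complex.Re z ->
  has_laplace (fun r => r `^ (al - 1)) z.
Proof.
move=> al01 z0.
have mD : measurable (`]0, +oo[%classic : set (measurableTypeR R)) by exact: measurable_itvR.
apply: (cintegrable_dom mD _ _ (integrable_gamma al01 z0)).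
  apply: cmeasurableM; first exact: cmeasurable_cexp_mulNC.
  by apply: cmeasurable_real; apply: measurable_funTS; exact: measurable_powR.
move=> r _; rewrite /laplace_integrand normcM normc_cexp_mulNC normcC.
by rewrite ger0_norm ?powR_ge0// mulrC.
Qed.

Lemma gamma_decay (al a : R) : 0 < al < 1 -> 0 < a ->
  exists C, 0 <= C /\ forall w : R,
    normc (laplace (fun r => r `^ (al - 1)) (a +i* w)%C) <= C * (1 + `|w|) `^ (- al).
Proof.
move=> /[dup] al01 /andP[al0 al1] a0.
pose D := `]0, +oo[%classic : set (measurableTypeR R).
have mD : measurable D by exact: measurable_itvR.
pose k r : R := r `^ (al - 1) * expR (- (a * r)).
have ik : mu.-integrable D (EFin \o k) by exact: integrable_gamma.
have k0 r : 0 <= k r by rewrite mulr_ge0 ?powR_ge0 ?expR_ge0.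
pose G := \int[mu]_(r in D) k r.
have G0 : 0 <= G by apply: Rintegral_ge0 => r _; exact: k0.
have b1 w : normc (laplace (fun r => r `^ (al - 1)) (a +i* w)%C) <= 2 * G.
  apply: (normc_cintegral_le mD _ _ ik).
    apply: cmeasurableM; first exact: cmeasurable_cexp_mulNC.
    by apply: cmeasurable_real; apply: measurable_funTS; exact: measurable_powR.
  move=> r _; rewrite /laplace_integrand normcM normc_cexp_mulNC normcC/=.
  by rewrite ger0_norm ?powR_ge0// mulrC.
have kni r s : 0 < r -> r <= s -> k s <= k r.
  move=> r0 rs; rewrite ler_pM ?powR_ge0 ?expR_ge0//; last first.
    by rewrite ler_expR lerN2 ler_pM2l.
  rewrite -(opprB 1 al) !powRN lef_pV2 ?posrE ?powR_gt0//; last exact: lt_le_trans rs.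
  rewrite ge0_ler_powR ?nnegrE//; lra.
have b2 w : w != 0 -> normc (laplace (fun r => r `^ (al - 1)) (a +i* w)%C) <=
    2 * ((pi / `|w|) `^ al / al).
  move=> w0; have h0 : 0 < pi / `|w| by rewrite divr_gt0 ?pi_gt0 ?normr_gt0.
  have kle : \int[mu]_(r in `]0, pi / `|w|]) k r <= (pi / `|w|) `^ al / al.
    have [i <-] := integral_powR_near0 al0 h0.
    apply: le_Rintegral => //.
      by apply: integrableS ik => //; apply: subset_itvl; rewrite bnd_simp.
    move=> r; rewrite /= in_itv/= => /andP[r0 _]; rewrite ler_piMr ?powR_ge0//.
    by rewrite expR_le1 oppr_le0 mulr_ge0// ltW.
  have wE : w * (pi / `|w|) = pi \/ w * (pi / `|w|) = - pi.
    have [wp|wn] := ltP 0 w; [left|right].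
      by rewrite gtr0_norm// mulrCA divff ?mulr1.
    by rewrite ler0_norm// invrN mulrN mulrN mulrCA divff ?mulr1.
  have cp r : cos (w * (r + pi / `|w|)) = - cos (w * r).
    rewrite mulrDr; case: wE => ->; first by rewrite cosDpi.
    by rewrite -[in RHS](subrK pi (w * r)) cosDpi opprK.
  have sp r : sin (w * (r + pi / `|w|)) = - sin (w * r).
    by rewrite mulrDr; case: wE => ->; [rewrite sinDpi|rewrite -[in RHS](subrK pi (w * r)) sinDpi opprK].
  have cwc : continuous (fun r : R => cos (w * r)).
    move=> r; apply: continuous_comp; last exact: continuous_cos.
    by apply: cvgM; [exact: cvg_cst|exact: cvg_id].
  have cws : continuous (fun r : R => sin (w * r)).
    move=> r; apply: continuous_comp; last exact: continuous_sin.
    by apply: cvgM; [exact: cvg_cst|exact: cvg_id].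
  rewrite (le_trans (normc_le_ReIm _))// mulrDl mul1r lerD//.
  - apply: le_trans kle; rewrite [X in `|X|](_ : _ = \int[mu]_(r in D) (cos (w * r) * k r)).
      apply: oscillation_bound => // r; by rewrite ler_norml cos_geN1 cos_le1.
    by apply: eq_Rintegral => r _; rewrite /laplace_integrand ReM cexp_mulNC/= mulr0 subr0 /k; ring.
  - apply: le_trans kle; rewrite -normrN [X in `|X|](_ : _ = \int[mu]_(r in D) (sin (w * r) * k r)).
      apply: oscillation_bound => // r; by rewrite ler_norml sin_geN1 sin_le1.
    rewrite -[LHS]mulN1r -[complex.Im _]/(\int[mu]_(r in D) complex.Im
      (laplace_integrand (fun r => r `^ (al - 1)) (a +i* w)%C r)).
    rewrite -RintegralZl//; last exact: (@cintegrable_gamma al (a +i* w)%C al01 a0).2.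
    by apply: eq_Rintegral => r _; rewrite /laplace_integrand ImM cexp_mulNC/= mulr0 add0r /k; ring.
have pa0 : 0 <= 2 * (pi `^ al / al) :> R.
  by rewrite mulr_ge0// divr_ge0 ?powR_ge0// ltW.
exists (2 `^ al * (2 * G + 2 * (pi `^ al / al))); split.
  by apply: mulr_ge0; [exact: powR_ge0|apply: addr_ge0 => //; exact: mulr_ge0].
move=> w.
have w1 : 0 < 1 + `|w| by rewrite ltr_pwDl.
have P1 : 0 < (1 + `|w|) `^ al by rewrite powR_gt0.
rewrite powRN ler_pdivlMr//.
have [wl|wg] := lerP `|w| 1.
  rewrite mulrC ler_pM ?powR_ge0 ?normc_ge0//.
    rewrite ge0_ler_powR ?nnegrE//; lra.
  by rewrite (le_trans (b1 w))// lerDl.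
have w0 : 0 < `|w| by rewrite (lt_trans _ wg).
rewrite (@le_trans _ _ (2 * ((pi / `|w|) `^ al / al) * (2 * `|w|) `^ al))//.
  rewrite ler_pM ?powR_ge0 ?normc_ge0// ?b2 -?normr_gt0//.
  rewrite ge0_ler_powR ?nnegrE//; lra.
rewrite !powRM ?invr_ge0 ?(ltW (pi_gt0 R))//.
rewrite (_ : _ * _ = 2 `^ al * (2 * (pi `^ al / al)) * (`|w|^-1 `^ al * `|w| `^ al)); last ring.
rewrite -powRM ?invr_ge0// mulVf ?gt_eqF// powR1 mulr1.
by rewrite ler_wpM2l ?powR_ge0// lerDr mulr_ge0.
Qed.

End Oscillation.

(** * The variance of the fractional Ornstein-Uhlenbeck process *)

Lemma continuous_powR_gt0 {R : realType} (p s : R) : 0 < s ->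
  {for s, continuous (fun r : R => r `^ p)}.
Proof.
move=> s0; apply/differentiable_continuous/derivable1_diffP.
by have [] := is_derive1_powR p s0.
Qed.

Section OUKernel.
Context {R : realType}.
Notation mu := (@lebesgue_measure R).
Variable al : R.
Hypothesis al01 : 0 < al < 1.

Let al0 : 0 < al. Proof. by case/andP: al01. Qed.

Definition ou_mass (s : R) : R := \int[mu]_(r in `]0, s]) (expR r * r `^ (al - 1)).

Definition ou_kernel (s : R) : R := expR (- (2 * s)) * ou_mass s.

Let measurable_mass (D : set (measurableTypeR R)) :
  measurable_fun D (fun r : R => expR r * r `^ (al - 1)).
Proof.
apply: measurable_funM; first exact: continuous_measurable_funR (@continuous_expR R).
by apply: measurable_funTS; exact: measurable_powR.
Qed.

Lemma integrable_ou_mass (s : R) :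
  mu.-integrable `]0, s] (EFin \o (fun r => expR r * r `^ (al - 1))).
Proof.
have [s0|s0] := ltP 0 s; last by rewrite set_itv_ge ?bnd_simp -?leNgt//; exact: integrable_set0.
have [i _] := integral_powR_near0 al0 s0.
have mD := measurable_itvR `]0, s].
apply: (@integrable_dom _ _ _ mu _ mD _ (fun r => expR s * r `^ (al - 1))).
- exact: measurable_mass.
- move=> r; rewrite /= in_itv/= => /andP[r0 rs].
  by rewrite ger0_norm ?mulr_ge0 ?expR_ge0 ?powR_ge0// ler_wpM2r ?powR_ge0// ler_expR.
- exact: integrableMc.
Qed.

Lemma ou_mass_bounds (s : R) : 0 < s -> s `^ al / al <= ou_mass s <= expR s * (s `^ al / al).
Proof.
move=> s0; have [i <-] := integral_powR_near0 al0 s0; apply/andP; split.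
  apply: le_Rintegral => //; first exact: integrable_ou_mass.
  move=> r; rewrite /= in_itv/= => /andP[r0 rs].
  by rewrite ler_peMl ?powR_ge0// -expR0 ler_expR ltW.
rewrite -RintegralZl//; apply: le_Rintegral => //; first exact: integrable_ou_mass.
  exact: (integrableMc (measurable_itvR _)).
move=> r; rewrite /= in_itv/= => /andP[r0 rs].
by rewrite ler_wpM2r ?powR_ge0// ler_expR.
Qed.

Lemma is_derive_ou_mass (s : R) : 0 < s ->
  is_derive s 1 ou_mass (expR s * s `^ (al - 1)).
Proof.
move=> s0.
have cm : {for s, continuous (fun r : R => expR r * r `^ (al - 1))}.
  by apply: cvgM; [exact: continuous_expR|exact: continuous_powR_gt0].
have [|| d e] := @continuous_FTC1 R (fun r => expR r * r `^ (al - 1)) (BRight 0) s (s + 1) _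
  (integrable_ou_mass (s + 1)) _ cm.
- by rewrite ltrDl.
- exact: s0.
by apply: DeriveDef; [exact: d|rewrite -derive1E; exact: e].
Qed.

Lemma is_derive_ou_kernel (s : R) : 0 < s -> is_derive s 1 ou_kernel
  (expR (- s) * s `^ (al - 1) - 2 * ou_kernel s).
Proof.
move=> s0; have d := is_derive_ou_mass s0.
apply: is_derive_eq; rewrite /GRing.scale/= /ou_kernel.
have -> : expR (- s) = expR (- (2 * s)) * expR s by rewrite -expRD; congr expR; lra.
ring.
Qed.

Lemma continuous_ou_kernel (s : R) : 0 < s -> {for s, continuous ou_kernel}.
Proof.
move=> s0; apply/differentiable_continuous/derivable1_diffP.
by have [] := is_derive_ou_kernel s0.
Qed.

Lemma ou_kernel_gt0 (s : R) : 0 < s -> 0 < ou_kernel s.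
Proof.
move=> s0; rewrite mulr_gt0 ?expR_gt0//.
have /andP[+ _] := ou_mass_bounds s0; apply: lt_le_trans.
by rewrite divr_gt0// powR_gt0.
Qed.

Lemma ou_kernel0 : ou_kernel 0 = 0.
Proof. by rewrite /ou_kernel /ou_mass set_itv_ge ?bnd_simp// Rintegral_set0 mulr0. Qed.

Lemma powR_le_1D (s : R) : 0 <= s -> s `^ al <= 1 + s.
Proof.
move=> s0; have [s1|s1] := lerP s 1.
  rewrite (@le_trans _ _ 1)//; last by rewrite lerDl.
  have : s `^ al <= 1 `^ al by rewrite ge0_ler_powR ?nnegrE// ltW.
  by rewrite powR1.
rewrite (@le_trans _ _ s)//; last by rewrite lerDr.
by rewrite -[leRHS]powRr1//; apply: ler_powR; [exact: ltW|case/andP: al01 => _ /ltW].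
Qed.

Lemma ou_kernel_le (s : R) : 0 < s -> ou_kernel s <= expR (- s) * (s `^ al / al).
Proof.
move=> s0; have /andP[_ h] := ou_mass_bounds s0.
rewrite /ou_kernel (_ : expR (- s) = expR (- (2 * s)) * expR s).
  by rewrite -mulrA ler_wpM2l ?expR_ge0.
by rewrite -expRD; congr expR; lra.
Qed.

Lemma ou_kernel_bounded (s : R) : 0 < s -> ou_kernel s <= al^-1.
Proof.
move=> s0; rewrite (le_trans (ou_kernel_le s0))// mulrA ler_piMl ?invr_ge0 ?(ltW al0)//.
rewrite (@le_trans _ _ (expR (- s) * expR s))//; last by rewrite -expRD addNr expR0.
rewrite ler_wpM2l ?expR_ge0// (le_trans (powR_le_1D (ltW s0)))//.
exact: expR_ge1Dx.
Qed.

Lemma ou_kernel_derive_bound (s : R) : 0 < s ->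
  s * `|expR (- s) * s `^ (al - 1) - 2 * ou_kernel s| <= 1 + 6 / al.
Proof.
move=> s0; have k0 := ou_kernel_gt0 s0.
rewrite -[X in X * _](gtr0_norm s0) -normrM mulrBr (le_trans (ler_normB _ _))// lerD//.
  rewrite ger0_norm ?mulr_ge0 ?powR_ge0 ?expR_ge0 ?(ltW s0)// mulrCA mulr_powRB1 ?(ltW s0)//.
  rewrite (@le_trans _ _ (expR (- s) * expR s))//; last by rewrite -expRD addNr expR0.
  rewrite ler_wpM2l ?expR_ge0// (le_trans (powR_le_1D (ltW s0)))//.
  exact: expR_ge1Dx.
have p0 : 0 < s * (2 * ou_kernel s) by apply: mulr_gt0 => //; apply: mulr_gt0.
rewrite (gtr0_norm p0) mulrCA.
rewrite (@le_trans _ _ (2 * (s * (expR (- s) * (s `^ al / al)))))//.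
  by rewrite ler_wpM2l// ler_wpM2l ?(ltW s0)// ou_kernel_le.
rewrite (_ : 2 * _ = (2 * (s * (expR (- s) * s `^ al))) / al); last by ring.
rewrite ler_pM2r ?invr_gt0//.
have h1 : expR (- s) * s `^ al <= expR (- s) * (1 + s).
  by rewrite ler_wpM2l ?expR_ge0// powR_le_1D// ltW.
have h2 : 1 + s ^+ 2 / 2 <= expR s by have := @expR_ge1Dxn R s 1 (ltW s0).
have h3 : s * (1 + s) <= 3 * expR s by have := expR_ge1Dx s; lra.
have h4 : s * (expR (- s) * (1 + s)) <= 3.
  rewrite mulrCA; have : expR (- s) * (s * (1 + s)) <= expR (- s) * (3 * expR s).
    by rewrite ler_wpM2l ?expR_ge0.
  by rewrite [X in _ <= X -> _]mulrCA -expRD addNr expR0 mulr1.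
by have := ler_wpM2l (ltW s0) h1; lra.
Qed.

Lemma integrable_ou_kernel (x : R) : mu.-integrable `[0, x] (EFin \o ou_kernel).
Proof.
apply: (@integrable_dom _ _ _ _ _ (measurable_itvR _) _ (fun=> al^-1)).
- have mk : measurable_fun (`[0, +oo[%classic : set R) ou_kernel.
    apply/measurable_fun_itv_obnd_cbndP.
    apply: open_continuous_measurable_fun; first exact: interval_open.
    by move=> y; rewrite inE/= in_itv/= andbT; exact: continuous_ou_kernel.
  have sub : (`[0, x]%classic : set R) `<=` `[0, +oo[%classic.
    by apply: subset_itvl; rewrite bnd_simp.
  exact: measurable_funS (measurable_itv _) sub mk.
- move=> s; rewrite /= in_itv/= => /andP[+ _]; rewrite le_eqVlt => /predU1P[<-|s0].
    by rewrite ou_kernel0 normr0 invr_ge0 ltW.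
  by rewrite gtr0_norm ?ou_kernel_gt0// ou_kernel_bounded.
- apply: continuous_compact_integrable; first exact: segment_compact.
  by apply: continuous_subspaceT; exact: cst_continuous.
Qed.

Definition ou_cov_density (z : R * R) : R := expR (- z.1 - z.2) * `|z.2 - z.1| `^ (al - 1).

Let q_ge0 z : 0 <= ou_cov_density z.
Proof. by rewrite mulr_ge0 ?expR_ge0 ?powR_ge0. Qed.

Lemma ou_cov_densityC s u : ou_cov_density (s, u) = ou_cov_density (u, s).
Proof. by rewrite /ou_cov_density/= distrC; congr (expR _ * _); lra. Qed.

Let mq : measurable_fun setT
  (fun z : measurableTypeR R * measurableTypeR R => ou_cov_density z).
Proof.
have m1 : measurable_fun setT (fun z : measurableTypeR R * measurableTypeR R => z.1 : R) by exact: measurable_fst.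
have m2 : measurable_fun setT (fun z : measurableTypeR R * measurableTypeR R => z.2 : R) by exact: measurable_snd.
apply: measurable_funM.
  apply: measurableT_comp => //; apply: measurable_funB => //; exact: measurableT_comp m1.
apply: (measurableT_comp (measurable_powR (al - 1))).
by apply: measurableT_comp => //; exact: measurable_funB.
Qed.

Let mqs (s : R) (D : set (measurableTypeR R)) :
  measurable_fun D (fun u : R => (ou_cov_density (s, u))%:E).
Proof.
apply/measurable_EFinP/measurable_funTS.
exact: (measurableT_comp mq (pair1_measurable (s : measurableTypeR R))).
Qed.

Lemma ou_cov_density_lower (s : R) : 0 <= s ->
  (\int[mu]_(u in `[0%R, s]) (ou_cov_density (s, u))%:E = (ou_kernel s)%:E)%E.
Proof.
move=> s0.
have mphi : measurable_fun setT (fun u : R => s - u) by exact: measurable_funB.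
pose f (r : R) : \bar R := (expR (- (2 * s)) * (expR r * r `^ (al - 1)))%:E.
have mf : measurable_fun (`[0, s]%classic : set (measurableTypeR R)) f.
  apply/measurable_EFinP/measurable_funM; first exact: measurable_cst.
  exact: measurable_mass.
have pre : (fun u : R => s - u) @^-1` `[0, s] = `[0, s]%classic.
  by apply/seteqP; split => x /=; rewrite !in_itv/= => /andP[? ?]; apply/andP; split; lra.
transitivity (\int[mu]_(u in (fun u : R => s - u)%R @^-1` `[0%R, s]) f (s - u)%R)%E.
  rewrite pre; apply: eq_integral => u; rewrite inE/= in_itv/= => /andP[u0 us].
  rewrite /f /ou_cov_density/= mulrA -expRD distrC ger0_norm ?subr_ge0//.
  by congr (expR _ * _)%:E; lra.
rewrite (integral_isometry mphi (@lebesgue_measure_reflect R s) (measurable_itvR _) mf).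
have -> : (\int[mu]_(x in `[0%R, s]) f x = \int[mu]_(x in `]0%R, s]) f x)%E.
  by apply/esym; apply: integral_itv_obnd_cbnd; apply: measurable_funS mf => //; apply: subset_itvr; rewrite bnd_simp.
rewrite /ou_kernel /ou_mass -RintegralZl//; last exact: integrable_ou_mass.
rewrite /Rintegral fineK//; apply: integrable_fin_num => //.
exact: (integrableMc (measurable_itvR _) _ (integrable_ou_mass s)).
Qed.

Lemma ou_cov_density_upper_fin (s T : R) :
  (\int[mu]_(u in `]s, T]) (ou_cov_density (s, u))%:E < +oo)%E.
Proof.
have mphi : measurable_fun setT (fun u : R => u + s) by exact: measurable_funD.
have pre : (fun u : R => u + s) @^-1` `]s, T] = `]0, T - s]%classic.
  by apply/seteqP; split => x /=; rewrite !in_itv/= => /andP[? ?]; apply/andP; split; lra.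
rewrite -[X in (X < _)%E](integral_isometry mphi (@lebesgue_measure_shift R s) (measurable_itvR _) (@mqs s _)) pre.
have [Ts|Ts] := ltP 0 (T - s); last first.
  by rewrite set_itv_ge ?bnd_simp -?leNgt// integral_set0 ltry.
have [/integrableP[mi i] _] := integral_powR_near0 al0 Ts.
apply: le_lt_trans (_ : ((expR (- (2 * s)))%:E * \int[mu]_(x in `]0%R, (T - s)%R]) `|(x `^ (al - 1))%:E| < +oo)%E); last first.
  by apply: lte_mul_pinfty => //; rewrite lee_fin expR_ge0.
rewrite -ge0_integralZl//; last exact: measurableT_comp mi.
apply: ge0_le_integral => //.
- by move=> x _; rewrite lee_fin.
- apply/measurable_EFinP; have := measurableT_comp (@mqs s setT) mphi.
  by move=> /measurable_EFinP; apply: measurable_funTS.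
- apply: emeasurable_funM; first exact: measurable_cst.
  exact: measurableT_comp mi.
move=> x; rewrite /= in_itv/= => /andP[x0 _].
rewrite -EFinM lee_fin /ou_cov_density/= addrK (gtr0_norm x0) (ger0_norm (powR_ge0 _ _)).
by rewrite ler_wpM2r ?powR_ge0// ler_expR; lra.
Qed.

Lemma ou_double_integral (T : R) : 0 <= T ->
  \int[mu]_(s in `[0, T]) \int[mu]_(u in `[0, T]) ou_cov_density (s, u) =
  2 * \int[mu]_(s in `[0, T]) ou_kernel s.
Proof.
move=> T0.
pose D := `[0, T]%classic : set (measurableTypeR R).
have mD : measurable D by exact: measurable_itvR.
pose up s := (\int[mu]_(u in `]s, T]) (ou_cov_density (s, u))%:E)%E.
have up0 s : (0 <= up s)%E by apply: integral_ge0 => u _; rewrite lee_fin.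
have split_ s : D s -> (\int[mu]_(u in D) (ou_cov_density (s, u))%:E =
    (ou_kernel s)%:E + up s)%E.
  rewrite /D /= in_itv/= => /andP[s0 sT]; rewrite -ou_cov_density_lower// /up.
  rewrite -ge0_integral_setU//=.
  - congr (integral _ _ _); apply/seteqP; split => x; rewrite /D /= !in_itv/=.
      by move=> /andP[x0 xT]; case: (leP x s) => xs; [left|right]; rewrite ?x0.
    by case=> /andP[x0 x1]; apply/andP; split => //; lra.
  - by move=> u _; rewrite lee_fin.
  - apply/disj_set2P; rewrite -subset0 => x/=; rewrite !in_itv/= => -[/andP[_ xs] /andP[]].
    by rewrite ltNge xs.
pose b (z : R * R) : bool := [&& 0 <= z.1, z.1 < z.2 & z.2 <= T].
pose g (z : measurableTypeR R * measurableTypeR R) : \bar R :=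
  (ou_cov_density z * (b z)%:R)%:E.
have g0 z : (0 <= g z)%E by rewrite lee_fin mulr_ge0.
have m1 : measurable_fun setT (fun z : measurableTypeR R * measurableTypeR R => z.1 : R) by exact: measurable_fst.
have m2 : measurable_fun setT (fun z : measurableTypeR R * measurableTypeR R => z.2 : R) by exact: measurable_snd.
have mg : measurable_fun setT g.
  apply/measurable_EFinP/measurable_funM => //.
  apply: measurable_bool_natr => //.
  apply: measurable_and; first exact: measurable_fun_ler.
  by apply: measurable_and; [exact: measurable_fun_ltr|exact: measurable_fun_ler].
have E1 s : D s -> (\int[mu]_u g (s, u) = up s)%E.
  rewrite /D/= in_itv/= => /andP[s0 sT]; rewrite /up [RHS]integral_mkcond.
  apply: eq_integral => u _; rewrite /restrict mem_setE in_itv/= /g /b/= s0/=.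
  by case: ifP; rewrite ?mulr1 ?mulr0.
have E1' s : ~ D s -> (\int[mu]_u g (s, u) = 0)%E.
  move=> Ds; apply: integral0_eq => u _; rewrite /g /b/=.
  case: (lerP 0 s) => s0/=; last by rewrite mulr0.
  case: ltP => su/=; last by rewrite mulr0.
  case: lerP => uT/=; last by rewrite mulr0.
  by exfalso; apply: Ds; rewrite /D/= in_itv/= s0 (le_trans (ltW su)).
have E2 u : D u -> (\int[mu]_s g (s, u) = (ou_kernel u)%:E)%E.
  rewrite /D/= in_itv/= => /andP[u0 uT]; rewrite -ou_cov_density_lower//.
  rewrite -integral_itv_bndo_bndc; last exact: mqs.
  rewrite [RHS]integral_mkcond.
  apply: eq_integral => s _; rewrite /restrict mem_setE in_itv/= /g /b/= uT andbT ou_cov_densityC.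
  by case: ifP; rewrite ?mulr1 ?mulr0.
have E2' u : ~ D u -> (\int[mu]_s g (s, u) = 0)%E.
  move=> Du; apply: integral0_eq => s _; rewrite /g /b/=.
  case: (lerP 0 s) => s0/=; last by rewrite mulr0.
  case: ltP => su/=; last by rewrite mulr0.
  case: lerP => uT/=; last by rewrite mulr0.
  by exfalso; apply: Du; rewrite /D/= in_itv/= uT (le_trans s0)// ltW.
have mup : measurable_fun D up.
  have := measurable_fun_fubini_tonelli_F g mg g0 (m2 := mu).
  move=> /(measurable_funS measurableT (@subsetT _ D)).
  by apply: eq_measurable_fun => s; rewrite inE => Ds; exact: E1.
have mk : measurable_fun D (fun s => (ou_kernel s)%:E).
  have := measurable_fun_fubini_tonelli_G g mg g0 (m1 := mu).
  move=> /(measurable_funS measurableT (@subsetT _ D)).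
  by apply: eq_measurable_fun => s; rewrite inE => Ds; exact: E2.
have k0 s : D s -> (0 <= (ou_kernel s)%:E)%E.
  by move=> Ds; rewrite -E2//; apply: integral_ge0.
have Eup : (\int[mu]_(s in D) up s = \int[mu]_(s in D) (ou_kernel s)%:E)%E.
  transitivity (\int[mu]_s \int[mu]_u g (s, u))%E.
    rewrite integral_mkcond; apply: eq_integral => s _; rewrite /restrict.
    by case: ifPn => [/set_mem /E1 ->//|/negP Ds]; rewrite E1'// => Ds'; apply: Ds; rewrite inE.
  rewrite (fubini_tonelli g mg g0) [RHS]integral_mkcond.
  apply: eq_integral => s _; rewrite /restrict.
  by case: ifPn => [/set_mem /E2 ->//|/negP Ds]; rewrite E2'// => Ds'; apply: Ds; rewrite inE.
have ik : mu.-integrable D (EFin \o ou_kernel) by exact: integrable_ou_kernel.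
transitivity (fine (\int[mu]_(s in D) \int[mu]_(u in D) (ou_cov_density (s, u))%:E)%E).
  rewrite {1}/Rintegral; congr fine; apply: eq_integral => s; rewrite inE => Ds.
  rewrite /Rintegral fineK// split_//.
  rewrite ge0_fin_numE; first by rewrite lte_add_pinfty ?ltry// ou_cov_density_upper_fin.
  by rewrite adde_ge0// k0.
have -> : (\int[mu]_(s in D) \int[mu]_(u in D) (ou_cov_density (s, u))%:E =
    \int[mu]_(s in D) (ou_kernel s)%:E + \int[mu]_(s in D) (ou_kernel s)%:E)%E.
  rewrite -{2}Eup -ge0_integralD//.
  by apply: eq_integral => s; rewrite inE => Ds; exact: split_.
rewrite fineD; last 2 first.
- exact: (integrable_fin_num mD ik).
- exact: (integrable_fin_num mD ik).
by rewrite mulr2n mulrDl mul1r.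
Qed.

End OUKernel.

Section OUVariance.
Context {R : realType}.
Notation mu := (@lebesgue_measure R).
Variables H theta : R.
Hypotheses (H_range : 2^-1 < H < 1) (theta_gt0 : 0 < theta).

Let al := 2 * H - 1.

Let al01 : 0 < al < 1.
Proof. by case/andP: H_range => h1 h2; rewrite /al; apply/andP; split; lra. Qed.

Let al0 : 0 < al. Proof. by case/andP: al01. Qed.

Let c0 := 2 * (H * (2 * H - 1) * theta `^ (2 * H)).

Let c0_gt0 : 0 < c0.
Proof.
rewrite /c0 mulr_gt0// mulr_gt0 ?powR_gt0// mulr_gt0 -/al//.
by case/andP: H_range => h1 _; lra.
Qed.

Let V := ou_variance H theta.

Definition ou_variance' (t : R) : R := c0 / theta * ou_kernel al (t / theta).

Definition ou_variance'' (t : R) : R := c0 / theta ^+ 2 *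
  (expR (- (t / theta)) * (t / theta) `^ (al - 1) - 2 * ou_kernel al (t / theta)).

Let W := ou_variance'.
Let W1 := ou_variance''.

Lemma ou_varianceE (t : R) : 0 <= t ->
  V t = c0 * \int[mu]_(s in `[0, t / theta]) ou_kernel al s.
Proof.
move=> t0; have T0 : 0 <= t / theta by rewrite divr_ge0// ltW.
rewrite /V /ou_variance.
have -> : \int[mu]_(s in `[0, t / theta]) \int[mu]_(u in `[0, t / theta])
      (expR (- s - u) * `|u - s| `^ (2 * H - 2)) =
    \int[mu]_(s in `[0, t / theta]) \int[mu]_(u in `[0, t / theta]) ou_cov_density al (s, u).
  apply: eq_Rintegral => s _; apply: eq_Rintegral => u _.
  by rewrite /ou_cov_density /al/=; congr (_ * _ `^ _); lra.
by rewrite ou_double_integral// /c0; ring.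
Qed.

Lemma ou_variance0 : V 0 = 0.
Proof. by rewrite ou_varianceE// mul0r set_itv1 Rintegral_set1 mulr0. Qed.

Lemma ou_variance'0 : W 0 = 0.
Proof. by rewrite /W /ou_variance' mul0r ou_kernel0 mulr0. Qed.

Let divt_gt0 (t : R) : 0 < t -> 0 < t / theta.
Proof. by move=> t0; rewrite divr_gt0. Qed.

Lemma is_derive_ou_variance (t : R) : 0 < t -> is_derive t 1 V (W t).
Proof.
move=> t0; have T0 := divt_gt0 t0.
have [|d e] := @continuous_FTC1_closed R (ou_kernel al) 0 (t / theta) (t / theta + 1) _
  (integrable_ou_kernel al01 _) T0 (continuous_ou_kernel al01 T0).
- by rewrite ltrDl.
have dG : is_derive (t / theta) 1
    (fun x => \int[mu]_(s in `[0, x]) ou_kernel al s) (ou_kernel al (t / theta)).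
  by apply: DeriveDef; [exact: d|rewrite -derive1E; exact: e].
have dl : is_derive t 1 (fun x : R => x / theta) theta^-1.
  by apply: is_derive_eq; rewrite /GRing.scale/=; ring.
have dc := @is_derive1_comp R _ _ t _ _ dG dl.
have dF : is_derive t 1 (fun x => c0 * \int[mu]_(s in `[0, x / theta]) ou_kernel al s) (W t).
  have dz := @is_deriveZ _ _ _ _ c0 t 1 _ dc; apply: (is_derive_eq dz).
  by rewrite /W /ou_variance' /GRing.scale/=; ring.
apply: (near_eq_is_derive _ dF).
have : \forall x \near t, 0 < x by exact: lt_nbhsr.
by apply: filterS => x x0; rewrite ou_varianceE// ltW.
Qed.

Lemma is_derive_ou_variance' (t : R) : 0 < t -> is_derive t 1 W (W1 t).
Proof.
move=> t0; have T0 := divt_gt0 t0.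
have dk := is_derive_ou_kernel al01 T0.
have dl : is_derive t 1 (fun x : R => x / theta) theta^-1.
  by apply: is_derive_eq; rewrite /GRing.scale/=; ring.
have dc := @is_derive1_comp R _ _ t _ _ dk dl.
have dz := @is_deriveZ _ _ _ _ (c0 / theta) t 1 _ dc; apply: (is_derive_eq dz).
by rewrite /W1 /ou_variance'' /GRing.scale/=; field; rewrite gt_eqF.
Qed.

Lemma continuous_ou_variance (t : R) : 0 < t -> {for t, continuous V}.
Proof.
move=> t0; apply/differentiable_continuous/derivable1_diffP.
by have [] := is_derive_ou_variance t0.
Qed.

Lemma continuous_ou_variance' (t : R) : 0 < t -> {for t, continuous W}.
Proof.
move=> t0; apply/differentiable_continuous/derivable1_diffP.
by have [] := is_derive_ou_variance' t0.
Qed.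

Lemma continuous_ou_variance'' (t : R) : 0 < t -> {for t, continuous W1}.
Proof.
move=> t0; have T0 := divt_gt0 t0.
have cd : {for t, continuous (fun x : R => x / theta)}.
  by apply: cvgM; [exact: cvg_id|exact: cvg_cst].
have c1 : {for t, continuous (fun x : R => (x / theta) `^ (al - 1))}.
  apply: (@cvg_comp _ _ _ (fun x => x / theta) (fun r => r `^ (al - 1)) _ (nbhs (t / theta))); first exact: cd.
  exact: continuous_powR_gt0.
have c2 : {for t, continuous (fun x : R => ou_kernel al (x / theta))}.
  apply: (@cvg_comp _ _ _ (fun x => x / theta) (ou_kernel al) _ (nbhs (t / theta))); first exact: cd.
  exact: continuous_ou_kernel.
have c3 : {for t, continuous (fun x : R => expR (- (x / theta)))}.
  by apply: continuous_comp; [exact: cvgN|exact: continuous_expR].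
apply: cvgM; first exact: cvg_cst.
apply: cvgB; first exact: cvgM c3 c1.
by apply: cvgM; [exact: cvg_cst|exact: c2].
Qed.

Lemma ou_variance'_gt0 (t : R) : 0 < t -> 0 < W t.
Proof.
move=> t0; rewrite /W /ou_variance' mulr_gt0 ?divr_gt0//.
exact/ou_kernel_gt0/divt_gt0.
Qed.

Definition ou_rate : R := c0 / theta / al.

Lemma ou_rate_gt0 : 0 < ou_rate.
Proof. by rewrite /ou_rate !divr_gt0. Qed.

Lemma ou_variance'_le (t : R) : 0 < t -> W t <= ou_rate.
Proof.
move=> t0; rewrite /W /ou_variance' /ou_rate ler_wpM2l ?divr_ge0 ?(ltW c0_gt0) ?(ltW theta_gt0)//.
exact/ou_kernel_bounded/divt_gt0.
Qed.

Lemma ou_variance_le (t : R) : 0 < t -> V t <= ou_rate * t.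
Proof.
move=> t0; rewrite ou_varianceE ?(ltW t0)//.
have T0 := divt_gt0 t0.
have : \int[mu]_(s in `[0, t / theta]) ou_kernel al s <= \int[mu]_(s in `[0, t / theta]) al^-1.
  apply: le_Rintegral => //; first exact: integrable_ou_kernel.
    apply: continuous_compact_integrable; first exact: segment_compact.
    by apply: continuous_subspaceT; exact: cst_continuous.
  move=> s; rewrite /= in_itv/= => /andP[+ _]; rewrite le_eqVlt => /predU1P[<-|s0].
    by rewrite ou_kernel0 invr_ge0 ltW.
  exact: ou_kernel_bounded.
rewrite Rintegral_cst//= lebesgue_measure_itv/= lte_fin T0 -EFinD/= subr0.
move=> /(ler_wpM2l (ltW c0_gt0)) /le_trans; apply.
by rewrite /ou_rate le_eqVlt; apply/orP; left; apply/eqP; field; rewrite !gt_eqF.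
Qed.

Lemma ou_variance_gt0 (t : R) : 0 < t -> 0 < V t.
Proof.
move=> t0.
have t20 : 0 < t / 2 by rewrite divr_gt0.
have t2 : t / 2 < t by rewrite ltr_pdivrMr// ltr_pMr// ltr1n.
have V2 : 0 <= V (t / 2).
  rewrite ou_varianceE ?(ltW t20)// mulr_ge0 ?(ltW c0_gt0)//; apply: Rintegral_ge0 => s.
  rewrite /= in_itv/= => /andP[+ _]; rewrite le_eqVlt => /predU1P[<-|s0].
    by rewrite ou_kernel0.
  exact/ltW/ou_kernel_gt0.
have dV x : t / 2 <= x -> is_derive x 1 V (W x).
  by move=> tx; apply: is_derive_ou_variance; exact: lt_le_trans tx.
have [||c /[!in_itv]/= /andP[c1 _] E] := @MVT R V W (t / 2) t t2.
- by move=> x /[!in_itv]/= /andP[x1 _]; apply: dV; exact: ltW.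
- apply: derivable_within_continuous => x /[!in_itv]/= /andP[x1 _].
  by have [] := dV _ x1.
have Wc := ou_variance'_gt0 (lt_trans t20 c1).
have : 0 < V t - V (t / 2).
  by rewrite E; apply: mulr_gt0; [exact: Wc|rewrite subr_gt0].
by rewrite subr_gt0; exact: le_lt_trans V2.
Qed.

Definition ou_rate2 : R := c0 / theta * (1 + 6 / al).

Lemma ou_variance''_bound (t : R) : 0 < t -> t * `|W1 t| <= ou_rate2.
Proof.
move=> t0; have := ou_kernel_derive_bound al01 (divt_gt0 t0).
rewrite /W1 /ou_variance'' normrM ger0_norm ?divr_ge0 ?sqr_ge0 ?(ltW c0_gt0)// => h.
rewrite (_ : _ * _ = c0 / theta * (t / theta *
  `|expR (- (t / theta)) * (t / theta) `^ (al - 1) - 2 * ou_kernel al (t / theta)|)).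
  by rewrite ler_wpM2l// divr_ge0// ltW.
by field; rewrite gt_eqF.
Qed.

Lemma laplace_ou_variance' (s : R[i]) : - theta^-1 < complex.Re s ->
  has_laplace W s /\
  laplace W s = (c0 / theta)%:C%C * ((s + (2 / theta)%:C%C)^-1 *
    laplace (fun r => r `^ (al - 1)) (s * theta%:C%C + 1)).
Proof.
move=> rs; set z := s + (2 / theta)%:C%C.
pose D := `]0, +oo[%classic : set (measurableTypeR R).
have mD : measurable D by exact: measurable_itvR.
have rz : complex.Re z = complex.Re s + 2 / theta by rewrite ReD.
pose rho := (theta^-1 + complex.Re z) / 2.
have ti0 : 0 < theta^-1 by rewrite invr_gt0.
have rz1 : theta^-1 < complex.Re z by rewrite rz; lra.
have rho1 : theta^-1 < rho by rewrite /rho; lra.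
have rho2 : rho < complex.Re z by rewrite /rho; lra.
pose m (r : R) := expR r * r `^ (al - 1).
have mm : measurable_fun D m.
  apply: measurable_funM; first exact: continuous_measurable_funR (@continuous_expR R).
  by apply: measurable_funTS; exact: measurable_powR.
have mt : measurable_fun D (fun r : R => theta * r).
  by apply: continuous_measurable_funR => r; apply: cvgM; [exact: cvg_cst|exact: cvg_id].
have im : mu.-integrable D (EFin \o (fun r => `|m r| * expR (- (rho * (theta * r))))).
  have a0 : 0 < rho * theta - 1 by rewrite subr_gt0 -ltr_pdivrMr// div1r.
  apply: (integrable_congr mD _ (integrable_gamma al01 a0)) => r _.
  rewrite ger0_norm ?mulr_ge0 ?expR_ge0 ?powR_ge0// /m mulrAC -expRD mulrC.
  by congr (_ * expR _); ring.
have [|i e] := @laplace_cdf _ _ _ (@lebesgue_measure R) D m (fun r => theta * r) z rho mD mm mt _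
  (ltW (lt_trans ti0 rho1)) rho2 im.
  by move=> r; rewrite /D/= in_itv/= andbT => r0; rewrite mulr_ge0// ltW.
set u := (X in has_laplace X _) in i; have {}e : laplace u z = _ := e.
have E t : D t -> laplace_integrand W s t = (c0 / theta)%:C%C * laplace_integrand u z t.
  rewrite /D/= in_itv/= andbT => t0.
  have uE : u t = ou_mass al (t / theta).
    rewrite /u /ou_mass [RHS]Rintegral_mkcond [LHS]Rintegral_mkcond.
    apply: eq_Rintegral => r _; rewrite !patchE !mem_setE !in_itv/= andbT ler_pdivlMr// [r * _]mulrC.
    by case: (ltP 0 r) => //= r0; case: ifP => _; rewrite ?mulr1 ?mulr0.
  rewrite /laplace_integrand uE /W /ou_variance' /ou_kernel !rmorphM/=.
  have -> : cexp (- z * t%:C%C) = cexp (- s * t%:C%C) * (expR (- (2 * (t / theta))))%:C%C.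
    rewrite -cexp_real -cexpD; congr cexp; rewrite /z !rmorphN !rmorphM/=; ring.
  by ring.
have hW : has_laplace W s.
  apply: (eq_cintegrable mD _ (cintegrableZ mD (c0 / theta)%:C%C i)) => t Dt.
  by rewrite E.
split => //; rewrite -[LHS]/(cintegral mu D (laplace_integrand W s)).
rewrite (eq_cintegral _ E) cintegralZ// -[cintegral _ _ _]/(laplace u z) e.
congr (_ * (_ * _)); apply: eq_cintegral => r _.
have -> : (m r)%:C%C = cexp r%:C%C * (r `^ (al - 1))%:C%C.
  by rewrite /m rmorphM/= cexp_real.
rewrite /laplace_integrand mulrA; congr (_ * _).
rewrite -cexpD; congr cexp; rewrite /z !rmorphM/= !fmorphV/= rmorph_nat.
have t0' : theta%:C%C != 0 :> R[i] by rewrite (inj_eq (@complexI R)) gt_eqF.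
by field.
Qed.

Lemma laplace_ou_variance'_decay (a : R) : - theta^-1 < a ->
  exists C, 0 <= C /\ forall w : R,
    normc (laplace W (a +i* w)%C) <= C * (1 + `|w|) `^ (- (1 + al)).
Proof.
move=> a_gt.
have ti0 : 0 < theta^-1 by rewrite invr_gt0.
have at0 : 0 < a * theta + 1 by rewrite -ltrBlDr sub0r -ltr_pdivrMr// mulN1r.
have [C [C0 HC]] := gamma_decay al01 at0.
pose p := a + 2 / theta.
have p0 : 0 < p by rewrite /p; lra.
pose m := Num.min 1 theta.
have m0 : 0 < m by rewrite lt_min ltr01.
exists (c0 / theta * ((1 + p^-1) * (C * m `^ (- al)))); split.
  by rewrite mulr_ge0 ?divr_ge0 ?(ltW c0_gt0) ?(ltW theta_gt0)// mulr_ge0 ?mulr_ge0 ?powR_ge0// addr_ge0// invr_ge0 ltW.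
move=> w; have [_ ->] := @laplace_ou_variance' (a +i* w)%C a_gt.
set z := (a +i* w)%C + (2 / theta)%:C%C.
have w1 : 0 < 1 + `|w| by rewrite ltr_pwDl.
rewrite !normcM normcC ger0_norm ?divr_ge0 ?(ltW c0_gt0) ?(ltW theta_gt0)//.
rewrite -[leRHS]mulrA ler_wpM2l ?divr_ge0 ?(ltW c0_gt0) ?(ltW theta_gt0)//.
have -> : (1 + `|w|) `^ (- (1 + al)) = (1 + `|w|)^-1 * (1 + `|w|) `^ (- al).
  by rewrite opprD powRD ?powR_inv1 ?(ltW w1)// (gt_eqF w1) implybT.
rewrite [leRHS](_ : _ = ((1 + p^-1) / (1 + `|w|)) * (C * (m `^ (- al) * (1 + `|w|) `^ (- al)))); last by ring.
rewrite ler_pM ?normc_ge0//.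
- rewrite normcV ler_pdivlMr// ler_pdivrMl; last first.
    rewrite normc_gt0; apply/eqP => /(congr1 (@complex.Re R)).
    by rewrite ReD/= -/p; apply/eqP; rewrite gt_eqF.
  have z1 : p <= normc z by rewrite (le_trans (ler_norm _))// (le_trans _ (ler_Re_normc z))// /z ReD.
  have z2 : `|w| <= normc z by rewrite (le_trans _ (ler_Im_normc z))// /z ImD/= addr0.
  rewrite mulrDr mulr1 [leRHS]addrC lerD//.
  by rewrite ler_pdivlMr// mul1r.
- have -> : ((a +i* w)%C * theta%:C%C + 1 = ((a * theta + 1) +i* (w * theta))%C).
    by apply: complex_ext; rewrite ?ReD ?ImD ?ReM ?ImM/= !mulr0 ?subr0 ?add0r ?addr0.
  rewrite (le_trans (HC _))// ler_wpM2l// -powRM ?(ltW m0) ?(ltW w1)//.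
  have mw : 0 < m * (1 + `|w|) by apply: mulr_gt0.
  have wt : 0 < 1 + `|w * theta| by rewrite ltr_pwDl.
  rewrite !powRN lef_pV2 ?posrE ?powR_gt0//.
  rewrite ge0_ler_powR ?nnegrE ?(ltW al0) ?(ltW mw) ?(ltW wt)//.
  rewrite normrM (gtr0_norm theta_gt0) mulrDr mulr1 lerD//; first by rewrite ge_min lexx.
  by rewrite mulrC ler_wpM2l// ge_min lexx orbT.
Qed.

End OUVariance.

(** * Laplace transforms of functions vanishing at zero *)

Section LaplaceDerivative.
Context {R : realType}.
Notation mu := (@lebesgue_measure R).
Variables (F f : R -> R) (K : R).
Hypotheses (F0 : F 0 = 0) (f0 : f 0 = 0).
Hypothesis dF : forall t : R, 0 < t -> is_derive t 1 F (f t).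
Hypothesis cf : forall t : R, 0 < t -> {for t, continuous f}.
Hypothesis F_le : forall t : R, 0 < t -> `|F t| <= K * t.
Hypothesis f_le : forall t : R, 0 < t -> `|f t| <= K * t.

Let cvg0 (g : R -> R) : g 0 = 0 -> (forall t : R, 0 < t -> `|g t| <= K * t) ->
  g x @[x --> 0^'+] --> g 0.
Proof.
move=> g0 gle; rewrite g0; apply: norm_cvg0.
apply: (@squeeze_cvgr _ _ _ _ (cst 0) (fun x => K * x)).
- near=> x; rewrite normr_ge0/= gle//.
- exact: cvg_cst.
- have : K * x @[x --> 0] --> K * 0 by apply: cvgM; [exact: cvg_cst|exact: cvg_id].
  by rewrite mulr0; exact: cvg_at_right_filter.
Unshelve. all: by end_near. Qed.

Lemma primitive_from0 (t : R) : 0 < t -> F t = \int[mu]_(r in `]0, t]) f r.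
Proof.
move=> t0.
have cF s : 0 < s -> {for s, continuous F}.
  by move=> s0; apply/differentiable_continuous/derivable1_diffP; have [] := dF s0.
have wf : {within `[0, t], continuous f}.
  apply/continuous_within_itvP => //; split.
  - by move=> x; rewrite in_itv/= => /andP[x0 _]; exact: cf.
  - exact: cvg0.
  - exact/cvg_at_left_filter/cf.
have E : (\int[mu]_(x in `[0%R, t]) (f x)%:E = (F t)%:E - (F 0)%:E)%E.
  apply: continuous_FTC2 => //.
  - split.
    + by move=> x; rewrite in_itv/= => /andP[/dF[]].
    + exact: cvg0.
    + exact/cvg_at_left_filter/cF.
  - move=> x; rewrite in_itv/= => /andP[x0 _].
    by rewrite derive1E; have /@derive_val := dF x0.
rewrite Rintegral_itv_obnd_cbnd; last first.
  have := continuous_compact_integrable (@segment_compact R 0 t) wf.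
  by apply: integrableS => //; exact: subset_itv_oc_cc.
by rewrite /Rintegral E F0 sube0.
Qed.

Let D := `]0, +oo[%classic : set (measurableTypeR R).

Let mf : measurable_fun D f. Proof. exact: continuous_gt0_measurable. Qed.

Lemma integrable_linear_expRN (rho : R) : 0 < rho ->
  mu.-integrable D (EFin \o (fun t => `|f t| * expR (- (rho * t)))).
Proof.
move=> rho0; have r20 : 0 < rho / 2 by rewrite divr_gt0.
have mD : measurable D by exact: measurable_itvR.
have K0 : 0 <= K by have := le_trans (normr_ge0 _) (f_le ltr01); rewrite mulr1.
have [i _] := @integral_expRN R (rho / 2) 0 r20.
have i' : mu.-integrable D (EFin \o (fun t => expR (- (rho / 2 * t)))).
  by apply: integrableS i => //; apply: subset_itvr; rewrite bnd_simp.
apply: (@integrable_dom _ _ _ mu _ mD _ (fun t => (K * (2 / rho)) * expR (- (rho / 2 * t)))).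
- apply: measurable_funM; first exact: measurableT_comp.
  apply: continuous_measurable_funR => r; apply: continuous_comp; last exact: continuous_expR.
  by apply: cvgN; apply: cvgM; [exact: cvg_cst|exact: cvg_id].
- move=> t; rewrite /D/= in_itv/= andbT => t0.
  rewrite ger0_norm ?mulr_ge0 ?expR_ge0//.
  rewrite (_ : expR (- (rho * t)) = expR (- (rho / 2 * t)) * expR (- (rho / 2 * t))); last first.
    by rewrite -expRD; congr expR; lra.
  rewrite mulrA ler_wpM2r ?expR_ge0//.
  rewrite (@le_trans _ _ (K * t * expR (- (rho / 2 * t))))//; first by rewrite ler_wpM2r ?expR_ge0// f_le.
  rewrite -mulrA ler_wpM2l// expRN ler_pdivrMr ?expR_gt0//.
  have -> : (t : R) = 2 / rho * (rho / 2 * t) by field; rewrite gt_eqF.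
  rewrite ler_wpM2l ?divr_ge0 ?(ltW rho0)//.
  by rewrite (_ : 2 / rho * (rho / 2 * t) = t) ?(le_trans _ (expR_ge1Dx _)) ?lerDr//; field; rewrite gt_eqF.
- exact: integrableMc.
Qed.

Lemma laplace_derivative (z : R[i]) : 0 < complex.Re z ->
  [/\ has_laplace F z, has_laplace f z & laplace F z = z^-1 * laplace f z].
Proof.
move=> rz; have mD : measurable D by exact: measurable_itvR.
have rho0 : 0 < complex.Re z / 2 by rewrite divr_gt0.
have rho1 : complex.Re z / 2 < complex.Re z by rewrite ltr_pdivrMr// ltr_pMr// ltr1n.
have mt : measurable_fun D (fun r : R => r) by exact: measurable_id.
have [|i e] := @laplace_cdf _ _ _ mu D f (fun r => r) z (complex.Re z / 2) mD mf mt _ (ltW rho0) rho1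
  (integrable_linear_expRN rho0).
  by move=> r; rewrite /D/= in_itv/= andbT => /ltW.
set u := (X in has_laplace X _) in i; have {}e : laplace u z = _ := e.
have E t : D t -> laplace_integrand F z t = laplace_integrand u z t.
  rewrite /D/= in_itv/= andbT => t0; rewrite /laplace_integrand; congr (_ * _%:C%C).
  rewrite primitive_from0// /u [RHS]Rintegral_mkcond [LHS]Rintegral_mkcond.
  apply: eq_Rintegral => r _; rewrite !patchE !mem_setE !in_itv/= andbT.
  by case: (ltP 0 r) => //= r0; case: ifP => _; rewrite ?mulr1 ?mulr0.
split.
- by apply: (eq_cintegrable mD _ i) => t Dt; rewrite E.
- apply: (@cintegrable_dom _ _ _ mu _ mD _ (fun t => `|f t| * expR (- (complex.Re z * t)))).
  + by apply: cmeasurableM; [exact: cmeasurable_cexp_mulNC|exact: cmeasurable_real].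
  + by move=> t _; rewrite /laplace_integrand normcM normc_cexp_mulNC normcC mulrC.
  + exact: integrable_linear_expRN.
- by rewrite -[LHS]/(cintegral mu D (laplace_integrand F z)) (eq_cintegral _ E).
Qed.

Lemma laplace_vertical_bounded (c : R) : 0 < c ->
  exists M, forall w : R, normc (laplace f (c +i* w)%C) <= M.
Proof.
move=> c0; have mD : measurable D by exact: measurable_itvR.
exists (2 * \int[mu]_(t in D) (`|f t| * expR (- (c * t)))) => w.
apply: (normc_cintegral_le mD _ _ (integrable_linear_expRN c0)).
  by apply: cmeasurableM; [exact: cmeasurable_cexp_mulNC|exact: cmeasurable_real].
by move=> t _; rewrite /laplace_integrand normcM normc_cexp_mulNC normcC mulrC.
Qed.

End LaplaceDerivative.

Section GaussianDensity.
Context {R : realType}.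
Implicit Types v x : R.

Definition gauss_density v x : R := (Num.sqrt (2 * pi * v))^-1 * expR (- (x ^+ 2) / (2 * v)).

Definition gauss_coef1 v x : R := x ^+ 2 / (2 * v ^+ 2) - (2 * v)^-1.

Definition gauss_coef2 v x : R := gauss_coef1 v x ^+ 2 - x ^+ 2 / v ^+ 3 + (2 * v ^+ 2)^-1.

Lemma gauss_density_ge0 v x : 0 <= gauss_density v x.
Proof. by rewrite mulr_ge0 ?invr_ge0 ?sqrtr_ge0 ?expR_ge0. Qed.

Lemma gauss_density0 x : gauss_density 0 x = 0.
Proof. by rewrite /gauss_density mulr0 sqrtr0 invr0 mul0r. Qed.

Lemma is_derive_gauss_density v x : 0 < v ->
  is_derive v 1 (gauss_density ^~ x) (gauss_coef1 v x * gauss_density v x).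
Proof.
move=> v0; have p0 := @pi_gt0 R.
have q0 : 0 < 2 * pi * v by rewrite !mulr_gt0.
have s0 : 0 < Num.sqrt (2 * pi * v) by rewrite sqrtr_gt0.
have ds := is_derive1_sqrt q0.
have dl : is_derive v 1 (fun v : R => 2 * pi * v) (2 * pi).
  by apply: is_derive_eq; rewrite /GRing.scale/=; ring.
have dq : is_derive v 1 (fun v : R => Num.sqrt (2 * pi * v)) ((2 * Num.sqrt (2 * pi * v))^-1 * (2 * pi)).
  exact: (@is_derive1_comp R _ _ v _ _ ds dl).
have dqi := @is_deriveV _ (fun v : R => Num.sqrt (2 * pi * v)) v _ 1 (lt0r_neq0 s0) dq.
have v2 : 2 * v != 0 by rewrite mulf_neq0 ?gt_eqF.
have dv : is_derive v 1 (fun v : R => 2 * v) 2.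
  by apply: is_derive_eq; rewrite /GRing.scale/=; ring.
have dvi := @is_deriveV _ (fun v : R => 2 * v) v _ 1 v2 dv.
have de : is_derive v 1 (fun v : R => expR (- (x ^+ 2) / (2 * v)))
    (expR (- (x ^+ 2) / (2 * v)) * (x ^+ 2 / (2 * v ^+ 2))).
  have dz : is_derive v 1 (fun v : R => - (x ^+ 2) / (2 * v)) (x ^+ 2 / (2 * v ^+ 2)).
    have d := @is_deriveZ _ _ _ _ (- (x ^+ 2)) v 1 _ dvi.
    by apply: (is_derive_eq d); rewrite /GRing.scale/=; field; rewrite gt_eqF.
  exact: (@is_derive1_comp R _ _ v _ _ (is_derive_expR _) dz).
apply: (is_derive_eq (is_deriveM dqi de)); rewrite /GRing.scale/= /gauss_density /gauss_coef1.
have sq : Num.sqrt (2 * pi * v) ^+ 2 = 2 * pi * v by rewrite sqr_sqrtr// ltW.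
move: (expR _) => E; move: (Num.sqrt _) s0 sq => s s0 sq.
have -> : s ^- 2 = (2 * pi * v)^-1 by rewrite sq.
move: pi p0 => q p0; field.
by rewrite !gt_eqF.
Qed.

Lemma is_derive_gauss_coef1 v x : 0 < v ->
  is_derive v 1 (gauss_coef1 ^~ x) (- (x ^+ 2) / v ^+ 3 + (2 * v ^+ 2)^-1).
Proof.
move=> v0; have v2 : 2 * v != 0 by rewrite mulf_neq0 ?gt_eqF.
have v3 : 2 * v ^+ 2 != 0 by rewrite mulf_neq0 ?expf_neq0 ?gt_eqF.
have dv : is_derive v 1 (fun v : R => 2 * v) 2.
  by apply: is_derive_eq; rewrite /GRing.scale/=; ring.
have dv2 : is_derive v 1 (fun v : R => 2 * v ^+ 2) (4 * v).
  by apply: is_derive_eq; rewrite /GRing.scale/=; ring.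
have d1 := @is_deriveZ _ _ _ _ (x ^+ 2) v 1 _ (@is_deriveV _ (fun v : R => 2 * v ^+ 2) v _ 1 v3 dv2).
apply: (is_derive_eq (is_deriveB d1 (@is_deriveV _ (fun v : R => 2 * v) v _ 1 v2 dv))).
by rewrite /GRing.scale/=; field; rewrite gt_eqF.
Qed.

Lemma expRN_le_pow (X : R) (n : nat) : 0 < X -> expR (- X) <= n`!%:R / X ^+ n.
Proof.
move=> X0; case: n => [|n]; first by rewrite expr0 divr1 expR_le1 oppr_le0 ltW.
have f0 : 0 < (n.+1)`!%:R :> R by rewrite ltr0n fact_gt0.
rewrite expRN -[leRHS]invf_div lef_pV2 ?posrE ?expR_gt0 ?divr_gt0 ?exprn_gt0//.
by rewrite (le_trans _ (expR_ge1Dxn n (ltW X0)))// lerDr.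
Qed.

Lemma gauss_density_le_pow (delta : R) (m : nat) : 0 < delta ->
  exists C, 0 <= C /\ forall v x, 0 < v -> delta <= `|x| -> gauss_density v x <= C * v ^+ m.
Proof.
move=> d0; have p0 := @pi_gt0 R.
pose y := delta ^+ 2 / 2; have y0 : 0 < y by rewrite divr_gt0 ?exprn_gt0.
pose k : R := (Num.sqrt (2 * pi))^-1.
have k0 : 0 < k by rewrite invr_gt0 sqrtr_gt0 mulr_gt0.
exists (k * (m`!%:R / y ^+ m + (m.+1)`!%:R / y ^+ m.+1)); split.
  by rewrite mulr_ge0 ?(ltW k0)// addr_ge0// divr_ge0// exprn_ge0// ltW.
move=> v x v0 dx.
have yv0 : 0 < y / v by rewrite divr_gt0.
have e1 : expR (- (x ^+ 2) / (2 * v)) <= expR (- (y / v)).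
  rewrite ler_expR mulNr lerN2 /y -mulrA -invfM ler_wpM2r ?invr_ge0 ?mulr_ge0 ?(ltW v0)//.
  by rewrite -[leRHS]ger0_norm ?sqr_ge0// normrX lerXn2r ?nnegrE// ltW.
have s1 : (Num.sqrt (2 * pi * v))^-1 <= k * (1 + v^-1).
  rewrite sqrtrM ?mulr_ge0 ?(ltW p0)// invfM ler_wpM2l ?(ltW k0)//.
  have [v1|v1] := lerP 1 v.
    rewrite (@le_trans _ _ 1) ?lerDl ?invr_ge0 ?(ltW v0)//.
    by rewrite invf_le1 ?sqrtr_gt0// -(@sqrtr1 R) ler_wsqrtr.
  rewrite (@le_trans _ _ v^-1) ?lerDr// lef_pV2 ?posrE ?sqrtr_gt0//.
  rewrite -{1}(sqr_sqrtr (ltW v0)) expr2 ler_piMl ?sqrtr_ge0//.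
  by rewrite -(@sqrtr1 R) ler_wsqrtr// ltW.
rewrite (@le_trans _ _ (k * (1 + v^-1) * expR (- (y / v))))//.
  by rewrite ler_pM ?invr_ge0 ?sqrtr_ge0 ?expR_ge0.
rewrite -mulrA -[leRHS]mulrA ler_wpM2l ?(ltW k0)// !mulrDl mul1r lerD//.
  rewrite (le_trans (expRN_le_pow m yv0))// expr_div_n invf_div mulrA.
  by rewrite mulrAC.
rewrite (@le_trans _ _ (v^-1 * ((m.+1)`!%:R / (y / v) ^+ m.+1)))//.
  by rewrite ler_wpM2l ?invr_ge0 ?(ltW v0)// expRN_le_pow.
rewrite expr_div_n invf_div [v ^+ m.+1]exprS le_eqVlt; apply/orP; left; apply/eqP.
by field; rewrite expf_neq0 ?gt_eqF.
Qed.

End GaussianDensity.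

(** * The Gaussian density as a function of time *)

Section Decay.
Context {R : realType}.
Notation mu := (@lebesgue_measure R).

Lemma integrable_decay (al : R) : 0 < al ->
  mu.-integrable setT (EFin \o (fun w : R => (1 + `|w|) `^ (- (1 + al)))).
Proof.
move=> al0.
have c1 (p : R) (x : R) : 0 <= x -> {for x, continuous (fun x : R => (1 + x) `^ p)}.
  move=> x0; apply: (@cvg_comp _ _ _ (fun x : R => 1 + x) (fun y => y `^ p) _ (nbhs (1 + x))).
    by apply: cvgD; [exact: cvg_cst|exact: cvg_id].
  by apply: continuous_powR_gt0; rewrite ltr_pwDl.
have [||||i _] := @FTC_halfline R (fun x => - al^-1 * (1 + x) `^ (- al))
  (fun x => (1 + x) `^ (- (1 + al))) 0 0.
- move=> x x0; have x10 : 0 < 1 + x by rewrite ltr_pwDl.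
  have dl : is_derive x 1 (fun x : R => 1 + x) 1.
    by apply: (is_derive_eq (is_deriveD _ _)); exact: add0r.
  have dp := @is_derive1_comp R _ _ x _ _ (is_derive1_powR (- al) x10) dl.
  apply: (is_derive_eq (@is_deriveZ _ _ _ _ (- al^-1) x 1 _ dp)).
  rewrite /GRing.scale/= mulr1 (_ : - al - 1 = - (1 + al)); last by ring.
  by field; rewrite gt_eqF.
- by move=> x x0; exact: c1.
- by move=> x _; exact: powR_ge0.
- rewrite -[X in _ --> X](mulr0 (- al^-1)); apply: cvgM; first exact: cvg_cst.
  apply/cvgrPdist_le => e e0; near=> x.
  have x0 : 0 < x by near: x; exact: nbhs_pinfty_gt.
  have x10 : 0 < 1 + x by rewrite ltr_pwDl// ltW.
  rewrite sub0r normrN ger0_norm ?powR_ge0// powRN.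
  rewrite -[leRHS]invrK lef_pV2 ?posrE ?powR_gt0 ?invr_gt0//.
  have -> : e^-1 = (e^-1 `^ al^-1) `^ al.
    by rewrite -powRrM mulVf ?gt_eqF// powRr1// invr_ge0 ltW.
  rewrite ge0_ler_powR ?nnegrE ?powR_ge0 ?(ltW al0) ?(ltW x10)//.
  by rewrite (@le_trans _ _ x) ?lerDr//; near: x; exact: nbhs_pinfty_ge.
have m1 : measurable_fun setT (fun w : R => (1 + `|w|) `^ (- (1 + al))).
  apply: (measurableT_comp (measurable_powR _)).
  by apply: measurable_funD => //; exact: measurableT_comp.
apply: (integrable_halves m1 _ _).1; apply: eq_integrable i => //= x;
  by rewrite inE/= in_itv/= andbT => x0; rewrite ?normrN ger0_norm.
Unshelve. all: by end_near. Qed.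

End Decay.

Section GaussianBounds.
Context {R : realType}.

Lemma gauss_density_div_le (delta : R) (m k : nat) : 0 < delta ->
  exists C, 0 <= C /\ forall v x, 0 < v -> delta <= `|x| ->
    (v ^+ k)^-1 * gauss_density v x <= C * v ^+ m.
Proof.
move=> d0; have [C [C0 HC]] := gauss_density_le_pow (k + m) d0.
exists C; split=> // v x v0 dx; rewrite ler_pdivrMl ?exprn_gt0//.
by rewrite (le_trans (HC _ _ v0 dx))// exprD mulrCA.
Qed.

Lemma gauss_coef1_bound (delta X : R) (m : nat) : 0 < delta ->
  exists C, 0 <= C /\ forall v x, 0 < v -> delta <= `|x| -> `|x| <= X ->
    `|gauss_coef1 v x * gauss_density v x| <= C * v ^+ m.
Proof.
move=> d0.
have [A [A0 HA]] := gauss_density_div_le m 1 d0.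
have [B [B0 HB]] := gauss_density_div_le m 2 d0.
exists (X ^+ 2 * B + A); split; first exact: addr_ge0 (mulr_ge0 (sqr_ge0 _) B0) A0.
move=> v x v0 dx xX; have X0 := le_trans (normr_ge0 x) xX.
have xX2 : x ^+ 2 <= X ^+ 2.
  by rewrite -[leLHS]ger0_norm ?sqr_ge0// normrX lerXn2r ?nnegrE.
have g0 := gauss_density_ge0 v x.
set g := gauss_density v x in g0 *.
have -> : gauss_coef1 v x * g = 2^-1 * (x ^+ 2 * ((v ^+ 2)^-1 * g)) - 2^-1 * ((v ^+ 1)^-1 * g).
  by rewrite /gauss_coef1; field; rewrite gt_eqF.
have {HA} := HA _ _ v0 dx; have {HB} := HB _ _ v0 dx; rewrite -/g.
have : 0 <= (v ^+ 1)^-1 * g by rewrite mulr_ge0 ?invr_ge0 ?exprn_ge0 ?(ltW v0).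
have : 0 <= (v ^+ 2)^-1 * g by rewrite mulr_ge0 ?invr_ge0 ?exprn_ge0 ?(ltW v0).
move: (_^-1 * g) => g2; move: (_^-1 * g) => g1.
move: (v ^+ m) => w h2 h1 k2 k1.
have e2 : x ^+ 2 * g2 <= X ^+ 2 * (B * w) by rewrite ler_pM// sqr_ge0.
have f2 : 0 <= x ^+ 2 * g2 by rewrite mulr_ge0// sqr_ge0.
rewrite (_ : _ * w = X ^+ 2 * (B * w) + A * w); last by ring.
move: (x ^+ 2 * _) (X ^+ 2 * _) (A * w) k1 e2 f2 => a2 b2 b1 k1 e2 f2.
by rewrite ler_norml; apply/andP; split; lra.
Qed.

Lemma gauss_coef2_bound (delta X : R) (m : nat) : 0 < delta ->
  exists C, 0 <= C /\ forall v x, 0 < v -> delta <= `|x| -> `|x| <= X ->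
    `|gauss_coef2 v x * gauss_density v x| <= C * v ^+ m.
Proof.
move=> d0.
have [A [A0 HA]] := gauss_density_div_le m 2 d0.
have [B [B0 HB]] := gauss_density_div_le m 3 d0.
have [C [C0 HC]] := gauss_density_div_le m 4 d0.
exists (X ^+ 4 * C + 2 * X ^+ 2 * B + A); split.
  have X2 := sqr_ge0 X; have X4 : 0 <= X ^+ 4 by exact: exprn_even_ge0.
  exact: addr_ge0 (addr_ge0 (mulr_ge0 X4 C0) (mulr_ge0 (mulr_ge0 (ler0n _ 2) X2) B0)) A0.
move=> v x v0 dx xX; have X0 := le_trans (normr_ge0 x) xX.
have xX2 : x ^+ 2 <= X ^+ 2.
  by rewrite -[leLHS]ger0_norm ?sqr_ge0// normrX lerXn2r ?nnegrE.
have xX4 : x ^+ 4 <= X ^+ 4 by rewrite (exprM x 2 2) (exprM X 2 2) lerXn2r ?nnegrE ?sqr_ge0.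
have g0 := gauss_density_ge0 v x.
set g := gauss_density v x in g0 *.
have -> : gauss_coef2 v x * g = 4^-1 * (x ^+ 4 * ((v ^+ 4)^-1 * g))
    - 3 / 2 * (x ^+ 2 * ((v ^+ 3)^-1 * g)) + 3 / 4 * ((v ^+ 2)^-1 * g).
  by rewrite /gauss_coef2 /gauss_coef1; field; rewrite gt_eqF.
have {HA} := HA _ _ v0 dx; have {HB} := HB _ _ v0 dx; have {HC} := HC _ _ v0 dx.
rewrite -/g.
have : 0 <= (v ^+ 2)^-1 * g by rewrite mulr_ge0 ?invr_ge0 ?exprn_ge0 ?(ltW v0).
have : 0 <= (v ^+ 3)^-1 * g by rewrite mulr_ge0 ?invr_ge0 ?exprn_ge0 ?(ltW v0).
have : 0 <= (v ^+ 4)^-1 * g by rewrite mulr_ge0 ?invr_ge0 ?exprn_ge0 ?(ltW v0).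
move: (_^-1 * g) => g4; move: (_^-1 * g) => g3; move: (_^-1 * g) => g2.
move: (v ^+ m) => w h4 h3 h2 k4 k3 k2.
have e4 : x ^+ 4 * g4 <= X ^+ 4 * (C * w) by rewrite ler_pM// exprn_even_ge0.
have e3 : x ^+ 2 * g3 <= X ^+ 2 * (B * w) by rewrite ler_pM// sqr_ge0.
have f4 : 0 <= x ^+ 4 * g4 by rewrite mulr_ge0// exprn_even_ge0.
have f3 : 0 <= x ^+ 2 * g3 by rewrite mulr_ge0// sqr_ge0.
rewrite (_ : _ * w = X ^+ 4 * (C * w) + 2 * (X ^+ 2 * (B * w)) + A * w); last by ring.
move: (x ^+ 4 * _) (x ^+ 2 * _) e4 e3 f4 f3 => a4 a3.
move: (X ^+ 4 * _) (X ^+ 2 * _) (A * w) k2 => b4 b3 b2 k2 e4 e3 f4 f3.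
by rewrite ler_norml; apply/andP; split; lra.
Qed.

End GaussianBounds.

Section OUDensity.
Context {R : realType}.
Notation mu := (@lebesgue_measure R).
Variables H theta : R.
Hypotheses (H_range : 2^-1 < H < 1) (theta_gt0 : 0 < theta).

Let V := ou_variance H theta.
Let W := ou_variance' H theta.
Let W1 := ou_variance'' H theta.
Let rate := ou_rate H theta.

Lemma ou_densityE (t x : R) : ou_density H theta t x = gauss_density (V t) x.
Proof. by []. Qed.

Definition ou_density' (t x : R) : R := gauss_coef1 (V t) x * gauss_density (V t) x * W t.

Definition ou_density'' (t x : R) : R :=
  gauss_coef2 (V t) x * gauss_density (V t) x * W t ^+ 2 +
  gauss_coef1 (V t) x * gauss_density (V t) x * W1 t.

Let h := ou_density H theta.
Let h1 := ou_density'.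
Let h2 := ou_density''.

Let dV (t : R) : 0 < t -> is_derive t 1 V (W t).
Proof. exact: is_derive_ou_variance. Qed.

Let dW (t : R) : 0 < t -> is_derive t 1 W (W1 t).
Proof. exact: is_derive_ou_variance'. Qed.

Let V_gt0 (t : R) : 0 < t -> 0 < V t.
Proof. exact: ou_variance_gt0. Qed.

Let W_gt0 (t : R) : 0 < t -> 0 < W t.
Proof. exact: ou_variance'_gt0. Qed.

Let dg (t x : R) : 0 < t -> is_derive t 1 (fun t => gauss_density (V t) x) (h1 t x).
Proof.
by move=> t0; exact: (@is_derive1_comp R _ _ t _ _ (is_derive_gauss_density x (V_gt0 t0)) (dV t0)).
Qed.

Lemma is_derive_ou_density (t x : R) : 0 < t -> is_derive t 1 (h ^~ x) (h1 t x).
Proof. exact: dg. Qed.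

Lemma is_derive_ou_density' (t x : R) : 0 < t -> is_derive t 1 (h1 ^~ x) (h2 t x).
Proof.
move=> t0; have v0 := V_gt0 t0.
have dc := @is_derive1_comp R _ _ t _ _ (is_derive_gauss_coef1 x v0) (dV t0).
apply: (is_derive_eq (is_deriveM (is_deriveM dc (dg x t0)) (dW t0))).
rewrite /GRing.scale/= /h1 /h2 /ou_density' /ou_density'' /gauss_coef2.
rewrite -[((_ \o _) * _) t]/(gauss_coef1 (V t) x * gauss_density (V t) x) !mulNr.
move: (gauss_coef1 _ _) (gauss_density _ _) (W t) (W1 t) (x ^+ 2 / _) ((2 * _)^-1) => c g w w1 a b.
ring.
Qed.

Let cont_of_derive (f : R -> R) (t a : R) : is_derive t 1 f a -> {for t, continuous f}.
Proof. by move=> d; apply/differentiable_continuous/derivable1_diffP; case: d. Qed.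

Lemma continuous_ou_density (t x : R) : 0 < t -> {for t, continuous (h ^~ x)}.
Proof. by move=> /(is_derive_ou_density x); exact: cont_of_derive. Qed.

Lemma continuous_ou_density' (t x : R) : 0 < t -> {for t, continuous (h1 ^~ x)}.
Proof. by move=> /(is_derive_ou_density' x); exact: cont_of_derive. Qed.

Lemma continuous_ou_density'' (t x : R) : 0 < t -> {for t, continuous (h2 ^~ x)}.
Proof.
move=> t0; have v0 := V_gt0 t0.
have cV := continuous_ou_variance H_range theta_gt0 t0.
have cW := continuous_ou_variance' H_range theta_gt0 t0.
have cW1 := continuous_ou_variance'' H_range theta_gt0 t0.
have cc : {for t, continuous (fun t => gauss_coef1 (V t) x)}.
  exact: cont_of_derive (@is_derive1_comp R _ _ t _ _ (is_derive_gauss_coef1 x v0) (dV t0)).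
have cg : {for t, continuous (fun t => gauss_density (V t) x)} by exact: cont_of_derive (dg x t0).
have cX (k : nat) : {for t, continuous (fun t => V t ^+ k)}.
  by apply: (@cvg_comp _ _ _ V (fun y => y ^+ k) _ (nbhs (V t))) => //; exact: exprn_continuous.
have cX2 : {for t, continuous (fun t => 2 * V t ^+ 2)}.
  by apply: cvgM; [exact: cvg_cst|exact: cX].
have c2 : {for t, continuous (fun t => gauss_coef2 (V t) x)}.
  apply: cvgD; last by apply: (cvgV _ cX2); rewrite mulf_neq0// expf_neq0// gt_eqF.
  apply: cvgB; first exact: (cvgM cc cc).
  apply: cvgM; first exact: cvg_cst.
  by apply: (cvgV _ (cX 3%N)); rewrite expf_neq0// gt_eqF.
apply: cvgD.
  by apply: cvgM; [exact: (cvgM c2 cg)|exact: (cvgM cW cW)].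
by apply: cvgM; [exact: (cvgM cc cg)|exact: cW1].
Qed.

Lemma ou_density0 (x : R) : h 0 x = 0.
Proof. by rewrite /h ou_densityE /V ou_variance0// gauss_density0. Qed.

Lemma ou_density'0 (x : R) : h1 0 x = 0.
Proof. by rewrite /h1 /ou_density' /W ou_variance'0// mulr0. Qed.

Lemma ou_density''0 (x : R) : h2 0 x = 0.
Proof. by rewrite /h2 /ou_density'' /V ou_variance0// gauss_density0 !mulr0 !mul0r addr0. Qed.

Lemma ou_density_bounds (x : R) : x != 0 -> exists K, 0 <= K /\ forall t : R, 0 < t ->
  [/\ `|h t x| <= K * t, `|h1 t x| <= K * t, `|h2 t x| <= K * t & `|h1 t x| <= K * W t].
Proof.
move=> x0; have d0 : 0 < `|x| by rewrite normr_gt0.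
have [A [A0 HA]] := gauss_density_le_pow 1 d0.
have [B0 [B00 HB0]] := gauss_coef1_bound `|x| 0 d0.
have [B1 [B10 HB1]] := gauss_coef1_bound `|x| 1 d0.
have [B2 [B20 HB2]] := gauss_coef1_bound `|x| 2 d0.
have [C [C0 HC]] := gauss_coef2_bound `|x| 1 d0.
have r0 : 0 < rate by exact: ou_rate_gt0.
pose k2 := ou_rate2 H theta.
have k20 : 0 <= k2.
  by have := ou_variance''_bound H_range theta_gt0 ltr01; apply: le_trans; rewrite mulr_ge0.
pose K1 := A * rate; pose K2 := B1 * rate * rate.
pose K3 := C * rate * rate ^+ 2 + B2 * rate ^+ 2 * k2.
have K10 : 0 <= K1 by rewrite mulr_ge0 ?(ltW r0).
have r2 := sqr_ge0 rate.
have K20 : 0 <= K2 by exact: mulr_ge0 (mulr_ge0 B10 (ltW r0)) (ltW r0).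
have K30 : 0 <= K3.
  exact: addr_ge0 (mulr_ge0 (mulr_ge0 C0 (ltW r0)) r2) (mulr_ge0 (mulr_ge0 B20 r2) k20).
exists (B0 + K1 + K2 + K3); split; first exact: addr_ge0 (addr_ge0 (addr_ge0 B00 K10) K20) K30.
move=> t t0; have v0 := V_gt0 t0; have w0 := W_gt0 t0.
have wr : W t <= rate by exact: ou_variance'_le.
have vr : V t <= rate * t by exact: ou_variance_le.
have w1 : t * `|W1 t| <= k2 by exact: ou_variance''_bound.
have xx := lexx `|x|.
split.
- rewrite (@le_trans _ _ (K1 * t))//; last by rewrite ler_wpM2r ?(ltW t0)//; lra.
  rewrite ger0_norm ?gauss_density_ge0// (le_trans (HA _ _ v0 xx))// expr1 /K1 -mulrA.
  by rewrite ler_wpM2l.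
- rewrite (@le_trans _ _ (K2 * t))//; last by rewrite ler_wpM2r ?(ltW t0)//; lra.
  rewrite normrM (gtr0_norm w0) /K2.
  apply: (@le_trans _ _ (B1 * V t * rate)).
    by apply: ler_pM => //; [exact: ltW|exact: HB1].
  rewrite (_ : B1 * rate * rate * t = B1 * (rate * t) * rate); last by ring.
  by rewrite ler_wpM2r ?(ltW r0)// ler_wpM2l.
- rewrite (@le_trans _ _ (K3 * t))//; last by rewrite ler_wpM2r ?(ltW t0)//; lra.
  rewrite /h2 /ou_density'' (le_trans (ler_normD _ _))// /K3 [leRHS]mulrDl.
  apply: lerD.
    rewrite normrM normrX (gtr0_norm w0).
    rewrite (@le_trans _ _ (C * V t * rate ^+ 2))//.
      apply: ler_pM; rewrite ?normr_ge0 ?sqr_ge0//; first exact: HC.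
      by rewrite lerXn2r// nnegrE ltW.
    rewrite (_ : C * rate * rate ^+ 2 * t = C * (rate * t) * rate ^+ 2); last by ring.
    by rewrite ler_wpM2r ?sqr_ge0// ler_wpM2l.
  rewrite normrM (@le_trans _ _ (B2 * (rate * t) ^+ 2 * `|W1 t|))//.
    rewrite ler_wpM2r// (le_trans (HB2 _ _ v0 xx xx))// ler_wpM2l//.
    by rewrite lerXn2r// nnegrE; [exact: ltW|exact: le_trans (ltW v0) vr].
  rewrite (_ : _ * `|W1 t| = B2 * rate ^+ 2 * t * (t * `|W1 t|)); last by ring.
  rewrite (_ : _ * k2 * t = B2 * rate ^+ 2 * t * k2); last by ring.
  by rewrite ler_wpM2l//; exact: mulr_ge0 (mulr_ge0 B20 r2) (ltW t0).
- rewrite (@le_trans _ _ (B0 * W t))//; last by rewrite ler_wpM2r ?(ltW w0)//; lra.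
  rewrite normrM (gtr0_norm w0) ler_wpM2r ?(ltW w0)//.
  by rewrite (le_trans (HB0 _ _ v0 xx xx))// expr0 mulr1.
Qed.

Lemma laplace_ou_density (x : R) (z : R[i]) : x != 0 -> 0 < complex.Re z ->
  [/\ has_laplace (h ^~ x) z, has_laplace (h1 ^~ x) z &
      laplace (h ^~ x) z = z^-1 * laplace (h1 ^~ x) z].
Proof.
move=> x0 rz; have [K [K0 HK]] := ou_density_bounds x0.
apply: (@laplace_derivative R (h ^~ x) (h1 ^~ x) K (ou_density0 x) (ou_density'0 x)) => // t t0.
- exact: is_derive_ou_density.
- exact: continuous_ou_density'.
- by have [] := HK _ t0.
- by have [] := HK _ t0.
Qed.

Lemma laplace_ou_density_decay (x c : R) : x != 0 -> 0 < c ->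
  exists C, 0 <= C /\ forall w : R,
    normc (laplace (h ^~ x) (c +i* w)%C) <= C * (1 + `|w|) `^ (- (1 + 1)).
Proof.
move=> x0 cc0; have [K [K0 HK]] := ou_density_bounds x0.
have [M HM] := @laplace_vertical_bounded R (h2 ^~ x) K (fun t => @continuous_ou_density'' t x)
  (fun t t0 => let: And4 _ _ k2 _ := HK t t0 in k2) c cc0.
have M0 : 0 <= M by exact: le_trans (normc_ge0 _) (HM 0).
pose k : R := 2 / c ^+ 2 + 2.
have k0 : 0 <= k by rewrite addr_ge0// divr_ge0// sqr_ge0.
exists (M * k); split; first by rewrite mulr_ge0.
move=> w; set z := (c +i* w)%C; have rz : 0 < complex.Re z by [].
have [_ _ ->] := laplace_ou_density x0 rz.
have [||||_ _ ->] := @laplace_derivative R (h1 ^~ x) (h2 ^~ x) K (ou_density'0 x) (ou_density''0 x) _ _ _ _ z rz.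
- by move=> t; exact: is_derive_ou_density'.
- by move=> t; exact: continuous_ou_density''.
- by move=> t /HK[].
- by move=> t /HK[].
have w1 : 0 < 1 + `|w| by rewrite ltr_pwDl.
have nz : normc z ^+ 2 = c ^+ 2 + w ^+ 2 by rewrite /= sqr_sqrtr// addr_ge0 ?sqr_ge0.
have nz0 : 0 < normc z ^+ 2 by rewrite nz ltr_pwDl ?sqr_ge0// exprn_gt0.
rewrite mulrA !normcM mulrC -[leRHS]mulrA ler_pM ?mulr_ge0 ?normc_ge0//; first exact: HM.
rewrite (_ : - (1 + 1) = - (2%:R)); last by rewrite -natr1.
rewrite powR_invn ?(ltW w1)// normcV -expr2 exprVn ler_pdivlMr ?exprn_gt0// ler_pdivrMl// nz.
rewrite -(real_normK (num_real w)) /k.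
set a := `|w|.
have -> : (c ^+ 2 + a ^+ 2) * (2 / c ^+ 2 + 2) = (1 + a) ^+ 2 + ((1 - a) ^+ 2 + 2 * (a / c) ^+ 2 + 2 * c ^+ 2).
  by field; rewrite gt_eqF.
have := sqr_ge0 (1 - a); have := sqr_ge0 (a / c); have := sqr_ge0 c.
move: ((1 - a) ^+ 2) ((a / c) ^+ 2) (c ^+ 2) => p q r r1 q1 p1.
by rewrite lerDl; lra.
Qed.

End OUDensity.

(** * Holomorphy of Laplace transforms *)

Section Holomorphy.
Context {R : realType}.
Notation mu := (@lebesgue_measure R).

Let G (a b p q s : R) : R := expR (s * a) * (p * cos (s * b) - q * sin (s * b)).

Let dG (a b p q s : R) : is_derive s 1 (G a b p q) (G a b (p * a - q * b) (p * b + q * a) s).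
Proof.
have dl (k : R) : is_derive s 1 (fun s : R => s * k) k.
  by apply: is_derive_eq; rewrite /GRing.scale/=; ring.
have de := @is_derive1_comp R _ _ s _ _ (is_derive_expR (s * a)) (dl a).
have dc := @is_derive1_comp R _ _ s _ _ (is_derive_cos (s * b)) (dl b).
have ds := @is_derive1_comp R _ _ s _ _ (is_derive_sin (s * b)) (dl b).
have d := is_deriveM de (is_deriveB (@is_deriveZ _ _ _ _ p s 1 _ dc) (@is_deriveZ _ _ _ _ q s 1 _ ds)).
apply: (is_derive_eq d); rewrite /GRing.scale/= /G.
rewrite -[((_ \*: _) - (_ \*: _)) s]/(p * cos (s * b) - q * sin (s * b)).
by move: (expR _) (cos _) (sin _) => E C S; ring.
Qed.

Let G_le (a b p q s : R) : 0 <= s <= 1 -> `|G a b p q s| <= (`|p| + `|q|) * expR `|a|.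
Proof.
move=> /andP[s0 s1]; rewrite /G normrM ger0_norm ?expR_ge0// [leRHS]mulrC.
apply: ler_pM; rewrite ?expR_ge0//.
  by rewrite ler_expR (le_trans (ler_norm _))// normrM ger0_norm// ler_piMl.
apply: (le_trans (ler_normB _ _)); rewrite !normrM; apply: lerD; apply: ler_piMr => //.
  by rewrite ler_norml cos_geN1 cos_le1.
by rewrite ler_norml sin_geN1 sin_le1.
Qed.

Let taylor_G (a b p q : R) :
  `|G a b p q 1 - p - (p * a - q * b)| <=
  (`|(p * a - q * b) * a - (p * b + q * a) * b| +
   `|(p * a - q * b) * b + (p * b + q * a) * a|) * expR `|a|.
Proof.
have cG p' q' : continuous (G a b p' q').
  by move=> s; apply/differentiable_continuous/derivable1_diffP; case: (dG a b p' q' s).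
have [] := @MVT_segment R (G a b p q) (G a b (p * a - q * b) (p * b + q * a)) 0 1 ler01.
- by move=> x _; exact: dG.
- by apply: continuous_subspaceT => x; exact: cG.
move=> x; rewrite in_itv/= => /andP[x0 x1]; rewrite subr0 mulr1 => e1.
have [] := @MVT_segment R (G a b (p * a - q * b) (p * b + q * a)) (G a b ((p * a - q * b) * a - (p * b + q * a) * b) ((p * a - q * b) * b + (p * b + q * a) * a)) 0 x x0.
- by move=> y _; exact: dG.
- by apply: continuous_subspaceT => y; exact: cG.
move=> y; rewrite in_itv/= => /andP[y0 y1]; rewrite subr0 => e2.
have G0 p' q' : G a b p' q' 0 = p'.
  by rewrite /G !mul0r expR0 cos0 sin0 mulr0 mulr1 subr0 mul1r.
have -> : G a b p q 1 - p - (p * a - q * b) = G a b ((p * a - q * b) * a - (p * b + q * a) * b) ((p * a - q * b) * b + (p * b + q * a) * a) y * x.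
  by rewrite -e2 !G0 -e1 G0.
rewrite normrM (ger0_norm x0) (@le_trans _ _ `|G a b ((p * a - q * b) * a - (p * b + q * a) * b) ((p * a - q * b) * b + (p * b + q * a) * a) y|)//.
  by rewrite ler_piMr.
by apply: G_le; rewrite y0 (le_trans y1 x1).
Qed.

Lemma cexp_taylor (u : R[i]) :
  normc (cexp u - 1 - u) <= 4 * normc u ^+ 2 * expR `|complex.Re u|.
Proof.
case: u => a b; rewrite (le_trans (normc_le_ReIm _))//.
have -> : normc (a +i* b)%C ^+ 2 = a ^+ 2 + b ^+ 2 by rewrite /= sqr_sqrtr// addr_ge0 ?sqr_ge0.
have ha : `|a ^+ 2 - b ^+ 2| <= a ^+ 2 + b ^+ 2.
  by have := sqr_ge0 a; have := sqr_ge0 b; rewrite ler_norml => ? ?; apply/andP; split; lra.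
have hb : `|2 * a * b| <= a ^+ 2 + b ^+ 2.
  have h1 := sqr_ge0 (a - b); have h2 := sqr_ge0 (a + b).
  by rewrite ler_norml; apply/andP; split; nra.
have e0 := expR_ge0 `|a|.
have h1 : `|complex.Re (cexp (a +i* b)%C - 1 - (a +i* b)%C)| <= (2 * (a ^+ 2 + b ^+ 2)) * expR `|a|.
  rewrite !(ReD, ReN)/=.
  have := taylor_G a b 1 0; rewrite {1}/G !mul1r !mul0r !subr0 !addr0 => /le_trans; apply.
  rewrite ler_wpM2r//.
  rewrite (_ : a * a - b * b = a ^+ 2 - b ^+ 2); last by ring.
  by rewrite (_ : a * b + b * a = 2 * a * b); [lra|ring].
have h2 : `|complex.Im (cexp (a +i* b)%C - 1 - (a +i* b)%C)| <= (2 * (a ^+ 2 + b ^+ 2)) * expR `|a|.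
  rewrite !(ImD, ImN)/= oppr0 addr0.
  have := taylor_G a b 0 (-1); rewrite {1}/G !mul1r !mul0r !sub0r !add0r subr0 !mulN1r !opprK => /le_trans; apply.
  rewrite ler_wpM2r//.
  rewrite (_ : b * a - - a * b = 2 * a * b); last by ring.
  by rewrite (_ : b * b + - a * a = - (a ^+ 2 - b ^+ 2)) ?normrN; [lra|ring].
by apply: le_trans (lerD h1 h2) _; rewrite -mulrDl ler_wpM2r//; lra.
Qed.

Variables (f : R -> R) (K : R).
Hypothesis cf : forall t : R, 0 < t -> {for t, continuous f}.
Hypothesis f_le : forall t : R, 0 < t -> `|f t| <= K * t.

Let D := `]0, +oo[%classic : set (measurableTypeR R).

Let mD : measurable D. Proof. exact: measurable_itvR. Qed.

Let mf : measurable_fun D f. Proof. exact: continuous_gt0_measurable. Qed.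

Lemma integrable_pow_expRN (rho : R) (k : nat) : 0 < rho ->
  mu.-integrable D (EFin \o (fun t : R => t ^+ k * (`|f t| * expR (- (rho * t))))).
Proof.
move=> rho0; have r20 : 0 < rho / 2 by rewrite divr_gt0.
apply: (@integrable_dom _ _ _ mu _ mD _ (fun t => k`!%:R / (rho / 2) ^+ k * (`|f t| * expR (- (rho / 2 * t))))).
- apply: measurable_funM; first exact: measurable_funX.
  apply: measurable_funM; first exact: measurableT_comp.
  apply: continuous_measurable_funR => r; apply: continuous_comp; last exact: continuous_expR.
  by apply: cvgN; apply: cvgM; [exact: cvg_cst|exact: cvg_id].
- move=> t; rewrite /D/= in_itv/= andbT => t0.
  have E0 : 0 <= `|f t| * expR (- (rho / 2 * t)) by rewrite mulr_ge0 ?expR_ge0.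
  rewrite ger0_norm; last by rewrite !mulr_ge0 ?expR_ge0 ?exprn_ge0 ?(ltW t0).
  rewrite (_ : expR (- (rho * t)) = expR (- (rho / 2 * t)) * expR (- (rho / 2 * t))); last first.
    by rewrite -expRD; congr expR; lra.
  rewrite (_ : _ * _ = (t ^+ k * expR (- (rho / 2 * t))) * (`|f t| * expR (- (rho / 2 * t)))); last by ring.
  rewrite ler_wpM2r// -ler_pdivlMl ?exprn_gt0//.
  rewrite (le_trans (expRN_le_pow k _)) ?mulr_gt0// exprMn invfM.
  by rewrite le_eqVlt; apply/orP; left; apply/eqP; ring.
- exact: (integrableMc mD _ (integrable_linear_expRN cf f_le r20)).
Qed.

Let has_laplace_pow (z : R[i]) (k : nat) : 0 < complex.Re z ->
  cintegrable mu D (fun t : R => cexp (- z * t%:C%C) * (t ^+ k * f t)%:C%C).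
Proof.
move=> rz; apply: (@cintegrable_dom _ _ _ mu _ mD _ (fun t => t ^+ k * (`|f t| * expR (- (complex.Re z * t))))).
- apply: cmeasurableM; first exact: cmeasurable_cexp_mulNC.
  by apply: cmeasurable_real; apply: measurable_funM => //; exact: measurable_funX.
- move=> t Dt; have t0 : 0 < t by move: Dt; rewrite /D/= in_itv/= andbT.
  rewrite normcM normc_cexp_mulNC normcC normrM ger0_norm ?exprn_ge0 ?(ltW t0)//.
  by rewrite mulrC mulrA.
- exact: integrable_pow_expRN.
Qed.

Lemma laplace_taylor (z : R[i]) : 0 < complex.Re z ->
  exists (L : R[i]) (M : R), 0 <= M /\ forall u : R[i], normc u <= complex.Re z / 2 ->
    normc (laplace f (z + u) - laplace f z - u * L) <= M * normc u ^+ 2.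
Proof.
move=> rz; have r20 : 0 < complex.Re z / 2 by rewrite divr_gt0.
set rho := complex.Re z / 2 in r20 *.
pose L := cintegral mu D (fun t : R => cexp (- z * t%:C%C) * (t ^+ 1 * f t)%:C%C).
have iM := integrable_pow_expRN 2 r20.
pose M := \int[mu]_(t in D) (t ^+ 2 * (`|f t| * expR (- (rho * t)))).
have M0 : 0 <= M.
  by apply: Rintegral_ge0 => t _; exact: mulr_ge0 (sqr_ge0 _) (mulr_ge0 (normr_ge0 _) (expR_ge0 _)).
exists (- L), (8 * M); split; first by rewrite mulr_ge0.
move=> u uz; have ru : `|complex.Re u| <= rho by exact: le_trans (ler_Re_normc u) uz.
have rzu : 0 < complex.Re (z + u).
  rewrite ReD; have : complex.Re z = 2 * rho by rewrite /rho; field.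
  by move: ru; rewrite ler_norml => /andP[h _] ->; lra.
have i0 (y : R[i]) : 0 < complex.Re y -> cintegrable mu D (laplace_integrand f y).
  by move=> ry; apply: (eq_cintegrable mD _ (has_laplace_pow 0 ry)) => t _; rewrite expr0 mul1r.
have i1 := has_laplace_pow 1 rz.
rewrite /laplace -(cintegralB mD (i0 _ rzu) (i0 _ rz)) mulrN opprK -(cintegralZ mD u i1).
rewrite -(cintegralD mD); last 2 first.
- exact: (cintegrableB mD (i0 _ rzu) (i0 _ rz)).
- exact: (cintegrableZ mD u i1).
rewrite (_ : 8 * M * normc u ^+ 2 = 2 * ((4 * normc u ^+ 2) * M)); last by ring.
rewrite -RintegralZl//.
apply: (normc_cintegral_le mD).
- apply: cmeasurableD; first apply: cmeasurableD.
  + by case: (cintegrable_cmeasurable (i0 _ rzu)).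
  + by apply: cmeasurableN; exact: cintegrable_cmeasurable (i0 _ rz).
  + by apply: cmeasurableM; [exact: cmeasurable_cst|exact: cintegrable_cmeasurable i1].
- move=> t Dt; have t0 : 0 < t by move: Dt; rewrite /D/= in_itv/= andbT.
  have -> : laplace_integrand f (z + u) t - laplace_integrand f z t + u * (cexp (- z * t%:C%C) * (t ^+ 1 * f t)%:C%C)
    = (cexp (- z * t%:C%C) * (f t)%:C%C) * (cexp (- u * t%:C%C) - 1 - - u * t%:C%C).
    rewrite /laplace_integrand opprD mulrDl cexpD expr1 rmorphM/=; ring.
  rewrite !normcM normc_cexp_mulNC normcC.
  have T := cexp_taylor (- u * t%:C%C).
  have e1 : normc (- u * t%:C%C) = t * normc u.
    by rewrite normcM normcN normcC gtr0_norm// mulrC.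
  have e2 : `|complex.Re (- u * t%:C%C)| <= rho * t.
    by rewrite ReM/= mulr0 subr0 ReN mulNr normrN normrM (gtr0_norm t0) ler_wpM2r// ltW.
  have {}T : normc (cexp (- u * t%:C%C) - 1 - - u * t%:C%C) <= 4 * (t * normc u) ^+ 2 * expR (rho * t).
    apply: (le_trans T); rewrite e1 ler_wpM2l ?ler_expR// mulr_ge0 ?sqr_ge0//.
  apply: (le_trans (ler_wpM2l _ T)); first by rewrite mulr_ge0 ?expR_ge0.
  rewrite (_ : expR (- (rho * t)) = expR (- (complex.Re z * t)) * expR (rho * t)).
    by rewrite le_eqVlt; apply/orP; left; apply/eqP; ring.
  by rewrite -expRD; congr expR; rewrite /rho; field.
- exact: integrableMc.
Qed.

Lemma cdifferentiable_laplace (z : R[i]) : 0 < complex.Re z ->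
  cdifferentiable (laplace f) z.
Proof.
move=> rz; have [L [M [M0 HM]]] := laplace_taylor rz.
apply/cvg_ex; exists (L : R[i]^o); apply/cvgrPdist_le => e e0.
have [e1 e1E] : exists e1 : R, e = e1%:C%C.
  by exists (complex.Re e); case: e e0 => a b /=; rewrite ltcE/= => /andP[/eqP -> _].
have e10 : 0 < e1 by move: e0; rewrite e1E ltcR.
pose dl := Num.min (complex.Re z / 2) (e1 / (M + 1)).
have dl0 : 0 < dl by rewrite lt_min !divr_gt0// ltr_wpDl.
near=> u.
have u0 : u != 0 by near: u; exact: nbhs_dnbhs_neq.
have ud : `|u| < dl%:C%C.
  near: u; apply: dnbhs0_lt; by rewrite ltcR.
have {}ud : normc u < dl by move: ud; rewrite -ltcR.
have ud1 : normc u <= complex.Re z / 2 by rewrite ltW// (lt_le_trans ud)// ge_min lexx.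
have ud2 : normc u <= e1 / (M + 1) by rewrite ltW// (lt_le_trans ud)// ge_min lexx orbT.
have := HM _ ud1.
have -> : (laplace f \o shift z) u%:A = laplace f (z + u).
  by rewrite /= /GRing.scale/= mulr1 addrC.
move: (laplace f (z + u) - laplace f z) => X HX.
have nu0 : 0 < normc u by rewrite normc_gt0.
have -> : L - u^-1 *: (X : R[i]^o) = - u^-1 * (X - u * L).
  by rewrite -[u^-1 *: _]/(u^-1 * X) mulNr mulrBr mulrA mulVf// mul1r opprB.
rewrite e1E -[leLHS]/(normc _)%:C%C lecR normcM normcN normcV ler_pdivrMl//.
rewrite (le_trans HX)// expr2 mulrA [leRHS]mulrC ler_wpM2r ?normc_ge0//.
rewrite (@le_trans _ _ ((M + 1) * normc u))//; first by rewrite ler_wpM2r ?normc_ge0// lerDl.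
by rewrite mulrC -ler_pdivlMr// ltr_wpDl.
Unshelve. all: by end_near. Qed.

End Holomorphy.

(** * Space derivatives under the integral *)

Section UnderIntegral.
Context {R : realType}.
Notation mu := (@lebesgue_measure R).
Let D := `]0, +oo[%classic : set (measurableTypeR R).
Let mD : measurable D. Proof. exact: measurable_itvR. Qed.

Lemma is_derive_under_integral (k : R -> R) (u du : R -> R -> R) (G : R -> R) (a b x : R) :
  measurable_fun D k -> (forall t, 0 < t -> `|k t| <= 1) -> a < x < b ->
  (forall y, a < y < b -> mu.-integrable D (EFin \o u ^~ y)) ->
  (forall t y : R, 0 < t -> a < y < b -> is_derive y 1 (u t) (du t y)) ->
  (forall t y : R, 0 < t -> a < y < b -> `|du t y| <= G t) ->
  mu.-integrable D (EFin \o G) ->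
  is_derive x 1 (fun y => \int[mu]_(t in D) (k t * u t y)) (\int[mu]_(t in D) (k t * du t x)).
Proof.
move=> mk k1 axb iu dk duG iG.
have Ix : `]a, b[%classic x by rewrite /= in_itv.
pose g (y t : R) := k t * u t y.
have ig y : `]a, b[%classic y -> mu.-integrable D (EFin \o g y).
  rewrite /= in_itv/= => yab; have iuy := iu _ yab.
  apply: (@integrable_dom _ _ _ mu _ mD _ (fun t => `|u t y|)).
  - apply: measurable_funM => //.
    by case/integrableP : iuy => /measurable_EFinP.
  - by move=> t; rewrite /D/= in_itv/= andbT => t0; rewrite /g normrM ler_piMl// k1.
  - exact: integrable_abse iuy.
have dg (y t : R) : `]a, b[%classic y -> D t -> is_derive y 1 (g ^~ t) (k t * du t y).
  rewrite /D/= !in_itv/= andbT => yab t0.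
  exact: (@is_deriveZ _ _ _ _ (k t) y 1 _ (dk _ _ t0 yab)).
have dd (y t : R) : `]a, b[%classic y -> D t -> derivable (g ^~ t) y 1.
  by move=> ya Dt; case: (dg _ _ ya Dt).
have pE (y t : R) : `]a, b[%classic y -> D t -> partial1of2 g y t = k t * du t y.
  by move=> ya Dt; rewrite partial1of2E; have /@derive_val := dg _ _ ya Dt.
have G0 (t : R) : 0 <= `|G t| by [].
have iG' : mu.-integrable D (EFin \o (fun t => `|G t|)) by exact: integrable_abse iG.
have pG (y t : R) : `]a, b[%classic y -> D t -> `|partial1of2 g y t| <= `|G t|.
  move=> ya Dt; rewrite pE// normrM.
  move: ya Dt; rewrite /D/= !in_itv/= andbT => ya t0.
  by rewrite (le_trans (ler_piMl _ (k1 t t0)))// (le_trans (duG _ _ t0 ya))// ler_norm.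
have E := differentiation_under_integral mD Ix ig dd G0 iG' pG.
have Dv := derivable_under_integral mD Ix ig dd G0 iG' pG.
apply: DeriveDef; first exact: Dv.
rewrite -derive1E E; apply: eq_Rintegral => t; rewrite inE => Dt.
exact: pE.
Qed.

Lemma is_derive2_under_integral (k : R -> R) (u du d2u : R -> R -> R) (G : R -> R) (a b x : R) :
  measurable_fun D k -> (forall t, 0 < t -> `|k t| <= 1) -> a < x < b ->
  (forall y, a < y < b -> mu.-integrable D (EFin \o u ^~ y)) ->
  (forall y, a < y < b -> mu.-integrable D (EFin \o du ^~ y)) ->
  (forall t y : R, 0 < t -> a < y < b -> is_derive y 1 (u t) (du t y)) ->
  (forall t y : R, 0 < t -> a < y < b -> is_derive y 1 (du t) (d2u t y)) ->
  (forall t y : R, 0 < t -> a < y < b -> `|du t y| <= G t) ->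
  (forall t y : R, 0 < t -> a < y < b -> `|d2u t y| <= G t) ->
  mu.-integrable D (EFin \o G) ->
  is_derive2 (fun y => \int[mu]_(t in D) (k t * u t y)) x (\int[mu]_(t in D) (k t * d2u t x)).
Proof.
move=> mk k1 axb iu idu du_ d2u_ duG d2uG iG.
have d1 y : a < y < b -> is_derive y 1 (fun y => \int[mu]_(t in D) (k t * u t y)) (\int[mu]_(t in D) (k t * du t y)).
  by move=> yab; exact: is_derive_under_integral yab iu du_ duG iG.
have nx : \forall y \near x, a < y < b.
  have : x \in `]a, b[ by rewrite in_itv.
  by move=> /near_in_itvoo; apply: filterS => y; rewrite in_itv.
split; first by apply: filterS nx => y /d1[].
apply: near_eq_is_derive; last exact: is_derive_under_integral axb idu d2u_ d2uG iG.
by apply: filterS nx => y /d1 dy; rewrite derive1E; have /@derive_val := dy.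
Qed.

End UnderIntegral.

Section SpaceDerivatives.
Context {R : realType}.
Notation mu := (@lebesgue_measure R).

Lemma is_derive_gauss_density_x (v x : R) : 0 < v ->
  is_derive x 1 (gauss_density v) (- (x / v) * gauss_density v x).
Proof.
move=> v0.
have d2 : is_derive x 1 (fun x : R => - (x ^+ 2) / (2 * v)) (- (x / v)).
  have d : is_derive x 1 (fun x : R => (2 * v)^-1 * x ^+ 2) ((2 * v)^-1 * (2 * x)).
    by apply: is_derive_eq; rewrite /GRing.scale/=; ring.
  have -> : (fun x : R => - (x ^+ 2) / (2 * v)) = (fun x : R => (- 1) * ((2 * v)^-1 * x ^+ 2)).
    by apply/funext => y; ring.
  apply: (is_derive_eq (@is_deriveZ _ _ _ _ (-1) x 1 _ d)); rewrite /GRing.scale/=.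
  by field; rewrite gt_eqF.
have de := @is_derive1_comp R _ _ x _ _ (is_derive_expR _) d2.
apply: (is_derive_eq (@is_deriveZ _ _ _ _ (Num.sqrt (2 * pi * v))^-1 x 1 _ de)).
by rewrite /GRing.scale/= /gauss_density; ring.
Qed.

Lemma is_derive2_gauss_density_x (v x : R) : 0 < v ->
  is_derive x 1 (fun x => - (x / v) * gauss_density v x)
    (2 * (gauss_coef1 v x * gauss_density v x)).
Proof.
move=> v0; have dl : is_derive x 1 (fun x : R => - (x / v)) (- v^-1).
  have -> : (fun x : R => - (x / v)) = (fun x : R => (- v^-1) * x).
    by apply/funext => y; ring.
  by apply: is_derive_eq; rewrite /GRing.scale/=; ring.
apply: (is_derive_eq (is_deriveM dl (is_derive_gauss_density_x x v0))).
by rewrite /GRing.scale/= /gauss_coef1; field; rewrite gt_eqF.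
Qed.

Variables H theta : R.
Hypotheses (H_range : 2^-1 < H < 1) (theta_gt0 : 0 < theta).
Let V := ou_variance H theta.
Let W := ou_variance' H theta.
Let D := `]0, +oo[%classic : set (measurableTypeR R).
Let mD : measurable D. Proof. exact: measurable_itvR. Qed.

Lemma integrable_ou_variance' : mu.-integrable D (EFin \o W).
Proof.
have t0 : - theta^-1 < complex.Re (0 : R[i]) by rewrite oppr_lt0 invr_gt0.
have [[i _] _] := laplace_ou_variance' H_range theta_gt0 t0.
apply: (integrable_congr mD _ i) => t Dt.
by rewrite /laplace_integrand oppr0 mul0r cexp0 mul1r.
Qed.

Lemma is_cderive2_laplace_product (z : R[i]) (x : R) : 0 < complex.Re z -> x != 0 ->
  is_cderive2 (fun x => laplace (fun t => W t * ou_density H theta t x) z) x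
    (2 * laplace (ou_density' H theta ^~ x) z).
Proof.
move=> rz x0; have d0 : 0 < `|x| / 2 by rewrite divr_gt0// normr_gt0.
have ax : x - `|x| / 2 < x < x + `|x| / 2 by rewrite ltrBlDr ltrDl d0.
have ay y : x - `|x| / 2 < y < x + `|x| / 2 -> `|x| / 2 <= `|y| <= 2 * `|x|.
  move=> /andP[h1 h2]; have xy : `|x - y| <= `|x| / 2 by rewrite ler_norml; apply/andP; split; lra.
  have := le_trans (ler_dist_dist x y) xy; rewrite ler_norml => /andP[h3 h4].
  by apply/andP; split; lra.
have [A [A0 HA]] := gauss_density_div_le 0 0 d0.
have [B [B0 HB]] := gauss_density_div_le 0 1 d0.
have [C [C0 HC]] := gauss_coef1_bound (2 * `|x|) 0 d0.
pose u (t y : R) := W t * gauss_density (V t) y.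
pose du (t y : R) := W t * (- (y / V t) * gauss_density (V t) y).
pose d2u (t y : R) := W t * (2 * (gauss_coef1 (V t) y * gauss_density (V t) y)).
have iW := integrable_ou_variance'.
pose G (t : R) := (A + 2 * `|x| * B + 2 * C) * W t.
have iG : mu.-integrable D (EFin \o G) by exact: (integrableMc mD _ iW).
have W0 (t : R) : 0 < t -> 0 < W t by exact: ou_variance'_gt0.
have V0 (t : R) : 0 < t -> 0 < V t by exact: ou_variance_gt0.
have cW (t : R) : 0 < t -> {for t, continuous W} by exact: continuous_ou_variance'.
have cV (t : R) : 0 < t -> {for t, continuous V} by exact: continuous_ou_variance.
have xB0 : 0 <= `|x| * B by exact: mulr_ge0.
have uG (t y : R) : 0 < t -> x - `|x| / 2 < y < x + `|x| / 2 -> `|u t y| <= G t.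
  move=> t0 /ay/andP[y1 y2]; rewrite /u /G mulrC normrM (gtr0_norm (W0 _ t0)).
  rewrite ler_wpM2r ?(ltW (W0 _ t0))// ger0_norm ?gauss_density_ge0//.
  by have := HA _ _ (V0 _ t0) y1; rewrite !expr0 invr1 mul1r mulr1 => h; lra.
have duG (t y : R) : 0 < t -> x - `|x| / 2 < y < x + `|x| / 2 -> `|du t y| <= G t.
  move=> t0 /ay/andP[y1 y2]; rewrite /du /G mulrC normrM (gtr0_norm (W0 _ t0)).
  rewrite ler_wpM2r ?(ltW (W0 _ t0))// normrM normrN normrM -mulrA.
  have := HB _ _ (V0 _ t0) y1; rewrite expr1 expr0 mulr1 => h.
  have v1 : 0 <= (V t)^-1 by rewrite invr_ge0 ltW// V0.
  rewrite (ger0_norm v1) (ger0_norm (gauss_density_ge0 _ _)).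
  have : `|y| * ((V t)^-1 * gauss_density (V t) y) <= 2 * `|x| * B.
    by apply: ler_pM => //; exact: mulr_ge0 v1 (gauss_density_ge0 _ _).
  by move: (_ * _) => q; lra.
have d2uG (t y : R) : 0 < t -> x - `|x| / 2 < y < x + `|x| / 2 -> `|d2u t y| <= G t.
  move=> t0 /ay/andP[y1 y2]; rewrite /d2u /G mulrC normrM (gtr0_norm (W0 _ t0)).
  rewrite ler_wpM2r ?(ltW (W0 _ t0))// normrM ger0_norm//.
  have := HC _ _ (V0 _ t0) y1 y2; rewrite expr0 mulr1.
  by move: `|_ * _| => q h; lra.
have cg (t y : R) : 0 < t -> {for t, continuous (fun t => gauss_density (V t) y)}.
  by move=> t0; exact: continuous_ou_density.
have iu y : x - `|x| / 2 < y < x + `|x| / 2 -> mu.-integrable D (EFin \o u ^~ y).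
  move=> yx; apply: (@integrable_dom _ _ _ mu _ mD _ G _ _ iG).
    by apply: continuous_gt0_measurable => t t0; apply: cvgM; [exact: cW|exact: cg].
  by move=> t Dt; apply: uG => //; move: Dt; rewrite /D/= in_itv/= andbT.
have idu y : x - `|x| / 2 < y < x + `|x| / 2 -> mu.-integrable D (EFin \o du ^~ y).
  move=> yx; apply: (@integrable_dom _ _ _ mu _ mD _ G _ _ iG).
    apply: continuous_gt0_measurable => t t0; apply: cvgM; first exact: cW.
    apply: cvgM; last exact: cg.
    apply: cvgN; apply: cvgM; first exact: cvg_cst.
    by apply: (cvgV _ (cV _ t0)); rewrite gt_eqF// V0.
  by move=> t Dt; apply: duG => //; move: Dt; rewrite /D/= in_itv/= andbT.
have du_ (t y : R) : 0 < t -> x - `|x| / 2 < y < x + `|x| / 2 -> is_derive y 1 (u t) (du t y).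
  move=> t0 _; exact: (@is_deriveZ _ _ _ _ (W t) y 1 _ (is_derive_gauss_density_x y (V0 _ t0))).
have d2u_ (t y : R) : 0 < t -> x - `|x| / 2 < y < x + `|x| / 2 -> is_derive y 1 (du t) (d2u t y).
  move=> t0 _; exact: (@is_deriveZ _ _ _ _ (W t) y 1 _ (is_derive2_gauss_density_x y (V0 _ t0))).
have [mk1 mk2] := cmeasurable_cexp_mulNC z D.
have kle (t : R) : 0 < t -> normc (cexp (- z * t%:C%C)) <= 1.
  by move=> t0; rewrite normc_cexp_mulNC expR_le1 oppr_le0; apply: mulr_ge0; exact: ltW.
have [_ i1 _] := laplace_ou_density H_range theta_gt0 x0 rz.
have -> : 2 * laplace (ou_density' H theta ^~ x) z =
    cintegral mu D (fun t => cexp (- z * t%:C%C) * (d2u t x)%:C%C).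
  rewrite /laplace -(cintegralZ mD 2 i1); apply: eq_cintegral => t _.
  rewrite /laplace_integrand /d2u /ou_density' -/V -/W.
  by rewrite !rmorphM/= rmorph_nat; ring.
split.
- have -> : (fun y => complex.Re (laplace (fun t => W t * ou_density H theta t y) z)) =
    (fun y => \int[mu]_(t in D) (complex.Re (cexp (- z * t%:C%C)) * u t y)).
    by apply/funext => y; apply: eq_Rintegral => t _; rewrite /laplace_integrand ReM/= mulr0 subr0.
  have -> : complex.Re (cintegral mu D (fun t => cexp (- z * t%:C%C) * (d2u t x)%:C%C)) =
    \int[mu]_(t in D) (complex.Re (cexp (- z * t%:C%C)) * d2u t x).
    by apply: eq_Rintegral => t _; rewrite ReM/= mulr0 subr0.
  apply: (is_derive2_under_integral mk1 _ ax iu idu du_ d2u_ duG d2uG iG).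
  by move=> t t0; rewrite (le_trans (ler_Re_normc _))// kle.
- have -> : (fun y => complex.Im (laplace (fun t => W t * ou_density H theta t y) z)) =
    (fun y => \int[mu]_(t in D) (complex.Im (cexp (- z * t%:C%C)) * u t y)).
    by apply/funext => y; apply: eq_Rintegral => t _; rewrite /laplace_integrand ImM/= mulr0 add0r.
  have -> : complex.Im (cintegral mu D (fun t => cexp (- z * t%:C%C) * (d2u t x)%:C%C)) =
    \int[mu]_(t in D) (complex.Im (cexp (- z * t%:C%C)) * d2u t x).
    by apply: eq_Rintegral => t _; rewrite ImM/= mulr0 add0r.
  apply: (is_derive2_under_integral mk2 _ ax iu idu du_ d2u_ duG d2uG iG).
  by move=> t t0; rewrite (le_trans (ler_Im_normc _))// kle.
Qed.

End SpaceDerivatives.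

Section LaplaceVertical.
Context {R : realType}.
Notation mu := (@lebesgue_measure R).
Let D := `]0, +oo[%classic : set (measurableTypeR R).
Let mD : measurable D. Proof. exact: measurable_itvR. Qed.

Let cmeasurable_vertical (a : R) :
  cmeasurable (setT : set (measurableTypeR R)) (fun w : measurableTypeR R => (a +i* w)%C).
Proof. by split; [exact: measurable_cst|exact: measurable_id]. Qed.

Lemma cmeasurable_comp d1 d2 (T1 : measurableType d1) (T2 : measurableType d2)
    (f : T2 -> R[i]) (g : T1 -> T2) (A : set T1) :
  cmeasurable setT f -> measurable_fun A g -> cmeasurable A (f \o g).
Proof. by move=> [f1 f2] mg; split; [exact: (measurableT_comp f1 mg)|exact: (measurableT_comp f2 mg)]. Qed.

Lemma cmeasurable_laplace_vertical (f : R -> R) (a : R) : measurable_fun D f ->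
  mu.-integrable D (EFin \o (fun t => expR (- (a * t)) * f t)) ->
  cmeasurable setT (fun w : measurableTypeR R => laplace f (a +i* w)%C).
Proof.
move=> mf ie; pose k (w : R) := (1 + `|w|) `^ (- (1 + 1)) : R.
have k0 (w : R) : 0 < 1 + `|w| by rewrite ltr_pwDl.
have mk : measurable_fun setT (k : measurableTypeR R -> R).
  apply: (measurableT_comp (measurable_powR _)).
  by apply: measurable_funD => //; exact: measurableT_comp.
have kp (w : R) : 0 < k w by rewrite powR_gt0.
pose F (x : measurableTypeR R * measurableTypeR R) : R[i] :=
  (k x.1)%:C%C * laplace_integrand f (a +i* x.1)%C x.2.
have mF : cmeasurable (setT `*` D) F.
  apply: cmeasurableM.
    by apply: cmeasurable_real; exact: (measurableT_comp mk (measurable_funTS measurable_fst)).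
  apply: cmeasurableM.
    apply/cmeasurable_cexp/cmeasurableM.
      by apply: cmeasurableN; apply: cmeasurable_comp (cmeasurable_vertical a) _; exact: measurable_funTS.
    by apply: cmeasurable_real; exact: measurable_funTS.
  apply: cmeasurable_real; apply: (measurable_comp mD _ mf) => //.
    by move=> _ [[x y] [_ Dy] <-].
  exact: measurable_funTS.
have FE (w t : R) : normc (F (w, t)) = k w * `|expR (- (a * t)) * f t|.
  rewrite /F normcM normcC gtr0_norm//; congr (_ * _).
  by rewrite /laplace_integrand normcM normc_cexp_mulNC normcC normrM ger0_norm ?expR_ge0.
have ik : mu.-integrable setT (EFin \o k) by exact: integrable_decay.
have ib : mu.-integrable D (EFin \o (fun t => `|expR (- (a * t)) * f t|)) by exact: integrable_abse ie.
have H := cintegrable_Fubini1 measurableT mD ik ib mF (fun x y _ _ => _).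
have {}H := H _.
have i1 w : cintegrable mu D (laplace_integrand f (a +i* w)%C).
  apply: (@cintegrable_dom _ _ _ mu _ mD _ (fun t => `|expR (- (a * t)) * f t|)) => //.
    by apply: cmeasurableM; [exact: cmeasurable_cexp_mulNC|exact: cmeasurable_real].
  move=> t _; rewrite /laplace_integrand normcM normc_cexp_mulNC normcC.
  by rewrite normrM ger0_norm ?expR_ge0.
have {}H : cintegrable mu setT (fun w => (k w)%:C%C * laplace f (a +i* w)%C).
  apply: (eq_cintegrable measurableT _ (H _)).
    by move=> w _; rewrite /F/= (cintegralZ mD _ (i1 w)).
  by move=> x y; rewrite (FE x y).
have -> : (fun w : measurableTypeR R => laplace f (a +i* w)%C) =
    (fun w => ((k w)^-1)%:C%C * ((k w)%:C%C * laplace f (a +i* w)%C)).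
  by apply/funext => w; rewrite mulrA -rmorphM mulVf ?gt_eqF// mul1r.
apply: cmeasurableM; last exact: cintegrable_cmeasurable H.
apply: cmeasurable_real.
have -> : (fun w : R => (k w)^-1) = (fun w => (1 + `|w|) ^+ 2).
  apply/funext => w; rewrite /k (_ : - (1 + 1) = - (2%:R)); last by rewrite -natr1.
  by rewrite powR_invn ?invrK// ltW.
by apply: measurable_funX; apply: measurable_funD => //; exact: measurableT_comp.
Qed.

End LaplaceVertical.

Section Truncation.
Context {R : realType}.
Notation mu := (@lebesgue_measure R).

Lemma Rintegral_truncate (g : R -> R) : mu.-integrable setT (EFin \o g) ->
  \int[mu]_(x in `[- r, r]) g x @[r --> +oo] --> \int[mu]_x g x.
Proof.
move=> ig; apply/cvg_pinftyP => u uy.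
have mg : measurable_fun setT g by case/integrableP : ig => /measurable_EFinP.
pose gn n (x : measurableTypeR R) := g x * \1_(`[- u n, u n]%classic : set (measurableTypeR R)) x.
have E n : \int[mu]_(x in `[- u n, u n]) g x = \int[mu]_x gn n x.
  rewrite Rintegral_mkcond; apply: eq_Rintegral => x _.
  by rewrite /gn patchE indicE; case: ifPn => _; rewrite ?mulr1 ?mulr0.
under eq_cvg do rewrite E.
apply: (@Rintegral_dominated_cvg R _ _ mu setT gn g (fun x => `|g x|)) => //.
- by move=> n; apply: measurable_funM => //; exact: measurable_indic.
- move=> x _; rewrite /gn -[X in _ --> X]mulr1; apply: cvgM; first exact: cvg_cst.
  apply: cvg_near_cst; near=> n; rewrite indicE mem_set//= in_itv/= -ler_norml.
  by near: n; move/cvgryPge : uy; exact.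
- exact: integrable_abse ig.
- by move=> n x _; rewrite normrM ler_piMr// ger0_norm// indicE lern1 leq_b1.
Unshelve. all: by end_near. Qed.

Lemma cvg_complex (T : Type) (F : set_system T) (f : T -> R[i]) (l : R[i]) : Filter F ->
  complex.Re (f x) @[x --> F] --> complex.Re l ->
  complex.Im (f x) @[x --> F] --> complex.Im l ->
  f x @[x --> F] --> (l : R[i]^o).
Proof.
move=> FF h1 h2; apply/(@cvgrPdist_le R[i] R[i]^o T F FF f l) => e e0.
have [e1 e1E] : exists e1 : R, e = e1%:C%C.
  by exists (complex.Re e); case: e e0 => a b /=; rewrite ltcE/= => /andP[/eqP -> _].
have e10 : 0 < e1 by move: e0; rewrite e1E ltcR.
have e20 : 0 < e1 / 2 by rewrite divr_gt0.
move/cvgrPdist_le : h1 => /(_ _ e20) h1; move/cvgrPdist_le : h2 => /(_ _ e20) h2.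
near=> x; rewrite e1E -[leLHS]/(normc _)%:C%C lecR (le_trans (normc_le_ReIm _))//.
rewrite ReD ImD ReN ImN (splitr e1) lerD//; near: x; [exact: h1|exact: h2].
Unshelve. all: by end_near. Qed.

Lemma cintegral_truncate (g : R -> R[i]) : cintegrable mu setT g ->
  cintegral mu `[- r, r] g @[r --> +oo] --> (cintegral mu setT g : R[i]^o).
Proof. by move=> [g1 g2]; apply: cvg_complex => /=; exact: Rintegral_truncate. Qed.

End Truncation.

(** * The operator on the transformed density *)

Lemma vertical_split {R : realType} (a b w z : R) :
  (a +i* w)%C = (b +i* z)%C + ((a - b) +i* (w - z))%C.
Proof. by apply: complex_ext; rewrite ?ReD ?ImD/= addrC subrK. Qed.

Section Assembly.
Context {R : realType}.
Notation mu := (@lebesgue_measure R).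
Variables H theta c1 c2 : R.
Hypotheses (H_range : 2^-1 < H < 1) (theta_gt0 : 0 < theta).
Hypotheses (c2_gt0 : 0 < c2) (c12 : - theta^-1 < c1 - c2).
Variable x : R.
Hypothesis x_neq0 : x != 0.

Let W := ou_variance' H theta.
Let h := ou_density H theta ^~ x.
Let al := 2 * H - 1.
Let a := c1 - c2.
Let D := `]0, +oo[%classic : set (measurableTypeR R).
Let mD : measurable D. Proof. exact: measurable_itvR. Qed.

Let al0 : 0 < al. Proof. by case/andP: H_range => h1 h2; rewrite /al; lra. Qed.

Let K (w : R) : R[i] := laplace W (a +i* w)%C.
Let Q (z : R) : R[i] := laplace h (c2 +i* z)%C.

Lemma laplace_derive1_ou_variance (s : R[i]) :
  laplace (derive1 (ou_variance H theta)) s = laplace W s.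
Proof.
apply: eq_cintegral => t; rewrite /= in_itv/= andbT => t0.
rewrite /laplace_integrand; congr (_ * _%:C%C); rewrite derive1E.
by have /@derive_val := is_derive_ou_variance H_range theta_gt0 t0.
Qed.

Let has_laplace_real (f : R -> R) (b : R) : has_laplace f (b +i* 0)%C ->
  mu.-integrable D (EFin \o (fun t => expR (- (b * t)) * f t)).
Proof.
move=> [i _]; apply: (integrable_congr mD _ i) => t Dt.
rewrite /laplace_integrand ReM/= !(mulr0, mul0r, subr0, addr0, oppr0, mulNr).
by rewrite cos0 mulr1.
Qed.

Let iW : mu.-integrable D (EFin \o (fun t => expR (- (a * t)) * W t)).
Proof.
by apply: has_laplace_real; have [] := @laplace_ou_variance' R H theta H_range theta_gt0 (a +i* 0)%C c12.
Qed.

Let ih : mu.-integrable D (EFin \o (fun t => expR (- (c2 * t)) * h t)).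
Proof.
by apply: has_laplace_real; have [] := @laplace_ou_density R H theta H_range theta_gt0 x (c2 +i* 0)%C x_neq0 c2_gt0.
Qed.

Let cW (t : R) : 0 < t -> {for t, continuous W}.
Proof. exact: continuous_ou_variance'. Qed.

Let ch (t : R) : 0 < t -> {for t, continuous h}.
Proof. exact: continuous_ou_density. Qed.

Let mK : cmeasurable (setT : set (measurableTypeR R)) K.
Proof. by apply: cmeasurable_laplace_vertical => //; apply: continuous_gt0_measurable; exact: cW. Qed.

Let mQ : cmeasurable (setT : set (measurableTypeR R)) Q.
Proof. by apply: cmeasurable_laplace_vertical => //; apply: continuous_gt0_measurable; exact: ch. Qed.

Let m (w : R) : R := (1 + `|w|) `^ (- (1 + al)).

Let K_le : exists C, 0 <= C /\ forall w, normc (K w) <= C * m w.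
Proof. exact: laplace_ou_variance'_decay. Qed.

Let im : mu.-integrable setT (EFin \o m).
Proof. exact: integrable_decay. Qed.

Let p1 : 0 <= 1 + al. Proof. by rewrite addr_ge0// ltW. Qed.

Let m_le1 (w : R) : m w <= 1.
Proof.
rewrite /m powRN invf_le1 ?powR_gt0 ?ltr_pwDl//.
have e1 : 1 `^ (1 + al) = 1 :> R by rewrite powR1.
have w1 : 1 <= 1 + `|w| by rewrite lerDl.
by rewrite -[leLHS]e1; apply: ge0_ler_powR => //; rewrite ?nnegrE ?p1// (le_trans _ w1).
Qed.

Let m_shift (r w z : R) : `|z| <= r -> m (w - z) <= (1 + r) `^ (1 + al) * m w.
Proof.
move=> zr; have r0 := le_trans (normr_ge0 z) zr.
have q1 : 0 < 1 + `|w - z| by rewrite ltr_pwDl.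
have p2 : 0 < 1 + `|w| by rewrite ltr_pwDl.
have p3 : 0 < 1 + r by rewrite ltr_pwDl.
rewrite /m !powRN ler_pdivlMr ?powR_gt0// mulrC ler_pdivrMr ?powR_gt0// -powRM ?(ltW q1) ?(ltW p3)//.
apply: ge0_ler_powR => //; rewrite ?nnegrE; [exact: ltW|exact: mulr_ge0 (ltW p3) (ltW q1)|].
have : `|w| <= `|w - z| + `|z| by rewrite -{1}(subrK z w) ler_normD.
have : 0 <= r * `|w - z| by rewrite mulr_ge0.
by move: `|w - z| `|w| `|z| zr => A B C zr ? ?; lra.
Qed.

Let iQ : cintegrable mu setT Q.
Proof.
have [C [C0 HC]] := laplace_ou_density_decay H_range theta_gt0 x_neq0 c2_gt0.
apply: (@cintegrable_dom _ _ _ mu _ measurableT _ _ mQ (fun z _ => HC z)).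
by apply: (integrableMc measurableT); exact: integrable_decay.
Qed.

Let iK : cintegrable mu setT K.
Proof.
have [C [C0 HC]] := K_le.
apply: (@cintegrable_dom _ _ _ mu _ measurableT _ _ mK (fun z _ => HC z)).
exact: (integrableMc measurableT).
Qed.

Let iexp (f : R -> R[i]) (b t : R) : cintegrable mu setT f ->
  cintegrable mu setT (fun w => cexp ((b +i* w)%C * t%:C%C) * f w).
Proof.
move=> i; have mf := cintegrable_cmeasurable i.
apply: (@cintegrable_dom _ _ _ mu _ measurableT _ (fun w => expR (b * t) * normc (f w))).
- apply: cmeasurableM => //; apply: cmeasurable_cexp; apply: cmeasurableM; last exact: cmeasurable_cst.
  by split; [exact: measurable_cst|exact: measurable_id].
- by move=> w _; rewrite normcM normc_cexp ReM/= mulr0 subr0.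
- by apply: (integrableMc measurableT); exact: (cintegrable_normc measurableT).
Qed.

Let E (r : R) := `[- r, r]%classic : set (measurableTypeR R).

Let mE (r : R) : measurable (E r). Proof. exact: measurable_itvR. Qed.

Let iQE (r : R) : cintegrable mu (E r) Q.
Proof. by case: iQ => i1 i2; split; [exact: integrableS i1|exact: integrableS i2]. Qed.

Let inner (w z : R) : R[i] := K (w - z) * Q z.

Let mshift (w : R) : measurable_fun setT (fun z : measurableTypeR R => (w - z : measurableTypeR R)).
Proof. exact: measurable_funB. Qed.

Let i_inner (r w : R) : cintegrable mu (E r) (inner w).
Proof.
have [C [C0 HC]] := K_le.
apply: (@cintegrable_dom _ _ _ mu _ (mE r) _ (fun z => C * normc (Q z))).
- apply: cmeasurableM; first exact: (cmeasurable_comp mK (measurable_funTS (mshift w))).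
  exact: cintegrable_cmeasurable (iQE r).
- move=> z _; rewrite normcM ler_wpM2r ?normc_ge0// (le_trans (HC _))//.
  by rewrite ler_piMr.
- by apply: (integrableMc (mE r)); exact: (cintegrable_normc (mE r)).
Qed.

Let full (t : R) (y : measurableTypeR R * measurableTypeR R) : R[i] :=
  cexp ((c1 +i* y.1)%C * t%:C%C) * inner y.1 y.2.

Let middleE (r t w : R) : Lhat_middle H theta c1 c2 Q t r w =
  cintegral mu (E r) (fun z => full t (w, z)).
Proof.
transitivity (cexp ((c1 +i* w)%C * t%:C%C) * cintegral mu (E r) (inner w)); last first.
  by rewrite -(cintegralZ (mE r) _ (i_inner r w)).
congr (_ * _).
by apply: eq_cintegral => z _; rewrite /Lhat_inner laplace_derive1_ou_variance.
Qed.

Let G (t u : R) : R[i] := cexp ((a +i* u)%C * t%:C%C) * K u.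

Let full_translate (t z w : R) :
  full t (w, z) = cexp ((c2 +i* z)%C * t%:C%C) * Q z * G t (w - z).
Proof.
rewrite /full /inner /G -[(w, z).1]/w -[(w, z).2]/z.
rewrite (vertical_split c1 c2 w z) mulrDl cexpD -/a; move: (cexp _) (cexp _) (K _) (Q _) => A B C F.
by rewrite [RHS]mulrACA [F * C]mulrC.
Qed.

Let integral_full (t z : R) : 0 < t -> cintegral mu setT (fun w => full t (w, z)) =
  (2 * pi * W t)%:C%C * (cexp ((c2 +i* z)%C * t%:C%C) * Q z).
Proof.
move=> t0; have iG : cintegrable mu setT (G t) by exact: iexp iK.
have msh : measurable_fun setT (fun w : R => w + - z) by exact: measurable_funD.
have iso := @lebesgue_measure_shift R (- z).
transitivity (cintegral mu setT (fun w => cexp ((c2 +i* z)%C * t%:C%C) * Q z * G t (w - z))).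
  by apply: eq_cintegral => w _; rewrite full_translate.
have iGz : cintegrable mu setT (fun w => G t (w - z)).
  by have := cintegrable_isometry msh iso measurableT iG; rewrite preimage_setT.
rewrite (cintegralZ measurableT _ iGz) [RHS]mulrC; congr (_ * _).
have := cintegral_isometry msh iso measurableT (cintegrable_cmeasurable iG).
rewrite preimage_setT => ->.
exact: (laplace_inversion t0 iW (cW t0) iK).
Qed.

Let mfull (r t : R) : cmeasurable ((setT : set (measurableTypeR R)) `*` E r) (full t).
Proof.
apply: cmeasurableM.
  apply: cmeasurable_cexp; apply: cmeasurableM; last exact: cmeasurable_cst.
  by split; [exact: measurable_cst|exact: (measurable_funTS measurable_fst)].
apply: cmeasurableM.
  have md : measurable_fun setT (fun y : measurableTypeR R * measurableTypeR R => (y.1 - y.2 : measurableTypeR R)).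
    exact: (measurable_funB measurable_fst measurable_snd).
  exact: (cmeasurable_comp mK (measurable_funTS md)).
exact: (cmeasurable_comp mQ (measurable_funTS measurable_snd)).
Qed.

Let full_le (r t : R) : exists C, forall w z : R, E r z ->
  normc (full t (w, z)) <= (C * m w) * normc (Q z).
Proof.
have [C [C0 HC]] := K_le.
exists (expR (c1 * t) * (C * (1 + r) `^ (1 + al))) => w z.
move=> Ez; have zr : `|z| <= r by move: Ez; rewrite /E/= in_itv/= ler_norml.
have -> : normc (full t (w, z)) = expR (c1 * t) * (normc (K (w - z)) * normc (Q z)).
  rewrite /full /inner !normcM normc_cexp; congr (expR _ * _).
  by rewrite ReM/= mulr0 subr0.
rewrite -[leRHS]mulrA -[leRHS]mulrA ler_wpM2l ?expR_ge0// [leRHS]mulrA ler_wpM2r ?normc_ge0//.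
by rewrite (le_trans (HC _))// -[leRHS]mulrA ler_wpM2l// m_shift.
Qed.

Let i_middle (r t : R) : cintegrable mu setT (Lhat_middle H theta c1 c2 Q t r).
Proof.
have [C HC] := full_le r t.
have i1 : mu.-integrable setT (EFin \o (fun w => C * m w)) by exact: (integrableMc measurableT).
have i2 := cintegrable_normc (mE r) (iQE r).
apply: (eq_cintegrable measurableT _ (cintegrable_Fubini1 measurableT (mE r) i1 i2 (mfull r t) (fun w z _ => HC w z))).
by move=> w _; rewrite middleE.
Qed.

Let integral_middle (r t : R) : 0 < t -> cintegral mu setT (Lhat_middle H theta c1 c2 Q t r) =
  cintegral mu (E r) (fun z => (2 * pi * W t)%:C%C * (cexp ((c2 +i* z)%C * t%:C%C) * Q z)).
Proof.
move=> t0; have [C HC] := full_le r t.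
have i1 : mu.-integrable setT (EFin \o (fun w => C * m w)) by exact: (integrableMc measurableT).
have i2 := cintegrable_normc (mE r) (iQE r).
transitivity (cintegral mu setT (fun w => cintegral mu (E r) (fun z => full t (w, z)))).
  by apply: eq_cintegral => w _; rewrite middleE.
rewrite (cintegral_Fubini measurableT (mE r) i1 i2 (mfull r t) (fun w z _ => HC w z)).
by apply: eq_cintegral => z _; rewrite integral_full.
Qed.

Let J (t : R) : R[i] := (4 * pi ^+ 2)%:C%C * (W t * h t)%:C%C.

Let cvg_middle (t : R) : 0 < t ->
  cintegral mu setT (Lhat_middle H theta c1 c2 Q t r) @[r --> +oo] --> (J t : R[i]^o).
Proof.
move=> t0; have i2 := cintegrableZ measurableT (2 * pi * W t)%:C%C (iexp c2 t iQ).
have E1 : cintegral mu setT (fun z => (2 * pi * W t)%:C%C * (cexp ((c2 +i* z)%C * t%:C%C) * Q z)) = J t.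
  rewrite (cintegralZ measurableT _ (iexp c2 t iQ)) (laplace_inversion t0 ih (ch t0) iQ) /J.
  by rewrite -!rmorphM; congr (_%:C%C); ring.
have := cintegral_truncate i2; rewrite E1.
by apply: cvg_trans; apply: near_eq_cvg; apply: nearW => r; rewrite integral_middle.
Qed.

Variable Psi : R[i] -> R[i].
Hypothesis Psi_gt0 : forall l, Hstar l -> 0 < complex.Re (Psi l).
Variable v : R[i] -> R -> R[i].
Hypothesis vE : forall l, Hstar l -> v l x = l^-1 * laplace (ou_density' H theta ^~ x) (Psi l).

Let symbolE (g : R[i] -> R[i]) (z : R[i]) : 0 < complex.Re z -> local_inverse Psi z g ->
  laplace h z = symbol v x g z.
Proof.
move=> rz /nbhs_singleton[gz gE _].
have z0 : z != 0 by apply/eqP => zE; move: rz; rewrite zE ltxx.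
have gz0 : g z != 0 by apply/eqP => zE; move: gz; rewrite /Hstar/= zE ltxx.
rewrite /symbol vE// gE; have [_ _ ->] := laplace_ou_density H_range theta_gt0 x_neq0 rz.
by rewrite [g z / z]mulrC -mulrA [g z * _]mulrA mulfV// mul1r.
Qed.

Lemma is_Lhat_at_ou (l : R[i]) : Hstar l ->
  is_Lhat_at H theta c1 c2 Psi v l x (laplace (fun t => W t * ou_density H theta t x) (Psi l)).
Proof.
move=> Hl; have rl := Psi_gt0 Hl.
have [Kh [Kh0 HKh]] := ou_density_bounds H_range theta_gt0 x_neq0.
have [hl _ _] := laplace_ou_density H_range theta_gt0 x_neq0 rl.
have il : has_laplace (fun t => W t * ou_density H theta t x) (Psi l).
  apply: (@cintegrable_dom _ _ _ mu _ mD _ (fun t => ou_rate H theta * normc (laplace_integrand h (Psi l) t))).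
  - apply: cmeasurableM; first exact: cmeasurable_cexp_mulNC.
    by apply: cmeasurable_real; apply: measurable_funM; apply: continuous_gt0_measurable.
  - move=> t Dt; have t0 : 0 < t by move: Dt; rewrite /D/= in_itv/= andbT.
    rewrite /laplace_integrand !normcM !normcC normrM mulrCA ler_wpM2r ?mulr_ge0 ?normc_ge0//.
    by rewrite gtr0_norm ?ou_variance'_gt0// ou_variance'_le.
  - by apply: (integrableMc mD); exact: (cintegrable_normc mD).
have p2 : (4 * pi ^+ 2 : R) != 0 by rewrite mulf_neq0 ?expf_neq0 ?gt_eqF ?pi_gt0.
exists Q, J; split.
- move=> z _; split; first by move=> g; exact: symbolE.
  move=> _; exists (laplace h); split=> //.
  - move=> y ry; apply: (@cdifferentiable_laplace R h Kh ch _ _ ry) => t t0.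
    by have [] := HKh _ t0.
  - by move=> y g ry; exact: symbolE.
- move=> r w _; apply: (eq_cintegrable (mE r) _ (i_inner r w)) => z _.
  by rewrite /Lhat_inner laplace_derive1_ou_variance.
- by move=> t r _ _; exact: i_middle.
- by move=> t; exact: cvg_middle.
have JE t : cexp (- Psi l * t%:C%C) * J t =
    (4 * pi ^+ 2)%:C%C * laplace_integrand (fun t => W t * ou_density H theta t x) (Psi l) t.
  by rewrite /J /laplace_integrand mulrCA.
split; first by apply: (eq_cintegrable mD _ (cintegrableZ mD _ il)) => t _; rewrite JE.
transitivity (((4 * pi ^+ 2)^-1)%:C%C * ((4 * pi ^+ 2)%:C%C *
    laplace (fun t => W t * ou_density H theta t x) (Psi l))).
  by rewrite mulrA -rmorphM mulVf// mul1r.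
congr (_ * _); rewrite -(cintegralZ mD _ il); apply: eq_cintegral => t _.
by rewrite JE.
Qed.

End Assembly.

(** * The inverse subordinator *)

Section LaplaceExponent.
Context {R : realType}.

Let f (a b x : R) : R := 1 - expR (- (a * x)) * cos (b * x).

Let f_gt0 (a b x : R) : 0 < a -> 0 < x -> 0 < f a b x.
Proof.
move=> a0 x0; rewrite subr_gt0 (@le_lt_trans _ _ (expR (- (a * x))))//.
  by rewrite ler_piMr ?expR_ge0// cos_le1.
by rewrite expR_lt1 oppr_lt0 mulr_gt0.
Qed.

Let f_le (a b x : R) : 0 < a -> 0 < x -> f a b x <= (2 + a + `|b|) * Num.min 1 x.
Proof.
move=> a0 x0; have b0 : 0 <= `|b| by [].
have [x1|x1] := leP 1 x.
  rewrite mulr1 (@le_trans _ _ 2)//; last by lra.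
  have E1 : expR (- (a * x)) <= 1 by rewrite expR_le1 oppr_le0 mulr_ge0// ltW.
  have : - 1 <= expR (- (a * x)) * cos (b * x).
    rewrite (@le_trans _ _ (- expR (- (a * x))))//; first by rewrite lerN2.
    by rewrite -mulrN1 ler_wpM2l ?expR_ge0// cos_geN1.
  by rewrite /f; lra.
pose f' (y : R) := expR (- (a * y)) * (a * cos (b * y) + b * sin (b * y)).
have dl (k y : R) : is_derive y 1 (fun y : R => k * y) k.
  by apply: is_derive_eq; rewrite /GRing.scale/=; ring.
have dn (y : R) : is_derive y 1 (fun y : R => - (a * y)) (- a).
  exact: is_deriveN (dl a y).
have df (y : R) : is_derive y 1 (f a b) (f' y).
  have de := @is_derive1_comp R _ _ y _ _ (is_derive_expR (- (a * y))) (dn y).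
  have dc := @is_derive1_comp R _ _ y _ _ (is_derive_cos (b * y)) (dl b y).
  apply: (is_derive_eq (is_deriveB (is_derive_cst (1 : R) y 1) (is_deriveM de dc))).
  rewrite /f' /GRing.scale/= sub0r.
  by move: (expR _) (cos _) (sin _) => A B C; ring.
have [|c] := @MVT_segment R (f a b) f' 0 x (ltW x0) (fun y _ => df y).
  apply: continuous_subspaceT => y; apply/differentiable_continuous/derivable1_diffP.
  by case: (df y).
rewrite in_itv/= => /andP[c0 _].
have -> : f a b 0 = 0 by rewrite /f !mulr0 oppr0 expR0 cos0 mulr1 subrr.
rewrite !subr0 => ->; rewrite ler_wpM2r ?(ltW x0)//.
have E1 : expR (- (a * c)) <= 1 by rewrite expR_le1 oppr_le0 mulr_ge0// ltW.
rewrite (le_trans (ler_norm _))// /f' normrM ger0_norm ?expR_ge0//.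
rewrite (@le_trans _ _ (1 * (a + `|b|)))//; last by rewrite mul1r; lra.
apply: ler_pM; rewrite ?expR_ge0 ?normr_ge0 ?E1//.
rewrite (le_trans (ler_normD _ _))// !normrM (gtr0_norm a0) lerD//.
  by rewrite ler_piMr ?(ltW a0)// ler_norml cos_geN1 cos_le1.
by rewrite ler_piMr// ler_norml sin_geN1 sin_le1.
Qed.

Lemma laplace_exponent_gt0 (nu : {measure set R -> \bar R}) (l : R[i]) :
  levy_measure nu -> nu [set` `]0, +oo[] = +oo%E -> Hstar l ->
  0 < complex.Re (laplace_exponent nu l).
Proof.
case: l => a b [_ nu1] nuoo a0; have {}a0 : 0 < a by [].
pose D := `]0, +oo[%classic : set R.
have mD : measurable D by exact: measurable_itv.
have E x : complex.Re (1 - cexp (- (a +i* b)%C * x%:C%C)) = f a b x.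
  by rewrite /f /= !mulr0 subr0 add0r !mulNr cosN.
have mf : measurable_fun D (f a b).
  apply: measurable_funTS; apply: continuous_measurable_fun => x.
  apply: cvgB; first exact: cvg_cst.
  apply: cvgM; apply: continuous_comp; [|exact: continuous_expR| |exact: continuous_cos].
    by apply: cvgN; apply: cvgM; [exact: cvg_cst|exact: cvg_id].
  by apply: cvgM; [exact: cvg_cst|exact: cvg_id].
have D0 x : D x -> 0 < x by rewrite /D/= in_itv/= andbT.
have im : nu.-integrable D (EFin \o (fun x => Num.min 1 x)).
  apply/integrableP; split.
    by apply/measurable_EFinP; apply: measurable_funTS; exact: measurable_minr.
  apply: le_lt_trans nu1; rewrite le_eqVlt; apply/orP; left; apply/eqP.
  apply: eq_integral => x; rewrite inE => /D0 x0 /=.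
  by rewrite ger0_norm// le_min ler01 ltW.
have iff : nu.-integrable D (EFin \o f a b).
  apply: (@integrable_dom _ _ _ nu _ mD _ (fun x => (2 + a + `|b|) * Num.min 1 x)) => //.
    by move=> x /D0 x0; rewrite gtr0_norm ?f_gt0// f_le.
  exact: (integrableMc mD).
have -> : complex.Re (laplace_exponent nu (a +i* b)%C) = \int[nu]_(x in D) f a b x.
  by apply: eq_Rintegral => x _; rewrite E.
rewrite lt_neqAle Rintegral_ge0 ?andbT; last by move=> x /D0 x0; rewrite ltW// f_gt0.
apply/eqP => I0.
have I1 : (\int[nu]_(x in D) `|(f a b x)%:E| = 0)%E.
  rewrite (eq_integral (EFin \o f a b)); last first.
    by move=> x; rewrite inE => /D0 x0 /=; rewrite gtr0_norm// f_gt0.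
  by rewrite -(fineK (integrable_fin_num mD iff)) -[X in (X)%:E]I0.
have mf' : measurable_fun D (EFin \o f a b) by exact/measurable_EFinP.
have [N [mN N0 DN]] := (ae_eq_integral_abs nu mD mf').1 I1.
have : (nu D <= nu N)%E.
  apply: le_measure; rewrite ?inE//; apply: subset_trans DN => x Dx /= /(_ Dx)[].
  by apply/eqP; rewrite gt_eqF// f_gt0// D0.
by rewrite N0 nuoo.
Qed.

End LaplaceExponent.

Section InverseProcess.
Context {R : realType} d (Omega : measurableType d) (P : probability Omega R).
Notation mu := (@lebesgue_measure R).
Variable sigma : R -> {RV P >-> R}.
Hypothesis sigma_mono : forall w (s t : R), 0 <= s -> s <= t -> sigma s w <= sigma t w.
Hypothesis sigma_rc : forall w (t : R), 0 <= t -> sigma s w @[s --> t^'+] --> sigma t w.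

Let E (t : R) (w : Omega) : R := inverse_process sigma t w.
Let S (t : R) (w : Omega) : set R := [set y | 0 < y /\ t < sigma y w].

Let S_lb t w : lbound (S t w) 0. Proof. by move=> y [/ltW]. Qed.

Let E_ge0 t w : 0 <= E t w.
Proof.
rewrite /E /inverse_process -/(S t w).
have [[y Sy]|Sn] := pselect (exists y, S t w y).
  by apply: lb_le_inf; [exists y|exact: S_lb].
have -> : S t w = set0 by rewrite -subset0 => y Sy; apply: Sn; exists y.
by rewrite inf0.
Qed.

Let sigma_le_of_lt_inverse t s w : 0 < s -> s < E t w -> sigma s w <= t.
Proof.
move=> s0 sE; rewrite leNgt; apply/negP => ts; move: sE; rewrite ltNge => /negP; apply.
by apply: ge_inf; [exists 0; exact: S_lb|split].
Qed.

Let inverse_ge t s w y : 0 < s -> sigma s w <= t -> S t w y -> s <= E t w.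
Proof.
move=> s0 st Sy; apply: lb_le_inf; first by exists y.
move=> u [u0 tu]; rewrite leNgt; apply/negP => us.
by move: tu; rewrite ltNge (le_trans _ st)// sigma_mono// ltW.
Qed.

Let msig (s : R) (A : set R) : measurable A -> measurable (sigma s @^-1` A).
Proof. by move=> mA; rewrite -[X in measurable X]setTI; exact: measurable_funP. Qed.

Lemma measurable_inverse_process (t : R) : measurable_fun setT (E t).
Proof.
apply: (measurability _ (RGenOInfty.measurableE R)) => _ [_ [s ->] <-]; rewrite setTI.
have [s0|s0] := ltP s 0.
  have -> : E t @^-1` `]s, +oo[ = setT.
    by apply/seteqP; split => // w _ /=; rewrite in_itv/= andbT (lt_le_trans s0).
  exact: measurableT.
pose A (n : nat) := sigma n.+1%:R @^-1` `]t, +oo[.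
pose B (q : rat) := if s < ratr q then sigma (ratr q) @^-1` `]-oo, t] else set0.
have -> : E t @^-1` `]s, +oo[ = (\bigcup_n A n) `&` (\bigcup_q B q).
  apply/seteqP; split => w /=.
    rewrite in_itv/= andbT => sE; split.
      have [[y [y0 ty]]|Sn] := pselect (exists y, S t w y).
        exists (Num.truncn y) => //=; rewrite /A/= in_itv/= andbT (lt_le_trans ty)//.
        by rewrite sigma_mono ?(ltW y0)// ltW// truncnS_gt.
      move: sE; rewrite /E /inverse_process -/(S t w).
      have -> : S t w = set0 by rewrite -subset0 => y Sy; apply: Sn; exists y.
      by rewrite inf0 ltNge s0.
    have [q] := rat_in_itvoo sE; rewrite in_itv/= => /andP[sq qE].
    by exists q => //; rewrite /B sq/= in_itv/= sigma_le_of_lt_inverse// (le_lt_trans s0).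
  move=> [[n _ An] [q _]]; rewrite /B; case: ifPn => // sq /=; rewrite !in_itv/= andbT => qt.
  rewrite (lt_le_trans sq)//; apply: (@inverse_ge t _ w n.+1%:R (le_lt_trans s0 sq) qt).
  by split; [rewrite ltr0n|move: An; rewrite /A/= in_itv/= andbT].
apply: measurableI; first by apply: bigcupT_measurable => n; apply: msig; exact: measurable_itv.
apply: bigcupT_measurable_rat => q; rewrite /B; case: ifPn => // _.
by apply: msig; exact: measurable_itv.
Qed.

(* On paths of [sigma] that stay below [t] the inverse process takes the junk
   value [inf set0 = 0]; this event is null because [E t] has a density. *)
Lemma subordinator_cdf (f : R -> R) (s t : R) : 0 < s -> 0 < t -> is_pdf P (E t) f ->
  P [set w | sigma s w <= t] = (\int[mu]_(y in `]s, +oo[) (f y)%:E)%E.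
Proof.
move=> s0 t0 [mf f0 fE].
have mE (A : set R) : measurable A -> measurable (E t @^-1` A).
  by move=> mA; rewrite -[X in measurable X]setTI; exact: measurable_inverse_process.
have ms : measurable [set w | sigma s w <= t].
  have -> : [set w | sigma s w <= t] = sigma s @^-1` `]-oo, t].
    by apply/seteqP; split => w /=; rewrite in_itv.
  by apply: msig; exact: measurable_itv.
have P1 (c : R) : P (E t @^-1` [set c]) = 0%E by rewrite fE ?integral_set1.
have mI : measurable (`]s, +oo[%classic : set R) by exact: measurable_itv.
apply/eqP; rewrite eq_le; apply/andP; split; last first.
  rewrite -fE//; apply: le_measure; rewrite ?inE//; first exact: mE.
  by move=> w /=; rewrite in_itv/= andbT; exact: sigma_le_of_lt_inverse.
rewrite -[leRHS]fE// (@le_trans _ _ (P (E t @^-1` `]s, +oo[ `|` (E t @^-1` [set s] `|` E t @^-1` [set 0]))))//.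
  apply: le_measure; rewrite ?inE//.
    by apply: measurableU; [exact: mE|apply: measurableU; exact: mE].
  move=> w /= st; rewrite in_itv/= andbT.
  have [[y Sy]|Sn] := pselect (exists y, S t w y).
    have := inverse_ge s0 st Sy; rewrite le_eqVlt => /predU1P[->|]; [by right; left|by left].
  right; right; rewrite /E /inverse_process -/(S t w).
  have -> : S t w = set0 by rewrite -subset0 => y Sy; apply: Sn; exists y.
  exact: inf0.
apply: (le_trans (measureU2 P _ _)); [exact: mE|by apply: measurableU; exact: mE|].
rewrite -[leRHS]adde0 leeD2l//; apply: (le_trans (measureU2 P _ _)); [exact: mE|exact: mE|].
by rewrite [X in (X + _ <= _)%E](P1 s) [X in (_ + X <= _)%E](P1 0) adde0.
Qed.

Let D := `]0, +oo[%classic : set (measurableTypeR R).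

Lemma measurable_subordinator :
  measurable_fun (setT `*` D) (fun z : Omega * measurableTypeR R => sigma z.2 z.1).
Proof.
have mD : measurable D by exact: measurable_itvR.
apply: (measurability _ (RGenInftyO.measurableE R)) => _ [_ [a ->] <-].
pose B (q : rat) := (sigma (ratr q) @^-1` `]-oo, a[) `*` (`]0, ratr q[%classic : set (measurableTypeR R)).
have -> : (setT `*` D) `&` (fun z : Omega * measurableTypeR R => sigma z.2 z.1) @^-1` `]-oo, a[ =
    \bigcup_q B q.
  apply/seteqP; split => -[w s] /=.
    move=> [[_ Ds]]; rewrite in_itv/= => sa.
    have s0 : 0 < s by move: Ds; rewrite /D/= in_itv/= andbT.
    have : \forall r \near s^'+, sigma r w < a by exact: cvgr_lt (@sigma_rc w s (ltW s0)) _ sa.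
    move=> [e /= e0 He].
    have [q] : exists q : rat, ratr q \in `]s, (s + e)[ by apply: rat_in_itvoo; rewrite ltrDl.
    rewrite in_itv/= => /andP[sq qe]; exists q => //; split => /=; rewrite in_itv/=.
      by apply: He => //; rewrite /ball/= ltr_distlC; apply/andP; split; lra.
    by rewrite s0 sq.
  move=> [q _ [/=]]; rewrite !in_itv/= => qa /andP[s0 sq].
  split; first by split=> //; rewrite /D/= in_itv/= andbT.
  by rewrite (le_lt_trans _ qa)// sigma_mono// ltW.
apply: bigcupT_measurable_rat => q; apply: measurableX; last exact: measurable_itvR.
by apply: msig; exact: measurable_itv.
Qed.

End InverseProcess.

Lemma normr_natrb_le1 {R : realType} (b : bool) : `|b%:R| <= 1 :> R.
Proof. by case: b; rewrite ?normr1 ?normr0. Qed.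

Lemma laplace_cdf_prod {R : realType} d1 d2 (T1 : measurableType d1) (T2 : measurableType d2)
    (m1 : {sigma_finite_measure set T1 -> \bar R}) (m2 : {sigma_finite_measure set T2 -> \bar R})
    (D : set (T1 * T2)) (w tau : T1 * T2 -> R) z (rho : R) :
  measurable D -> measurable_fun D w -> measurable_fun D tau ->
  (forall x, D x -> 0 <= tau x) -> 0 <= rho -> rho < complex.Re z ->
  (m1 \x m2)%E.-integrable D (EFin \o (fun x => `|w x| * expR (- (rho * tau x)))) ->
  let u t := \int[(m1 \x m2)%E]_(x in D) (w x * (tau x <= t)%R%:R) in
  has_laplace u z /\
  laplace u z = z^-1 * cintegral (m1 \x m2)%E D (fun x => cexp (- z * (tau x)%:C%C) * (w x)%:C%C).
Proof.
(* The library provides the mixins, but no structure, for the sigma-finite product. *)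
pose M : {sigma_finite_measure set (T1 * T2)%type -> \bar R} := HB.pack (m1 \x m2)%E
  (lebesgue_integral_fubini.measure_function_Measure_isSigmaFinite__to__measure_function_isSFinite m1 m2)
  (lebesgue_integral_fubini.measure_function_Measure_isSigmaFinite__to__measure_function_isSigmaFinite m1 m2).
exact: (@laplace_cdf R _ (T1 * T2)%type M D w tau z rho).
Qed.

Section DensityTransform.
Context {R : realType}.
Notation mu := (@lebesgue_measure R).
Variables (H theta : R).
Hypotheses (H_range : 2^-1 < H < 1) (theta_gt0 : 0 < theta).
Context (nu : {measure set R -> \bar R}) d (Omega : measurableType d) (P : probability Omega R).
Variable sigma : R -> {RV P >-> R}.
Hypothesis sigma_sub : driftless_subordinator nu sigma.
Variable fE : R -> R -> R.
Hypothesis fE_pdf : forall t : R, 0 < t -> is_pdf P (inverse_process sigma t) (fE t).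
Variable x : R.
Hypothesis x_neq0 : x != 0.

Let h := ou_density H theta ^~ x.
Let h1 := ou_density' H theta ^~ x.
Let D := `]0, +oo[%classic : set (measurableTypeR R).
Let mD : measurable D. Proof. exact: measurable_itvR. Qed.
Let D_gt0 s : D s -> 0 < s. Proof. by rewrite /D/= in_itv/= andbT. Qed.

Let sigma_mono w (s t : R) : 0 <= s -> s <= t -> sigma s w <= sigma t w.
Proof. by case: sigma_sub => _ + _ _; apply. Qed.

Let sigma_rc w (t : R) : 0 <= t -> sigma s w @[s --> t^'+] --> sigma t w.
Proof. by case: sigma_sub => _ _ + _; apply. Qed.

Let sigma_ge0 w (t : R) : 0 <= t -> 0 <= sigma t w.
Proof. by move=> t0; case: sigma_sub => s0 _ _ _; rewrite -(s0 w) sigma_mono. Qed.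

Let mh1 : measurable_fun D h1.
Proof. by apply: continuous_gt0_measurable => t t0; exact: continuous_ou_density'. Qed.

Let ih1 : mu.-integrable D (EFin \o h1).
Proof.
have [K [K0 HK]] := ou_density_bounds H_range theta_gt0 x_neq0.
apply: (@integrable_dom _ _ _ mu _ mD _ (fun t => K * ou_variance' H theta t) mh1).
  by move=> t /D_gt0 t0; have [] := HK _ t0.
exact: (integrableMc mD _ (integrable_ou_variance' H_range theta_gt0)).
Qed.

Let ih1n : mu.-integrable D (EFin \o (fun s => `|h1 s|)). Proof. exact: integrable_abse ih1. Qed.

Let iP1 : P.-integrable setT (EFin \o (fun=> 1 : R)).
Proof. exact: finite_measure_integrable_cst. Qed.

Let mfE (t : R) : 0 < t -> measurable_fun setT (fE t : measurableTypeR R -> R).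
Proof. by move=> /fE_pdf[]. Qed.

Let ifE (t : R) : 0 < t -> mu.-integrable setT (EFin \o fE t).
Proof.
move=> t0; have [mf f0 fP] := fE_pdf t0.
apply/integrableP; split; first by apply/measurable_EFinP; exact: (mfE t0).
have E1 : (\int[mu]_y (fE t y)%:E = 1)%E.
  by rewrite -[LHS](fP setT measurableT) preimage_setT probability_setT.
apply: (@le_lt_trans _ _ 1%E); last exact: ltry.
by rewrite -E1 le_eqVlt; apply/orP; left; apply/eqP; apply: eq_integral => y _ /=; rewrite ger0_norm.
Qed.

Let cdfE (t s : R) : 0 < t -> 0 < s ->
  fine (P [set w | sigma s w <= t]) = \int[mu]_(y in D) (fE t y * (s <= y)%R%:R).
Proof.
move=> t0 s0; rewrite (subordinator_cdf sigma_mono s0 t0 (fE_pdf t0)).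
rewrite (Rintegral_tail (ltW s0) (mfE t0)).
rewrite -Rintegral_itv_obnd_cbnd//.
by apply: integrableS (ifE t0) => //; exact: measurable_itvR.
Qed.

Let u t := \int[(P \x mu)%E]_(z in setT `*` D) (h1 z.2 * (sigma z.2 z.1 <= t)%R%:R).

Let msigma := measurable_subordinator sigma_mono sigma_rc.

Let mh1s : measurable_fun ((setT : set Omega) `*` D) (fun z => h1 z.2).
Proof.
apply: (measurable_comp mD _ mh1); first by move=> _ [[w y] [_ Dy] <-].
exact: measurable_funTS.
Qed.

Let mXD : measurable ((setT : set Omega) `*` D). Proof. exact: measurableX. Qed.

Let m_u (t : R) : measurable_fun ((setT : set Omega) `*` D) (fun z => h1 z.2 * (sigma z.2 z.1 <= t)%R%:R).
Proof.
apply: measurable_funM => //; apply: measurable_bool_natr => //.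
by apply: measurable_fun_ler => //; exact: measurable_cst.
Qed.

Let u_le (t : R) (w : Omega) (s : R) : setT w -> D s ->
  `|h1 s * (sigma s w <= t)%R%:R| <= 1 * `|h1 s|.
Proof. by move=> _ _; rewrite mul1r normrM ler_piMr// normr_natrb_le1. Qed.

Let int_sigma (s t : R) : \int[P]_w ((sigma s w <= t)%R%:R : R) = fine (P [set w | sigma s w <= t]).
Proof.
have ms : measurable [set w | sigma s w <= t].
  have -> : [set w | sigma s w <= t] = sigma s @^-1` `]-oo, t].
    by apply/seteqP; split => w /=; rewrite in_itv.
  by rewrite -[X in measurable X]setTI; exact: measurable_funP.
rewrite -[P _]/(P _) -(setIT [set w | _]) -(integral_indic P measurableT ms).
rewrite /Rintegral; congr fine; apply: eq_integral => w _.
rewrite indicE (_ : (w \in _) = (sigma s w <= t))//.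
by apply/idP/idP => st; [move: st; rewrite inE|rewrite inE].
Qed.

Let uE (t : R) : u t = \int[mu]_(s in D) (h1 s * fine (P [set w | sigma s w <= t])).
Proof.
rewrite /u (Rintegral_prod measurableT mD iP1 ih1n (m_u t) (@u_le t)).
rewrite (Rintegral_Fubini measurableT mD iP1 ih1n (m_u t) (@u_le t)).
apply: eq_Rintegral => s; rewrite inE => Ds /=.
rewrite RintegralZl// ?int_sigma//.
apply: (@integrable_dom _ _ _ P _ measurableT _ (fun=> 1)) => //.
  apply: measurable_bool_natr => //; apply: measurable_fun_ler; [exact: measurable_funP|exact: measurable_cst].
by move=> w _; exact: normr_natrb_le1.
Qed.

Let hE (y : R) : 0 < y -> h y = \int[mu]_(s in D) (h1 s * (s <= y)%R%:R).
Proof.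
move=> y0; have [K [K0 HK]] := ou_density_bounds H_range theta_gt0 x_neq0.
have -> : h y = \int[mu]_(s in `]0, y]) h1 s.
  apply: (@primitive_from0 R h h1 K) => //.
  - exact: ou_density0.
  - exact: ou_density'0.
  - by move=> t t0; exact: is_derive_ou_density.
  - by move=> t t0; exact: continuous_ou_density'.
  - by move=> t /HK[].
  - by move=> t /HK[].
rewrite [RHS]Rintegral_mkcond [LHS]Rintegral_mkcond.
apply: eq_Rintegral => r _; rewrite !patchE !mem_setE !in_itv/= andbT.
by case: (ltP 0 r) => //= r0; case: ifP => _; rewrite ?mulr1 ?mulr0.
Qed.

Lemma inverse_mixture_cdf (t : R) : 0 < t ->
  \int[mu]_(y in `]0, +oo[) (h y * fE t y) = u t.
Proof.
move=> t0; rewrite uE; have [_ f0 _] := fE_pdf t0.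
pose g (z : measurableTypeR R * measurableTypeR R) : R := h1 z.1 * (fE t z.2 * (z.1 <= z.2)%R%:R).
have iD : mu.-integrable D (EFin \o fE t) by apply: integrableS (ifE t0).
have mg : measurable_fun (D `*` D) g.
  have mDD : measurable (D `*` D) by exact: measurableX.
  apply: measurable_funM.
    apply: (measurable_comp mD _ mh1); first by move=> _ [[a b] [Da _] <-].
    exact: (measurable_funTS measurable_fst).
  apply: measurable_funM.
    exact: (measurableT_comp (mfE t0) (measurable_funTS measurable_snd)).
  apply: measurable_bool_natr => //; apply: measurable_fun_ler.
    exact: (measurable_funTS measurable_fst).
  exact: (measurable_funTS measurable_snd).
have gle s y : D s -> D y -> `|g (s, y)| <= `|h1 s| * fE t y.
  by move=> _ _; rewrite /g normrM ler_wpM2l// normrM (ger0_norm (f0 _)) ler_piMr// normr_natrb_le1.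
transitivity (\int[mu]_(y in D) \int[mu]_(s in D) g (s, y)).
  apply: eq_Rintegral => y; rewrite inE => Dy; rewrite hE ?D_gt0// -RintegralZr//.
    by apply: eq_Rintegral => s _; rewrite /g/=; ring.
  apply: (@integrable_dom _ _ _ mu _ mD _ (fun s => `|h1 s|)) => //.
    apply: measurable_funM => //; apply: measurable_bool_natr => //.
    by apply: measurable_fun_ler; [exact: measurable_id|exact: measurable_cst].
  by move=> s _; rewrite normrM ler_piMr// normr_natrb_le1.
rewrite -(Rintegral_Fubini mD mD ih1n iD mg gle).
apply: eq_Rintegral => s; rewrite inE => Ds; rewrite (cdfE t0 (D_gt0 Ds)).
apply: (@RintegralZl _ _ R mu D (fun y => fE t y * (s <= y)%R%:R) (h1 s) mD).
apply: (@integrable_dom _ _ _ mu _ mD _ (fE t)) => //.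
  apply: measurable_funM; first exact: (measurable_funTS (mfE t0)).
  apply: measurable_bool_natr => //.
  by apply: measurable_fun_ler; [exact: measurable_cst|exact: measurable_id].
by move=> y _; rewrite normrM (ger0_norm (f0 _)) ler_piMr// normr_natrb_le1.
Qed.

Lemma laplace_inverse_mixture (p : R -> R) (l : R[i]) : Hstar l ->
  (forall t : R, 0 < t -> p t = \int[mu]_(y in `]0, +oo[) (h y * fE t y)) ->
  has_laplace p l /\
  laplace p l = l^-1 * laplace h1 (laplace_exponent nu l).
Proof.
move=> Hl pE.
have s0 (z : Omega * measurableTypeR R) : ((setT : set Omega) `*` D) z -> 0 <= sigma z.2 z.1.
  by move=> [_ /D_gt0/ltW]; exact: sigma_ge0.
have iw : (P \x mu)%E.-integrable (setT `*` D)
    (EFin \o (fun z : Omega * measurableTypeR R => `|h1 z.2| * expR (- (0 * sigma z.2 z.1)))).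
  have mw : measurable_fun ((setT : set Omega) `*` D) (fun z => `|h1 z.2|).
    exact: measurableT_comp.
  have wl (w : Omega) (s : measurableTypeR R) : setT w -> D s -> `| `|h1 s| | <= 1 * `|h1 s| by rewrite normr_id mul1r.
  apply: (integrable_congr mXD _ (integrable_prod measurableT mD iP1 ih1n mw wl)) => z _ /=.
  by rewrite mul0r oppr0 expR0 mulr1.
have [i e] := laplace_cdf_prod mXD mh1s msigma s0 (lexx 0) Hl iw.
have E t : D t -> laplace_integrand p l t = laplace_integrand u l t.
  by move=> /D_gt0 t0; rewrite /laplace_integrand pE// inverse_mixture_cdf.
split; first by apply: (eq_cintegrable mD _ i) => t Dt; rewrite E.
rewrite -[LHS]/(cintegral mu D (laplace_integrand p l)) (eq_cintegral _ E).
rewrite -[LHS]/(laplace u l) e; congr (_ * _).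
pose f (z : Omega * measurableTypeR R) : R[i] := cexp (- l * (sigma z.2 z.1)%:C%C) * (h1 z.2)%:C%C.
have mf : cmeasurable (setT `*` D) f.
  apply: cmeasurableM; last exact: cmeasurable_real.
  apply: cmeasurable_cexp; apply: cmeasurableM; first exact: cmeasurable_cst.
  exact: cmeasurable_real.
have fle w s : setT w -> D s -> normc (f (w, s)) <= 1 * `|h1 s|.
  move=> _ Ds; rewrite normcM normcC ler_wpM2r// normc_cexp_mulNC expR_le1 oppr_le0.
  apply: mulr_ge0; [exact: ltW|apply: sigma_ge0; exact/ltW/D_gt0].
rewrite (cintegral_prod measurableT mD iP1 ih1n mf fle) (cintegral_Fubini measurableT mD iP1 ih1n mf fle).
apply: eq_cintegral => s Ds; rewrite /f/=.
have is0 : cintegrable P setT (fun w => cexp (- l * (sigma s w)%:C%C)).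
  apply: (@cintegrable_dom _ _ _ P _ measurableT _ (fun=> 1)) => //.
    apply: cmeasurable_cexp; apply: cmeasurableM; first exact: cmeasurable_cst.
    by apply: cmeasurable_real; exact: measurable_funP.
  move=> w _; rewrite normc_cexp_mulNC expR_le1 oppr_le0.
  apply: mulr_ge0; [exact: ltW|apply: sigma_ge0; exact/ltW/D_gt0].
rewrite (cintegralZr measurableT _ is0) /laplace_integrand; congr (_ * _).
have [_ _ _ [_ _ H3]] := sigma_sub.
by rewrite (H3 s l (ltW (D_gt0 Ds)) Hl) mulNr mulNr [X in cexp (- X)]mulrC.
Qed.

End DensityTransform.

Theorem theorem7p1 (R : realType) (H theta c1 c2 : R)
  (H_range : 2^-1 < H < 1) (theta_gt0 : 0 < theta)
  (c1_lt0 : c1 < 0) (c2_gt0 : 0 < c2) (c12 : - theta^-1 < c1 - c2)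
  (nu : {measure set R -> \bar R})
  (nu_levy : levy_measure nu) (nu_infinite : nu [set` `]0, +oo[] = +oo%E)
  (d : measure_display) (Omega : measurableType d) (P : probability Omega R)
  (B sigma : R -> {RV P >-> R})
  (B_fbm : fractional_brownian_motion H B)
  (sigma_sub : driftless_subordinator nu sigma)
  (E_U_indep :
     independent_processes P (inverse_process sigma) (fractional_ou theta B))
  (fE : R -> R -> R)
  (fE_pdf : forall t : R, 0 < t -> is_pdf P (inverse_process sigma t) (fE t))
  (E_moment : forall t : R, 0 < t ->
     ('E_P[fun w => (inverse_process sigma t w `^ (- H))%R] < +oo)%E)
  (p : R -> R -> R)
  (p_pdf : forall t : R, 0 < t ->
     is_pdf P (fun w => fractional_ou theta B (inverse_process sigma t w) w)
       (p t))
  (pE : forall t x : R, 0 < t ->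
     p t x = \int[lebesgue_measure]_(y in `]0, +oo[)
               (ou_density H theta y x * fE t y))
  (p0 : forall x : R, x != 0 -> p 0 x = 0) :
  mild_solution H theta c1 c2 (laplace_exponent nu) [set x | x != 0] p.
Proof.
have Psi_gt0 l (Hl : Hstar l) := laplace_exponent_gt0 nu_levy nu_infinite Hl.
have pL x l (x0 : x != 0) (Hl : Hstar l) := laplace_inverse_mixture H_range theta_gt0 sigma_sub
  fE_pdf x0 Hl (fun t => pE t x).
split; first by move=> l x Hl x0; have [] := pL x l x0 Hl.
exists (fun l x => laplace (fun t => ou_variance' H theta t * ou_density H theta t x) (laplace_exponent nu l)).
exists (fun l x => 2 * laplace (ou_density' H theta ^~ x) (laplace_exponent nu l)).
split=> l x Hl x0.
- by apply: is_Lhat_at_ou => // l' Hl'; have [] := pL x l' x0 Hl'.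
- by apply: is_cderive2_laplace_product => //; exact: Psi_gt0.
- have [_ ->] := pL x l x0 Hl; rewrite p0// mulr0 subr0 invfM -!mulrA; congr (_ * _).
  by rewrite mulrCA; congr (_ * _); rewrite mulKf// (pnatr_eq0 _ 2).
Qed.
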